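(* Let $\omega>0$ and assume that $0\leq\sigma<\omega$. Then for every $\boldsymbol{x}\in L^2_\sigma\oplus L^2_\sigma$ the equalities $$\boldsymbol{\Psi}_{\omega}\boldsymbol{\Phi}_{\omega}\boldsymbol{x}=\boldsymbol{x},\qquad \boldsymbol{\Phi}_{\omega}\boldsymbol{\Psi}_{\omega}\boldsymbol{x}=\boldsymbol{x}$$ hold (as equalities of functions almost everywhere on $\mathbb{R}$).
   Context: Fix $\omega>0$ and put $C_{\omega}(t)=\frac{\omega}{\pi}\cdot\frac{1}{\cosh\omega t}$ for $t\in\mathbb{R}$ and $S_{\omega}(t)=\frac{\omega}{\pi}\cdot\frac{1}{\sinh\omega t}$ for $t\in\mathbb{R}\setminus\{0\}$. $L^1_\omega$ is the set of all measurable complex-valued functions $x$, defined almost everywhere on $\mathbb{R}$, with $\int_{\mathbb{R}}|x(\xi)|e^{-\omega|\xi|}d\xi<\infty$; $L^1_\omega\dotplus L^1_\omega$ is the set of $2\times1$ columns with both entries in $L^1_\omega$. For $x\in L^1_\omega$ define $$(\boldsymbol{C}_{\omega}x)(t)=\int_{\mathbb{R}}C_{\omega}(t-\tau)x(\tau)\,d\tau,\quad t\in\mathbb{R},$$ $$(\boldsymbol{S}_{\omega}x)(t)=\mathrm{p.v.}\int_{\mathbb{R}}S_{\omega}(t-\tau)x(\tau)\,d\tau=\lim_{\varepsilon\to+0}\int_{\mathbb{R}\setminus(t-\varepsilon,t+\varepsilon)}S_{\omega}(t-\tau)x(\tau)\,d\tau;$$ the first integral is finite for every $t$, and the limit exists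 for almost every $t\in\mathbb{R}$. For $\boldsymbol{x}=\begin{bmatrix}x_1\\ x_2\end{bmatrix}\in L^1_\omega\dotplus L^1_\omega$ the Akhiezer transforms are $$\boldsymbol{\Phi}_{\omega}\boldsymbol{x}=\begin{bmatrix}\boldsymbol{C}_{\omega}x_1+\boldsymbol{S}_{\omega}x_2\\ \boldsymbol{S}_{\omega}x_1+\boldsymbol{C}_{\omega}x_2\end{bmatrix},\qquad \boldsymbol{\Psi}_{\omega}\boldsymbol{x}=\begin{bmatrix}\boldsymbol{C}_{\omega}x_1-\boldsymbol{S}_{\omega}x_2\\ -\boldsymbol{S}_{\omega}x_1+\boldsymbol{C}_{\omega}x_2\end{bmatrix}.$$ For $\sigma\in\mathbb{R}$, $L^2_\sigma$ is the space of measurable functions $x$, defined almost everywhere on $\mathbb{R}$, with $\|x\|_{L^2_\sigma}=\big\{\int_{\mathbb{R}}|x(\tau)|^2e^{-2\sigma|\tau|}d\tau\big\}^{1/2}<\infty$. $L^2_\sigma\oplus L^2_\sigma$ is the space of $2\times1$ columns $\boldsymbol{x}$ with entries $x_1,x_2\in L^2_\sigma$, with norm $\sqrt{\|x_1\|^2_{L^2_\sigma}+\|x_2\|^2_{L^2_\sigma}}$. For $\sigma<\omega$ one has $L^2_\sigma\subset L^1_\omega$, so $\boldsymbol{\Phi}_\omega,\boldsymbol{\Psi}_\omega$ are defined on $L^2_\sigma\oplus L^2_\sigma$; for $0\le\sigma<\omega$ they map this space into itself, so the compositions are defined. *)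

(* Defs.v *)
From HB Require Import structures.
From mathcomp Require Import all_boot all_order all_algebra.
From mathcomp Require Import all_classical all_reals all_analysis.
From mathcomp Require Import complex.

Set Implicit Arguments.
Unset Strict Implicit.
Unset Printing Implicit Defensive.

Import Order.TTheory GRing.Theory Num.Theory.
Import numFieldNormedType.Exports.

Local Open Scope classical_set_scope.
Local Open Scope ring_scope.
Local Open Scope complex_scope.

Section Akhiezer.
Context {R : realType}.
Implicit Types (omega sigma t e : R) (f g x : R -> R[i]).

Definition cosh t : R := (expR t + expR (- t)) / 2.
Definition sinh t : R := (expR t - expR (- t)) / 2.

Definition C_kernel omega t : R := omega / pi * (cosh (omega * t))^-1.

(* The value at t = 0 is meaningless; the principal value never uses it. *)
Definition S_kernel omega t : R := omega / pi * (sinh (omega * t))^-1.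

Definition measurable_complex f : Prop :=
  measurable_fun [set: R] (fun t => complex.Re (f t)) /\
  measurable_fun [set: R] (fun t => complex.Im (f t)).

(* A function defined almost everywhere is represented by an arbitrary total
   extension. The measurable sets of lebesgue_measure are the Borel sets, so
   Lebesgue measurability means being a.e. equal to a Borel function. *)
Definition ae_measurable_complex f : Prop :=
  exists2 g, measurable_complex g & f = g %[ae lebesgue_measure].

Definition CintegralR (D : set R) f : R[i] :=
  Rintegral lebesgue_measure D (fun t => complex.Re (f t)) +i*
  Rintegral lebesgue_measure D (fun t => complex.Im (f t)).

Definition C_transform omega x : R -> R[i] := fun t =>
  CintegralR [set: R] (fun tau => (C_kernel omega (t - tau))%:C * x tau).

Definition S_truncated omega x t e : R[i] :=
  CintegralR (~` `]t - e, t + e[) (fun tau => (S_kernel omega (t - tau))%:C * x tau).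

(* R[i]^o is R[i] with the topology of its norm. On the null set of t where
   the limit does not exist, lim returns a default value. *)
Definition S_transform omega x : R -> R[i] := fun t =>
  lim ((S_truncated omega x t e : R[i]^o) @[e --> 0^'+]).

Definition column : Type := ((R -> R[i]) * (R -> R[i]))%type.
Implicit Types X Y : column.

Definition Phi omega X : column :=
  (fun t => C_transform omega X.1 t + S_transform omega X.2 t,
   fun t => S_transform omega X.1 t + C_transform omega X.2 t).

Definition Psi omega X : column :=
  (fun t => C_transform omega X.1 t - S_transform omega X.2 t,
   fun t => - S_transform omega X.1 t + C_transform omega X.2 t).

Definition L2 sigma : set (R -> R[i]) :=
  [set x | ae_measurable_complex x /\
    (\int[lebesgue_measure]_tau
       (Normc.normc (x tau) ^+ 2 * expR (- (2 * sigma * `|tau|)))%:E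
     < +oo)%E].

Definition L2_column sigma : set column :=
  [set X | L2 sigma X.1 /\ L2 sigma X.2].

Definition column_ae_eq X Y : Prop :=
  X.1 = Y.1 %[ae lebesgue_measure] /\ X.2 = Y.2 %[ae lebesgue_measure].

End Akhiezer.
Arguments column : clear implicits.

(* Main.v *)
Require Import Defs.
From HB Require Import structures.
From mathcomp Require Import all_boot all_order all_algebra.
From mathcomp Require Import all_classical all_reals all_analysis.
From mathcomp Require Import measurable_realfun complex.
From mathcomp Require Import ring lra.

Set Implicit Arguments.
Unset Strict Implicit.
Unset Printing Implicit Defensive.

Import Order.TTheory GRing.Theory Num.Theory.
Import numFieldNormedType.Exports.

Local Open Scope classical_set_scope.
Local Open Scope ring_scope.

(** The idea: shift the singular kernel off the real line.

    For s = 1 and s = -1 put T_s (x1, x2) = (C x1 + s S x2, C x2 + s S x1), so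
    that Phi and Psi are T_1 and T_(-1). If S commutes with C and S S = C C - 1,
    then the first entry of T_(-s) (T_s (x1, x2)) is
    C C x1 + s C S x2 - s S C x2 - S S x1 = x1, and the second one follows by
    exchanging x1 and x2 ([akhiezer_component]). So everything rests on the two
    relations S C = C S and S S = C C - 1.

    Take an angle th in ]0, pi/2[, a = cos th, b = sin th. Then
    1 / sinh (x + i th) = sn a b x - i pn b x and
    1 / cosh (x + i th) = pn a x - i sn b a x.
    After rescaling, [SK w a b] is a bounded odd kernel which regularises the
    kernel of S as b tends to 0, and [PK w b] is a positive kernel of integral 1
    which concentrates at 0, like a Poisson kernel; [PK w 1] is the kernel of C.
    The addition theorem of sinh turns the product of two such functions at
    points of constant sum into a combination of functions of one variable that
    are either odd or of known integral ([inv_zsinhM_Bzcosh]). Integrating it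
    gives, for angles th and th', with convolution written as *,
      SK_th * SK_th' - PK (cos th) * PK (cos th') = - PK (sin (th + th')),
      PK (sin th) * SK_th' - SK (sin th) (cos th) * PK (cos th') = SK_(th + th').
    These are [Rint_SK_SK] and [Rint_PK_SK]; the same relations for the
    operators are [convol_SS] and [convol_PS].

    It remains to let the angles tend to 0.

    Convergence in norm. With sigma = 0 and Q th = <f, PK (sin th) * f>, the
    first relation gives
    |SK_th f - SK_th' f|^2 <= Q (2 th) + Q (2 th') - 2 Q (th + th'),
    and Q tends to |f|^2 by the lemma of Fatou, so SK_th f is Cauchy
    ([convol_SK_Cauchy0]). For sigma > 0, exchanging SK_th with the multiplication
    by exp (- sigma |t|) costs an operator dominated by convolution with
    |SK_th s| (exp (sigma |s|) - 1); the second factor removes the singularity at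
    0, and the product is integrable because sigma < omega, so the weighted case
    follows from the other one ([convol_SK_Cauchy]). Completeness then yields a limit
    g, and [Strans f g] says that g is this limit.

    Convergence at almost every point. Letting th' tend to 0 in the two
    relations gives, at every t, formulas for SK_th f and for SK_th g in terms
    of Poisson integrals of f, g and C f ([convol_SK_limit], [convol_SS_limit]). A Poisson
    integral converges at each Lebesgue point, so SK_th f converges to g almost
    everywhere, and [Strans f g], [Strans g h] force h = C C f - f. Cutting
    the kernel of S off at distance e differs from SK_th with sin th = omega e
    by an odd kernel dominated by 2 PK_b, b = omega e; its effect vanishes at
    Lebesgue points, so the principal value of f is g ([trunc_cvg]). Finally
    S C = C S, because convolutions commute ([Strans_convol]).

    The complex statement follows by taking real and imaginary parts. The
    functions are only almost everywhere equal to Borel functions, and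
    [integral_ae] shows that the integral does not see the difference. *)

(** * Integrals over the line *)

Section LineIntegrals.
Context {R : realType}.
Local Notation mu := (@lebesgue_measure R).

Lemma measurable_reflect (a : R) : measurable_fun [set: R] (fun x : R => a - x).
Proof. by apply: measurable_funB. Qed.

(** Lebesgue measure is characterised by its values on half open intervals;
    reflection exchanges the two kinds, which have the same length. *)
Lemma lebesgue_measure_reflect (a : R) (A : set R) : measurable A ->
  pushforward mu (fun x : R => a - x : measurableTypeR R) A = mu A.
Proof.
move=> mA; have mphi := measurable_reflect a.
apply/esym/lebesgue_measure_unique => //= _ [[x y]] _ <-; rewrite /pushforward.
have -> : (fun x : R => a - x) @^-1` `]x, y]%classic = `[a - y, a - x[%classic.
  apply/seteqP; split => z; rewrite /preimage /= !in_itv /= => /andP[z1 z2];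
    apply/andP; split; lra.
rewrite !lebesgue_measure_itv/= !lte_fin ltrD2l ltrN2.
by case: ifPn => // _; rewrite -!EFinB; congr EFin; ring.
Qed.

Lemma ge0_integral_reflect (a : R) (F : R -> \bar R) :
  measurable_fun [set: R] F -> (forall x, 0 <= F x)%E ->
  (\int[mu]_x F (a - x)%R = \int[mu]_x F x)%E.
Proof.
move=> mF F0; have mphi := measurable_reflect a.
transitivity (\int[pushforward mu ((fun x : R => a - x : measurableTypeR R)%R)]_x F x)%E.
  by rewrite ge0_integral_pushforward//= preimage_setT.
by apply: eq_measure_integral => //= A mA _; exact: lebesgue_measure_reflect.
Qed.

Lemma integral_reflect (a : R) (F : R -> \bar R) :
  measurable_fun [set: R] F ->
  (\int[mu]_x F (a - x)%R = \int[mu]_x F x)%E.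
Proof.
move=> mF; rewrite integralE [RHS]integralE; congr (_ - _)%E.
- rewrite -(ge0_integral_reflect a (measurable_funepos mF))//.
  by apply: eq_integral => x _; rewrite !funeposE.
- rewrite -(ge0_integral_reflect a (measurable_funeneg mF))//.
  by apply: eq_integral => x _; rewrite !funenegE.
Qed.

Lemma integral_translate (a : R) (F : R -> \bar R) :
  measurable_fun [set: R] F ->
  (\int[mu]_x F (x - a)%R = \int[mu]_x F x)%E.
Proof.
move=> mF; rewrite -(integral_reflect 0 mF) -[RHS](integral_reflect a)//.
  by apply: eq_integral => x _; congr F; ring.
by apply: (measurableT_comp mF) => //; exact: measurable_reflect.
Qed.

(** Squared, so that the case of infinite integrals on the right needs no
    convention on square roots of extended reals. *)
Lemma cauchy_schwarz (f g : R -> R) :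
  measurable_fun [set: R] f -> measurable_fun [set: R] g ->
  ((\int[mu]_x (`|f x * g x|)%:E) * (\int[mu]_x (`|f x * g x|)%:E) <=
   (\int[mu]_x (f x ^+ 2)%:E) * (\int[mu]_x (g x ^+ 2)%:E))%E.
Proof.
move=> mf mg.
have H := hoelder mu mf mg (ltr0Sn R 1) (ltr0Sn R 1) _.
have {H} := H ltac:(lra).
rewrite Lnorm1 /=.
have N2 (h : R -> R) : ('N[mu]_2%:E[EFin \o h] * 'N[mu]_2%:E[EFin \o h] =
    \int[mu]_x (h x ^+ 2)%:E)%E.
  have <- : ('N[mu]_2%:E[EFin \o h] `^ 2 = 'N[mu]_2%:E[EFin \o h] * 'N[mu]_2%:E[EFin \o h])%E.
    by rewrite -[2%R]/(1 + 1)%R poweRD ?add_neq0_poweRD_def ?poweRe1 ?Lnorm_ge0//; lra.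
  rewrite poweR_Lnorm ?pnatr_eq0//; apply: eq_integral => x _ /=.
  by rewrite powR_mulrn ?real_normK ?num_real.
rewrite -(N2 f) -(N2 g) => H.
rewrite [leRHS]muleACA; apply: lee_pmul => //; exact: integral_ge0.
Qed.

(** The fundamental theorem is applied on the half line, so F has to be an antiderivative
    at positive points only. *)
Lemma integral_even_FTC (f F : R -> R) (l : R) :
  (forall x, 0 <= f x) -> continuous f -> (forall x, f (- x) = f x) ->
  (forall x : R, 0 < x -> is_derive x 1 F (f x)) -> {for 0, continuous F} ->
  F x @[x --> +oo] --> l ->
  (\int[mu]_x (f x)%:E = (2 * (l - F 0))%:E)%E.
Proof.
move=> f0 cf ef dF cF Fl.
rewrite ge0_symfun_integralT//; last by move=> x /=; rewrite ef.
rewrite -set_itvcy (@ge0_continuous_FTC2y _ f F 0 l)//.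
- exact: continuous_subspaceT.
- by move=> x /dF [].
- exact: cvg_at_right_filter.
- by move=> x; rewrite in_itv/= andbT derive1E => x0; case: (dF x x0).
Qed.

Lemma is_derive_expRM (c x : R) :
  is_derive x 1 (fun x => expR (c * x)) (c * expR (c * x)).
Proof.
have H : is_derive x 1 (fun x => c * x) c.
  rewrite (_ : (fun x => c * x) = c \*: id); last exact/funext.
  by apply: is_derive_eq; rewrite /GRing.scale /= mulr1.
have -> : (fun x => expR (c * x)) = expR \o (fun x => c * x) by [].
rewrite mulrC; exact: is_derive1_comp.
Qed.

Lemma continuous_expRabs (c : R) : continuous (fun x : R => expR (- (c * `|x|))).
Proof.
move=> x; apply: continuous_comp; last exact: continuous_expR.
apply: cvgN; apply: cvgMl_tmp; exact: norm_continuous.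
Qed.

Lemma integral_expRabs (c : R) : 0 < c ->
  (\int[mu]_x (expR (- (c * `|x|)))%:E = (2 / c)%:E)%E.
Proof.
move=> c0.
pose F (x : R) := - (c^-1) * expR ((- c) * x).
have -> : 2 / c = 2 * (0 - F 0) by rewrite /F mulr0 expR0; lra.
apply: (@integral_even_FTC _ F 0) => //.
- exact: continuous_expRabs.
- by move=> x; rewrite normrN.
- move=> x x0; have := is_derive_expRM (- c) x => H.
  have -> : expR (- (c * `|x|)) = - (c^-1) * (- c * expR (- c * x)).
    have -> : expR (- (c * `|x|)) = expR (- c * x) by rewrite gtr0_norm// mulNr.
    by field; rewrite gt_eqF.
  exact: is_deriveZ.
- apply: cvgMl_tmp; apply: continuous_comp; last exact: continuous_expR.
  by apply: cvgMl_tmp; exact: cvg_id.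
- rewrite -(mulr0 (- c^-1)); apply: cvgMl_tmp.
  have : expR (- (c * x)) @[x --> +oo] --> 0.
    apply: (@cvg_comp _ _ _ (fun x => c * x) (fun x => expR (- x))); last exact: cvgr_expR.
    by apply: gt0_cvgMry.
  by under eq_fun do rewrite -mulNr.
Qed.

End LineIntegrals.

(** * Hyperbolic functions *)

Section Hyperbolic.
Context {R : realType}.
Implicit Types (x y : R).

Lemma cosh2 x : cosh x ^+ 2 = 1 + sinh x ^+ 2.
Proof.
transitivity (expR x * expR (- x) + sinh x ^+ 2).
  by rewrite /cosh /sinh; field.
by rewrite expRxMexpNx_1.
Qed.

Lemma sinhN x : sinh (- x) = - sinh x.
Proof. by rewrite /sinh opprK; field. Qed.

Lemma coshN x : cosh (- x) = cosh x.
Proof. by rewrite /cosh opprK addrC. Qed.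

Lemma sinh0 : sinh (0 : R) = 0.
Proof. by rewrite /sinh oppr0 subrr mul0r. Qed.

Lemma sinhD x y : sinh (x + y) = sinh x * cosh y + cosh x * sinh y.
Proof. by rewrite /sinh /cosh opprD !expRD; field. Qed.

Lemma coshD x y : cosh (x + y) = cosh x * cosh y + sinh x * sinh y.
Proof. by rewrite /sinh /cosh opprD !expRD; field. Qed.

Lemma cosh_gt0 x : 0 < cosh x.
Proof. by rewrite /cosh divr_gt0// addr_gt0// expR_gt0. Qed.

Lemma cosh_ge1 x : 1 <= cosh x.
Proof.
have c0 := cosh_gt0 x; have := cosh2 x; have := sqr_ge0 (sinh x).
nra.
Qed.

Lemma sinh_abs x : `|sinh x| = sinh `|x|.
Proof.
wlog x0 : x / 0 <= x.
  move=> H; have [|/ltW x0] := leP 0 x; first exact: H.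
  by rewrite -normrN -sinhN -(normrN x) H// oppr_ge0.
rewrite (ger0_norm x0) ger0_norm// /sinh divr_ge0// subr_ge0 ler_expR; lra.
Qed.

Lemma sinh_le x y : x <= y -> sinh x <= sinh y.
Proof.
move=> xy; rewrite /sinh ler_pM2r// lerB// ler_expR//; lra.
Qed.

Lemma norm_sinh_le_cosh x : `|sinh x| <= cosh x.
Proof.
rewrite ler_norml /sinh /cosh; have := expR_gt0 x; have := expR_gt0 (- x).
by move=> *; apply/andP; split; lra.
Qed.

Lemma cosh_ge_expR x : expR `|x| / 2 <= cosh x.
Proof.
have h : cosh x = cosh `|x| by case: (ger0P x) => // _; rewrite coshN.
by rewrite h /cosh ler_pM2r// lerDl expR_ge0.
Qed.

Lemma invcosh_le x : (cosh x)^-1 <= 2 * expR (- `|x|).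
Proof.
rewrite expRN -[leRHS]invrK lef_pV2 ?posrE ?cosh_gt0 ?invr_gt0 ?mulr_gt0 ?invr_gt0 ?expR_gt0//.
by rewrite invfM invrK mulrC; exact: cosh_ge_expR.
Qed.

Lemma is_derive_sinhM (w x : R) :
  is_derive x 1 (fun x => sinh (w * x)) (w * cosh (w * x)).
Proof.
rewrite (_ : (fun x => sinh (w * x)) =
   2^-1 \*: ((fun x => expR (w * x)) - (fun x => expR (- w * x)))); last first.
  apply/funext => t; rewrite /sinh /GRing.scale /= mulrC; congr (_ * _).
  by rewrite -mulNr.
have H1 := is_derive_expRM w x; have H2 := is_derive_expRM (- w) x.
by apply: is_derive_eq; rewrite /cosh /GRing.scale /= !mulNr; field.
Qed.

Lemma continuous_sinh : continuous (@sinh R).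
Proof.
move=> x; apply: cvgMr_tmp; apply: cvgB; first exact: continuous_expR.
by apply: continuous_comp; [exact: cvgN|exact: continuous_expR].
Qed.

Lemma continuous_cosh : continuous (@cosh R).
Proof.
move=> x; apply: cvgMr_tmp; apply: cvgD; first exact: continuous_expR.
by apply: continuous_comp; [exact: cvgN|exact: continuous_expR].
Qed.

Lemma sinh_ge x : 0 <= x -> x <= sinh x.
Proof.
rewrite le_eqVlt => /predU1P[<-|x0]; first by rewrite sinh0.
have ct : {within `[0, x], continuous (fun x => sinh (1 * x))}.
  apply: continuous_subspaceT => y; apply: continuous_comp; last exact: continuous_sinh.
  by apply: cvgMl_tmp; exact: cvg_id.
have [c _] := @MVT R (fun x => sinh (1 * x)) (fun x => 1 * cosh (1 * x)) 0 x x0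
  (fun y _ => is_derive_sinhM 1 y) ct.
by rewrite !mul1r sinh0 !subr0 => ->; have := cosh_ge1 c; nra.
Qed.

Lemma norm_sinh_ge x : `|x| <= `|sinh x|.
Proof. by rewrite sinh_abs sinh_ge. Qed.

Lemma sinh_le2 x : 0 <= x -> x <= 2^-1 -> sinh x <= 2 * x.
Proof.
move=> x0 x1; rewrite /sinh.
have h1 := expR_ge1Dx (- x).
have h2 : expR x <= (1 - x)^-1.
  by rewrite -[expR x]invrK -expRN lef_pV2 ?posrE ?expR_gt0//; lra.
have h3 : (1 - x)^-1 <= 1 + 3 * x.
  by rewrite -div1r ler_pdivrMr; nra.
lra.
Qed.

(** The singular kernel 1 / sinh absorbs the growth exp (s |x|) - 1 of the
    weight: the left side vanishes at 0 to the same order as sinh, and at infinity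
    it is smaller by the factor exp (- (w - s) |x|). *)
Lemma expRB1_le_sinh (s w x : R) : 0 <= s -> s <= w ->
  expR (s * `|x|) - 1 <= 2 * expR (- ((w - s) * `|x|)) * `|sinh (w * x)|.
Proof.
move=> s0 sw; rewrite sinh_abs normrM (ger0_norm (le_trans s0 sw)).
set y := `|x|; have y0 : 0 <= y by exact: normr_ge0.
rewrite /sinh.
have -> : 2 * expR (- ((w - s) * y)) * ((expR (w * y) - expR (- (w * y))) / 2) =
  expR (s * y) - expR (- ((2 * w - s) * y)).
  rewrite (_ : expR (s * y) = expR (- ((w - s) * y)) * expR (w * y)); last first.
    by rewrite -expRD; congr expR; ring.
  rewrite (_ : expR (- ((2 * w - s) * y)) = expR (- ((w - s) * y)) * expR (- (w * y))); last first.
    by rewrite -expRD; congr expR; ring.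
  by field.
rewrite lerD2l lerN2 expR_le1 oppr_le0 mulr_ge0//; lra.
Qed.

End Hyperbolic.

(** * The reciprocals of sinh (x + i th) and cosh (x + i th) *)

Section ComplexHyperbolic.
Context {R : realType}.
Implicit Types (a b x y : R).
Local Open Scope complex_scope.

(** Real part of 1 / sinh (x + i th), for a = cos th and b = sin th. The pair (a, b)
    stands for the angle throughout, so that sums of angles are polynomial in it. *)
Definition sn a b x : R := a * sinh x / (sinh x ^+ 2 + b ^+ 2).
(** Minus the imaginary part of 1 / sinh (x + i th), for b = sin th. *)
Definition pn b x : R := b * cosh x / (sinh x ^+ 2 + b ^+ 2).

Let zsinh a b x : R[i] := (a * sinh x) +i* (b * cosh x).
Let zcosh a b x : R[i] := (a * cosh x) +i* (b * sinh x).

Let unitE a b : a ^+ 2 + b ^+ 2 = 1 -> a ^+ 2 = 1 - b ^+ 2.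
Proof. by move=> <-; rewrite addrK. Qed.

Lemma unit_mul a b a' b' : a ^+ 2 + b ^+ 2 = 1 -> a' ^+ 2 + b' ^+ 2 = 1 ->
  (a * a' - b * b') ^+ 2 + (a * b' + b * a') ^+ 2 = 1.
Proof.
move=> ab ab'; transitivity ((a ^+ 2 + b ^+ 2) * (a' ^+ 2 + b' ^+ 2)); first by ring.
by rewrite ab ab' mulr1.
Qed.

Lemma unit_sqr a b : a ^+ 2 + b ^+ 2 = 1 ->
  (a ^+ 2 - b ^+ 2) ^+ 2 + (2 * (a * b)) ^+ 2 = 1.
Proof.
by move=> ab; transitivity ((a ^+ 2 + b ^+ 2) ^+ 2); [ring|rewrite ab expr1n].
Qed.

Lemma zsinh_inv a b x : a ^+ 2 + b ^+ 2 = 1 ->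
  (zsinh a b x)^-1 = sn a b x -i* pn b x.
Proof.
move=> ab; rewrite /zsinh /GRing.inv /= /sn /pn.
suff -> : (a * sinh x) ^+ 2 + (b * cosh x) ^+ 2 = sinh x ^+ 2 + b ^+ 2 by [].
by rewrite exprMn [(b * _) ^+ 2]exprMn cosh2 (unitE ab); ring.
Qed.

Lemma zcosh_inv a b x : a ^+ 2 + b ^+ 2 = 1 ->
  (zcosh a b x)^-1 = pn a x -i* sn b a x.
Proof.
move=> ab; rewrite /zcosh /GRing.inv /= /sn /pn.
suff -> : (a * cosh x) ^+ 2 + (b * sinh x) ^+ 2 = sinh x ^+ 2 + a ^+ 2 by [].
by rewrite exprMn [(b * _) ^+ 2]exprMn cosh2 (unitE ab); ring.
Qed.

Lemma zsinh_neq0 a b x : a ^+ 2 + b ^+ 2 = 1 -> sinh x ^+ 2 + b ^+ 2 != 0 ->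
  zsinh a b x != 0.
Proof.
move=> ab; apply: contra_neq; rewrite /zsinh => -[h1 h2].
have : (a * sinh x) ^+ 2 + (b * cosh x) ^+ 2 = 0 by rewrite h1 h2 !expr0n addr0.
by rewrite exprMn [(b * _) ^+ 2]exprMn cosh2 (unitE ab) => <-; ring.
Qed.

Lemma zcosh_neq0 a b x : a != 0 -> zcosh a b x != 0.
Proof.
move=> a0; rewrite /zcosh eq_complex /= negb_and mulf_eq0 negb_or a0.
by rewrite gt_eqF// cosh_gt0.
Qed.

Lemma zsinhD a b a' b' x y : zsinh (a * a' - b * b') (a * b' + b * a') (x + y) =
  zsinh a b x * zcosh a' b' y + zcosh a b x * zsinh a' b' y.
Proof.
by rewrite /zsinh /zcosh; simpc; rewrite sinhD coshD; congr (_ +i* _); ring.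
Qed.

Lemma zsinh2 a b x : zsinh (a ^+ 2 - b ^+ 2) (2 * (a * b)) (2 * x) =
  2%:R * (zsinh a b x * zcosh a b x).
Proof.
rewrite (_ : 2 * x = x + x); last by ring.
rewrite (_ : a ^+ 2 - b ^+ 2 = a * a - b * b); last by ring.
rewrite (_ : 2 * (a * b) = a * b + b * a); last by ring.
rewrite zsinhD; ring.
Qed.

Lemma zcosh2Bzsinh2 a b x : a ^+ 2 + b ^+ 2 = 1 ->
  zcosh a b x ^+ 2 - zsinh a b x ^+ 2 = 1.
Proof.
move=> ab; rewrite /zsinh /zcosh !expr2; simpc.
have c2 := cosh2 x; have a2 := unitE ab.
by congr (_ +i* _); ring: a2 c2.
Qed.

(** Write u, v for the values of sinh, cosh at x + i th, and u', v' for those at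
    y + i th'. As W = u v' + v u' is the value of sinh at the sum, and
    v^2 - u^2 = v'^2 - u'^2 = 1, one has W (v v' - u u') = u v + u' v'. Dividing by
    W u v u' v' gives the identity, as 1 / (u v) is 2 / sinh at the double argument. *)
Lemma inv_zsinhM_Bzcosh a b a' b' x y :
  a ^+ 2 + b ^+ 2 = 1 -> a' ^+ 2 + b' ^+ 2 = 1 ->
  a != 0 -> b != 0 -> a' != 0 -> b' != 0 ->
  sinh (x + y) ^+ 2 + (a * b' + b * a') ^+ 2 != 0 ->
  (sn a b x -i* pn b x) * (sn a' b' y -i* pn b' y)
  - (pn a x -i* sn b a x) * (pn a' y -i* sn b' a' y) =
  (sn (a * a' - b * b') (a * b' + b * a') (x + y)
    -i* pn (a * b' + b * a') (x + y)) *
  (2%:R * ((sn (a ^+ 2 - b ^+ 2) (2 * (a * b)) (2 * x) -i* pn (2 * (a * b)) (2 * x))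
       + (sn (a' ^+ 2 - b' ^+ 2) (2 * (a' * b')) (2 * y)
           -i* pn (2 * (a' * b')) (2 * y)))).
Proof.
move=> ab ab' a0 b0 a0' b0' ne0.
have pos c z : c != 0 -> sinh z ^+ 2 + c ^+ 2 != 0 :> R.
  move=> c0; rewrite gt_eqF// ltr_wpDl ?sqr_ge0//.
  by rewrite lt_neqAle sqr_ge0 eq_sym sqrf_eq0 c0.
rewrite -!zsinh_inv -?zcosh_inv//; try solve [exact: unit_mul | exact: unit_sqr].
rewrite !zsinh2 zsinhD.
have := zsinh_neq0 (a := a * a' - b * b') (b := a * b' + b * a') _ ne0.
rewrite zsinhD => /(_ (unit_mul ab ab')).
have := zsinh_neq0 ab (pos b x b0); have := zsinh_neq0 ab' (pos b' y b0').
have := zcosh_neq0 b x a0; have := zcosh_neq0 b' y a0'.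
have := zcosh2Bzsinh2 x ab; have := zcosh2Bzsinh2 y ab'.
set u := zsinh a b x; set v := zcosh a b x.
set u' := zsinh a' b' y; set v' := zcosh a' b' y.
move=> h' h v0' v0 u0' u0 w0.
have e1 : v ^+ 2 = 1 + u ^+ 2 by rewrite -h; ring.
have e2 : v' ^+ 2 = 1 + u' ^+ 2 by rewrite -h'; ring.
field: e1 e2.
by rewrite v0' u0' v0 u0 w0.
Qed.

(** Replacing b by - b is replacing th by - th. *)
Lemma sn_parity a b x : [/\ sn a (- b) x = sn a b x, pn (- b) x = - pn b x &
  sn (- a) b x = - sn a b x].
Proof. by rewrite /sn /pn sqrrN !mulNr. Qed.

Section RealIdentities.
Variables (a b a' b' x y : R).
Hypotheses (ab : a ^+ 2 + b ^+ 2 = 1) (ab' : a' ^+ 2 + b' ^+ 2 = 1)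
  (a0 : a != 0) (b0 : b != 0) (a0' : a' != 0) (b0' : b' != 0)
  (xy0 : sinh (x + y) != 0).

Let SD := sn (a * a' - b * b') (a * b' + b * a') (x + y).
Let PD := pn (a * b' + b * a') (x + y).
Let SB := sn (a * a' + b * b') (b * a' - a * b') (x + y).
Let PB := pn (b * a' - a * b') (x + y).
Let S2 := sn (a ^+ 2 - b ^+ 2) (2 * (a * b)) (2 * x).
Let P2 := pn (2 * (a * b)) (2 * x).
Let S2' := sn (a' ^+ 2 - b' ^+ 2) (2 * (a' * b')) (2 * y).
Let P2' := pn (2 * (a' * b')) (2 * y).

Let plus := inv_zsinhM_Bzcosh ab ab' a0 b0 a0' b0' (y := y) (x := x).

Let den0 c : sinh (x + y) ^+ 2 + c ^+ 2 != 0.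
Proof.
rewrite gt_eqF// ltr_pwDl ?sqr_ge0//.
by rewrite lt_neqAle sqr_ge0 eq_sym sqrf_eq0 xy0.
Qed.

(* The same identity for the angle - th'. *)
Let minus := @inv_zsinhM_Bzcosh a b a' (- b') x y ab
  ltac:(by rewrite sqrrN) a0 b0 a0' ltac:(by rewrite oppr_eq0) (den0 _).

(** The identity for complex numbers, written for th' and for - th', gives two
    equations whose real parts add up to the product of real parts alone. The
    right side is affine in functions of x and of y separately, the factors
    depending only on x + y. *)
Lemma snMsn_BpnMpn : sn a b x * sn a' b' y - pn a x * pn a' y =
  SD * (S2 + S2') - PD * (P2 + P2') + SB * (S2 + S2') - PB * (P2 - P2').
Proof.
have [s1 p1 _] := sn_parity a' b' y.
have [_ _ s2] := sn_parity b' a' y.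
have [s3 p3 _] := sn_parity (a' ^+ 2 - b' ^+ 2) (2 * (a' * b')) (2 * y).
have HP := congr1 (@complex.Re R) (plus (den0 _)).
have HM := congr1 (@complex.Re R) minus.
move: HP HM; rewrite !mulrN opprK sqrrN s1 p1 s2 s3 p3 (addrC (- (a * b'))) /=.
by rewrite /SD /PD /SB /PB /S2 /P2 /S2' /P2'; move=> HP HM; lra.
Qed.

(** Likewise, with imaginary parts. *)
Lemma pnMsn_BsnMpn : pn b x * sn a' b' y - sn b a x * pn a' y =
  SD * (P2 + P2') + PD * (S2 + S2') + SB * (P2 - P2') + PB * (S2 + S2').
Proof.
have [s1 p1 _] := sn_parity a' b' y.
have [_ _ s2] := sn_parity b' a' y.
have [s3 p3 _] := sn_parity (a' ^+ 2 - b' ^+ 2) (2 * (a' * b')) (2 * y).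
have HP := congr1 (@complex.Im R) (plus (den0 _)).
have HM := congr1 (@complex.Im R) minus.
move: HP HM; rewrite !mulrN opprK sqrrN s1 p1 s2 s3 p3 (addrC (- (a * b'))) /=.
by rewrite /SD /PD /SB /PB /S2 /P2 /S2' /P2'; move=> HP HM; lra.
Qed.

End RealIdentities.

End ComplexHyperbolic.

(** * The kernels and their convolution identities *)

Section Kernels.
Context {R : realType}.
Local Notation mu := (@lebesgue_measure R).
Implicit Types (w a b s t : R) (K L : R -> R).

Lemma measurable_normr K : measurable_fun [set: R] K ->
  measurable_fun [set: R] (fun x => `|K x|).
Proof. by move=> mK; exact: (measurableT_comp (@normr_measurable R setT) mK). Qed.

Definition intbl K := mu.-integrable [set: R] (EFin \o K).
Definition Rint K : R := \int[mu]_x K x.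

(** Exponential decay with an explicit constant; [w] is the rate of the kernels of
    C and S. Such kernels act on all the weighted spaces with sigma < w. *)
Definition exp_decay w A K := measurable_fun [set: R] K /\
  forall s, `|K s| <= A * expR (- (w * `|s|)).

Lemma intbl_exp_decay w A K : 0 < w -> exp_decay w A K -> intbl K.
Proof.
move=> w0 [mK bK]; apply/integrableP; split; first exact/measurable_EFinP.
have me : measurable_fun [set: R] (fun s => expR (- (w * `|s|))).
  exact: continuous_measurable_fun (@continuous_expRabs R w).
apply: (@le_lt_trans _ _ (\int[mu]_x (A * expR (- (w * `|x|)))%:E)%E).
  apply: ge0_le_integral => //=.
  - apply/measurable_EFinP; exact: measurable_normr.
  - by apply/measurable_EFinP; apply: measurable_funM.
  - by move=> x _; rewrite lee_fin.
have A0 : 0 <= A.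
  by have := bK 0; rewrite normr0 mulr0 oppr0 expR0 mulr1; apply: le_trans.
under eq_integral do rewrite EFinM.
rewrite ge0_integralZl//=.
- by rewrite integral_expRabs// -EFinM ltry.
- by apply/measurable_EFinP.
Qed.

Lemma intblD K L : intbl K -> intbl L -> intbl (fun s => K s + L s).
Proof. exact: integrableD. Qed.

Lemma intblB K L : intbl K -> intbl L -> intbl (fun s => K s - L s).
Proof. exact: integrableB. Qed.

Lemma intblZ a K : intbl K -> intbl (fun s => a * K s).
Proof. exact: integrableZl. Qed.

Lemma intbl_measurable K : intbl K -> measurable_fun [set: R] K.
Proof. by move/integrableP => [/measurable_EFinP]. Qed.

Lemma intbl_reflect u K : intbl K -> intbl (fun s => K (u - s)).
Proof.
move=> iK; have mK := intbl_measurable iK; move/integrableP : iK => [_ iK].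
apply/integrableP; split.
  by apply/measurable_EFinP; apply: measurableT_comp => //; exact: measurable_reflect.
rewrite (ge0_integral_reflect u (F := fun s => `|(K s)%:E|%E))//.
by apply/measurableT_comp => //; exact/measurable_EFinP.
Qed.

Lemma RintD K L : intbl K -> intbl L -> Rint (fun s => K s + L s) = Rint K + Rint L.
Proof. by move=> iK iL; rewrite /Rint RintegralD. Qed.

Lemma RintB K L : intbl K -> intbl L -> Rint (fun s => K s - L s) = Rint K - Rint L.
Proof. by move=> iK iL; rewrite /Rint RintegralB. Qed.

Lemma RintZ a K : intbl K -> Rint (fun s => a * K s) = a * Rint K.
Proof. by move=> iK; rewrite /Rint RintegralZl. Qed.

Lemma Rint_reflect u K : measurable_fun [set: R] K ->
  Rint (fun s => K (u - s)) = Rint K.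
Proof.
move=> mK; rewrite /Rint /Rintegral.
by rewrite (integral_reflect u (F := fun s => (K s)%:E))//; exact/measurable_EFinP.
Qed.

Lemma Rint_odd K : measurable_fun [set: R] K -> (forall s, K (- s) = - K s) -> intbl K ->
  Rint K = 0.
Proof.
move=> mK oK iK; have := Rint_reflect 0 mK.
under [X in Rint X]eq_fun do rewrite sub0r oK -mulN1r.
rewrite RintZ// => h; lra.
Qed.

Definition SK w a b s : R := w / pi * sn a b (w * s).
Definition PK w b s : R := w / pi * pn b (w * s).

Lemma wpi_gt0 w : 0 < w -> 0 < w / pi.
Proof. by move=> w0; rewrite divr_gt0// pi_gt0. Qed.

Lemma den_gt0 b x : 0 < b -> 0 < sinh x ^+ 2 + b ^+ 2.
Proof. by move=> b0; rewrite ltr_wpDl ?sqr_ge0// exprn_gt0. Qed.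

Lemma den_ge b x : b <= 1 -> 0 < b -> b ^+ 2 * cosh x ^+ 2 <= sinh x ^+ 2 + b ^+ 2.
Proof.
move=> b1 b0; rewrite cosh2 mulrDr mulr1 addrC lerD2r ler_piMl ?sqr_ge0//.
by rewrite expr_le1// ltW.
Qed.

Lemma continuous_wM (f : R -> R) w : continuous f -> continuous (fun s => f (w * s)).
Proof.
move=> cf x; apply: (@continuous_comp _ _ _ (fun s => w * s) f); last exact: cf.
by apply: cvgMl_tmp; exact: cvg_id.
Qed.

Lemma continuous_den w b : continuous (fun s => sinh (w * s) ^+ 2 + b ^+ 2).
Proof.
move=> x; apply: cvgD; last exact: cvg_cst.
by apply: cvgM; exact: continuous_wM (@continuous_sinh R) _.
Qed.

Lemma continuous_SK w a b : 0 < b -> continuous (SK w a b).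
Proof.
move=> b0 x; apply: cvgMl_tmp; apply: cvgM.
  by apply: cvgMl_tmp; exact: continuous_wM (@continuous_sinh R) _.
apply: cvgV; first by rewrite gt_eqF// den_gt0.
exact: continuous_den.
Qed.

Lemma continuous_PK w b : 0 < b -> continuous (PK w b).
Proof.
move=> b0 x; apply: cvgMl_tmp; apply: cvgM.
  by apply: cvgMl_tmp; exact: continuous_wM (@continuous_cosh R) _.
apply: cvgV; first by rewrite gt_eqF// den_gt0.
exact: continuous_den.
Qed.

Lemma measurable_SK w a b : 0 < b -> measurable_fun [set: R] (SK w a b).
Proof. by move=> b0; apply: continuous_measurable_fun; exact: continuous_SK. Qed.

Lemma measurable_PK w b : 0 < b -> measurable_fun [set: R] (PK w b).
Proof. by move=> b0; apply: continuous_measurable_fun; exact: continuous_PK. Qed.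

Lemma SKN w a b s : SK w a b (- s) = - SK w a b s.
Proof. by rewrite /SK /sn mulrN sinhN sqrrN !(mulrN, mulNr). Qed.

Lemma PKN w b s : PK w b (- s) = PK w b s.
Proof. by rewrite /PK /pn mulrN sinhN sqrrN coshN. Qed.

Lemma PK_ge0 w b s : 0 < w -> 0 < b -> 0 <= PK w b s.
Proof.
move=> w0 b0; rewrite /PK mulr_ge0 ?(ltW (wpi_gt0 w0))//.
by rewrite /pn divr_ge0 ?mulr_ge0 ?(ltW b0) ?(ltW (cosh_gt0 _)) ?(ltW (den_gt0 _ b0)).
Qed.

Lemma cosh_den_le b x : b <= 1 -> 0 < b ->
  cosh x / (sinh x ^+ 2 + b ^+ 2) <= 2 / b ^+ 2 * expR (- `|x|).
Proof.
move=> b1 b0; have d0 := den_gt0 x b0; have c0 := cosh_gt0 x.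
apply: (@le_trans _ _ ((cosh x)^-1 / b ^+ 2)); last first.
  rewrite mulrAC ler_pM2r ?invr_gt0 ?exprn_gt0//; exact: invcosh_le.
rewrite ler_pdivrMr// mulrAC ler_pdivlMr ?exprn_gt0//.
rewrite mulrC -ler_pdivlMl//.
have := den_ge x b1 b0.
move=> h.
rewrite [leLHS](_ : _ = b ^- 2 * ((cosh x)^-1 * (b ^+ 2 * cosh x ^+ 2))); last first.
  by field; rewrite !gt_eqF.
by rewrite !ler_pM2l ?invr_gt0 ?exprn_gt0.
by rewrite exprn_gt0.
Qed.

Lemma exp_decay_SK w a b : 0 < w -> `|a| <= 1 -> 0 < b -> b <= 1 ->
  exp_decay w (w / pi * (2 / b ^+ 2)) (SK w a b).
Proof.
move=> w0 a1 b0 b1; split; first exact: measurable_SK.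
move=> s; rewrite /SK normrM gtr0_norm ?wpi_gt0// -[leRHS]mulrA ler_pM2l ?wpi_gt0//.
rewrite -[w in leRHS](gtr0_norm w0) -normrM.
apply: le_trans (cosh_den_le (w * s) b1 b0).
rewrite /sn normrM normfV (gtr0_norm (den_gt0 _ b0)) ler_pM2r ?invr_gt0 ?den_gt0//.
by rewrite normrM -[leRHS]mul1r ler_pM// norm_sinh_le_cosh.
Qed.

Lemma exp_decay_PK w b : 0 < w -> 0 < b -> b <= 1 ->
  exp_decay w (w / pi * (2 / b ^+ 2)) (PK w b).
Proof.
move=> w0 b0 b1; split; first exact: measurable_PK.
move=> s; rewrite ger0_norm ?PK_ge0// /PK -[leRHS]mulrA ler_pM2l ?wpi_gt0//.
rewrite -[w in leRHS](gtr0_norm w0) -normrM.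
apply: le_trans (cosh_den_le (w * s) b1 b0).
by rewrite /pn -mulrA ler_piMl// divr_ge0 ?(ltW (cosh_gt0 _)) ?(ltW (den_gt0 _ b0))//.
Qed.

Lemma integral_PK w b : 0 < w -> 0 < b -> (\int[mu]_s (PK w b s)%:E = 1%:E)%E.
Proof.
move=> w0 b0.
pose F (x : R) := pi^-1 * atan (b^-1 * sinh (w * x)).
have pi0 : pi != 0 :> R by rewrite gt_eqF// pi_gt0.
have F0 : F 0 = 0 by rewrite /F mulr0 sinh0 mulr0 atan0 mulr0.
have -> : 1 = 2 * (2^-1 - F 0) :> R by rewrite F0; field.
apply: integral_even_FTC.
- by move=> x; exact: PK_ge0.
- exact: continuous_PK.
- by move=> x; rewrite PKN.
- move=> x x0.
  have H1 : is_derive x 1 (fun y => b^-1 * sinh (w * y)) (b^-1 * (w * cosh (w * x))).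
    exact: (is_deriveZ b^-1 (is_derive_sinhM w x)).
  have H2 := is_derive1_atan (b^-1 * sinh (w * x)).
  have H3 := @is_derive1_comp R atan _ x _ _ H2 H1.
  have H4 := is_deriveZ pi^-1 H3.
  rewrite (_ : PK w b x = pi^-1 *: ((1 + (b^-1 * sinh (w * x)) ^+ 2)^-1 *
    (b^-1 * (w * cosh (w * x))))); first exact: H4.
  have d0 := den_gt0 (w * x) b0.
  rewrite /PK /pn /GRing.scale /=; move: pi0; move: (@pi R) => p p0; field.
  by rewrite p0 (gt_eqF b0) addrC (gt_eqF d0).
- apply: cvgMl_tmp; apply: (@continuous_comp _ _ _ (fun x => b^-1 * sinh (w * x)) atan);
    last exact: continuous_atan.
  by apply: cvgMl_tmp; exact: continuous_wM (@continuous_sinh R) _.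
- rewrite (_ : 2^-1 = pi^-1 * (pi / 2)); last first.
    by move: pi0; move: (@pi R) => p p0; field.
  apply: cvgMl_tmp.
  apply: (@cvg_comp _ _ _ (fun x => b^-1 * sinh (w * x)) atan _ +oo _); last exact: cvgy_atan.
  apply/cvgryPge => A; near=> x.
  have x0 : 0 <= x by near: x; apply: nbhs_pinfty_ge; rewrite num_real.
  rewrite ler_pdivlMl//; apply: (@le_trans _ _ (w * x)); last first.
    by apply: sinh_ge; rewrite mulr_ge0// ltW.
  by rewrite -ler_pdivrMl//; near: x; apply: nbhs_pinfty_ge; rewrite num_real.
Unshelve. all: by end_near. Qed.

Lemma Rint_PK w b : 0 < w -> 0 < b -> Rint (PK w b) = 1.
Proof. by move=> w0 b0; rewrite /Rint /Rintegral integral_PK. Qed.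

Lemma unit_le1 a b : 0 < a -> a ^+ 2 + b ^+ 2 = 1 -> a <= 1.
Proof. by move=> a0 ab; have := sqr_ge0 b; nra. Qed.

Section ConvolutionIdentities.
Variables (w a b a' b' u : R).
Hypotheses (w0 : 0 < w) (a0 : 0 < a) (b0 : 0 < b) (a0' : 0 < a') (b0' : 0 < b').
Hypotheses (ab : a ^+ 2 + b ^+ 2 = 1) (ab' : a' ^+ 2 + b' ^+ 2 = 1) (u0 : u != 0).

Let dbl (c d : R) : 0 < c -> 0 < d -> c ^+ 2 + d ^+ 2 = 1 ->
  [/\ `|c ^+ 2 - d ^+ 2| <= 1, 0 < 2 * (c * d) & 2 * (c * d) <= 1].
Proof.
move=> c0 d0 cd; split.
- by rewrite ler_norml; have := sqr_ge0 c; have := sqr_ge0 d; move=> *; apply/andP; split; lra.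
- by rewrite mulr_gt0// mulr_gt0.
- by have := sqr_ge0 (c - d); nra.
Qed.

Let w20 : 0 < 2 * w. Proof. by rewrite mulr_gt0. Qed.

Let S2 s := SK (2 * w) (a ^+ 2 - b ^+ 2) (2 * (a * b)) s.
Let P2 s := PK (2 * w) (2 * (a * b)) s.
Let S2' s := SK (2 * w) (a' ^+ 2 - b' ^+ 2) (2 * (a' * b')) s.
Let P2' s := PK (2 * w) (2 * (a' * b')) s.

Let iS c d : 0 < c -> 0 < d -> c ^+ 2 + d ^+ 2 = 1 ->
  intbl (SK (2 * w) (c ^+ 2 - d ^+ 2) (2 * (c * d))).
Proof.
by move=> c0 d0 /(dbl c0 d0)[h1 h2 h3]; exact: (intbl_exp_decay w20 (exp_decay_SK w20 h1 h2 h3)).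
Qed.

Let iP c d : 0 < c -> 0 < d -> c ^+ 2 + d ^+ 2 = 1 ->
  intbl (PK (2 * w) (2 * (c * d))).
Proof.
by move=> c0 d0 /(dbl c0 d0)[h1 h2 h3]; exact: (intbl_exp_decay w20 (exp_decay_PK w20 h2 h3)).
Qed.

Let rS c d : 0 < c -> 0 < d -> c ^+ 2 + d ^+ 2 = 1 ->
  Rint (SK (2 * w) (c ^+ 2 - d ^+ 2) (2 * (c * d))) = 0.
Proof.
move=> c0 d0 cd; have [h1 h2 h3] := dbl c0 d0 cd.
apply: Rint_odd; [exact: measurable_SK|by move=> s; rewrite SKN|exact: iS].
Qed.

Let combo (c1 c2 c3 c4 : R) :
  Rint (fun s => (c1 * S2 (u - s) + c2 * S2' s) + (c3 * P2 (u - s) + c4 * P2' s))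
  = c3 + c4.
Proof.
have [_ h _] := dbl a0 b0 ab; have [_ h' _] := dbl a0' b0' ab'.
have i1 := intbl_reflect u (iS a0 b0 ab); have i2 := iS a0' b0' ab'.
have i3 := intbl_reflect u (iP a0 b0 ab); have i4 := iP a0' b0' ab'.
rewrite RintD; [|apply: intblD; exact: intblZ|apply: intblD; exact: intblZ].
rewrite !RintD//; try exact: intblZ.
rewrite (RintZ c1 i1) (RintZ c2 i2) (RintZ c3 i3) (RintZ c4 i4).
rewrite !Rint_reflect ?rS ?Rint_PK//; try exact: measurable_SK; try exact: measurable_PK.
by rewrite !mulr0 !mulr1 !add0r.
Qed.

Let wu s : w * (u - s) + w * s = w * u. Proof. by ring. Qed.

Let su : sinh (w * u) != 0.
Proof.
by rewrite -normr_gt0 (lt_le_trans _ (norm_sinh_ge _))// normr_gt0 mulf_neq0// gt_eqF.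
Qed.

Let a0n := lt0r_neq0 a0. Let b0n := lt0r_neq0 b0.
Let a0n' := lt0r_neq0 a0'. Let b0n' := lt0r_neq0 b0'.

(** After [snMsn_BpnMpn] the integrand is a combination, with coefficients
    depending on u alone, of kernels at rate 2 w in u - s and in s: the odd ones
    integrate to 0 and the Poisson ones to 1. The case u = 0 is left out because the
    difference of the angles may vanish, and then sinh (w u) is a denominator. *)
Lemma Rint_SK_SK :
  Rint (fun s => SK w a b (u - s) * SK w a' b' s - PK w a (u - s) * PK w a' s) =
  - PK w (a * b' + b * a') u.
Proof.
pose SD := SK w (a * a' - b * b') (a * b' + b * a') u.
pose PD := PK w (a * b' + b * a') u.
pose SB := SK w (a * a' + b * b') (b * a' - a * b') u.
pose PB := PK w (b * a' - a * b') u.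
transitivity (Rint (fun s => ((SD + SB) / 2 * S2 (u - s) + (SD + SB) / 2 * S2' s)
   + (- (PD + PB) / 2 * P2 (u - s) + - (PD - PB) / 2 * P2' s))); last first.
  by rewrite combo /PD; field.
congr Rint; apply/funext => s.
have := @snMsn_BpnMpn R a b a' b' (w * (u - s)) (w * s) ab ab' a0n b0n a0n' b0n'.
rewrite wu => /(_ su) H.
transitivity ((w / pi) ^+ 2 * (sn a b (w * (u - s)) * sn a' b' (w * s) -
    pn a (w * (u - s)) * pn a' (w * s))); first by rewrite /SK /PK; ring.
rewrite H !(mulrA 2 w) /SD /PD /SB /PB /S2 /P2 /S2' /P2' /SK /PK.
by have := pi_gt0 R; move: (@pi R) => p p0; field; rewrite gt_eqF.
Qed.

Lemma Rint_PK_SK :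
  Rint (fun s => PK w b (u - s) * SK w a' b' s - SK w b a (u - s) * PK w a' s) =
  SK w (a * a' - b * b') (a * b' + b * a') u.
Proof.
pose SD := SK w (a * a' - b * b') (a * b' + b * a') u.
pose PD := PK w (a * b' + b * a') u.
pose SB := SK w (a * a' + b * b') (b * a' - a * b') u.
pose PB := PK w (b * a' - a * b') u.
transitivity (Rint (fun s => ((PD + PB) / 2 * S2 (u - s) + (PD + PB) / 2 * S2' s)
   + ((SD + SB) / 2 * P2 (u - s) + (SD - SB) / 2 * P2' s))); last first.
  by rewrite combo /SD; field.
congr Rint; apply/funext => s.
have := @pnMsn_BsnMpn R a b a' b' (w * (u - s)) (w * s) ab ab' a0n b0n a0n' b0n'.
rewrite wu => /(_ su) H.
transitivity ((w / pi) ^+ 2 * (pn b (w * (u - s)) * sn a' b' (w * s) -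
    sn b a (w * (u - s)) * pn a' (w * s))); first by rewrite /SK /PK; ring.
rewrite H !(mulrA 2 w) /SD /PD /SB /PB /S2 /P2 /S2' /P2' /SK /PK.
by have := pi_gt0 R; move: (@pi R) => p p0; field; rewrite gt_eqF.
Qed.

End ConvolutionIdentities.

End Kernels.

(** * Fubini and the Schur test *)

Section ProductIntegrals.
Context {R : realType}.
Local Notation mu := (@lebesgue_measure R).
Implicit Types (F : R * R -> R) (f g h k K L : R -> R).

Lemma measurable_Rint F : measurable_fun [set: R * R] F ->
  measurable_fun [set: R] (fun t => Rint (fun s => F (t, s))).
Proof.
move=> mF; have mE : measurable_fun [set: R * R] (EFin \o F) by exact/measurable_EFinP.
rewrite /Rint /Rintegral.
rewrite (_ : (fun _ => _) = fine \o
  ((fun t => \int[mu]_s (EFin \o F)^\+ (t, s)) \-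
   (fun t => \int[mu]_s (EFin \o F)^\- (t, s)))%E); last first.
  apply/funext => t /=; congr fine; rewrite integralE; congr (_ - _)%E;
    by apply: eq_integral => s _; rewrite ?funeposE ?funenegE.
apply: (measurableT_comp (@fine_measurable R setT measurableT)).
apply: emeasurable_funB.
- exact: (measurable_fun_fubini_tonelli_F (m2 := mu) _ (measurable_funepos mE) (funepos_ge0 _)).
- exact: (measurable_fun_fubini_tonelli_F (m2 := mu) _ (measurable_funeneg mE) (funeneg_ge0 _)).
Qed.

Lemma Rint_Fubini F :
  (mu \x mu)%E.-integrable [set: R * R] (EFin \o F) ->
  (forall x, intbl (fun y => F (x, y))) -> (forall y, intbl (fun x => F (x, y))) ->
  Rint (fun x => Rint (fun y => F (x, y))) = Rint (fun y => Rint (fun x => F (x, y))).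
Proof.
move=> iF i1 i2; rewrite /Rint /Rintegral; congr fine.
have := @Fubini _ _ _ _ R mu mu (EFin \o F) iF => /= H.
transitivity (\int[mu]_x \int[mu]_y (F (x, y))%:E)%E.
  by apply: eq_integral => x _; rewrite fineK//; exact: integrable_fin_num (i1 x).
by rewrite H; apply: eq_integral => y _; rewrite fineK//; exact: integrable_fin_num (i2 y).
Qed.

Lemma ereal_sqr_le (X : \bar R) (r : R) : (0 <= X)%E -> (X * X <= r%:E)%E ->
  (X <= (Num.sqrt r)%:E)%E.
Proof.
case: X => [x|_|//]; last by rewrite mulyy leye_eq.
rewrite -EFinM !lee_fin => x0 h.
by rewrite -(ger0_norm x0) -sqrtr_sqr ler_wsqrtr// expr2.
Qed.

Lemma Rint_abs_le f (B : R) : measurable_fun [set: R] f ->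
  (\int[mu]_x `|f x|%:E <= B%:E)%E -> intbl f /\ `|Rint f| <= B.
Proof.
move=> mf fB; have i : intbl f.
  apply/integrableP; split; first exact/measurable_EFinP.
  by apply: le_lt_trans fB _; rewrite ltry.
split=> //; rewrite -lee_fin; apply: le_trans fB.
rewrite /Rint EFin_normr_Rintegral//.
have := le_abse_integral mu measurableT (f := EFin \o f).
by apply; exact/measurable_EFinP.
Qed.

Lemma int_mul_le f g (M N : R) :
  measurable_fun [set: R] f -> measurable_fun [set: R] g ->
  (\int[mu]_x (f x ^+ 2)%:E <= M%:E)%E -> (\int[mu]_x (g x ^+ 2)%:E <= N%:E)%E ->
  (\int[mu]_x `|f x * g x|%:E <= (Num.sqrt (M * N))%:E)%E.
Proof.
move=> mf mg fM gN; apply: ereal_sqr_le; first exact: integral_ge0.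
apply: le_trans (cauchy_schwarz mf mg) _; rewrite EFinM.
by apply: lee_pmul => //; apply: integral_ge0 => x _; rewrite lee_fin sqr_ge0.
Qed.

Lemma measurable_conv2 k h : measurable_fun [set: R] k -> measurable_fun [set: R] h ->
  measurable_fun [set: R * R] (fun p => k (p.1 - p.2) * h p.2).
Proof.
move=> mk mh; apply: measurable_funM; last exact: measurableT_comp.
by apply: (measurableT_comp mk); apply: measurable_funB.
Qed.

Lemma measurable_shift k (a : R) : measurable_fun [set: R] k ->
  measurable_fun [set: R] (fun s => k (s - a)).
Proof. by move=> mk; apply: (measurableT_comp mk); apply: measurable_funB. Qed.

Lemma measurable_refl k (a : R) : measurable_fun [set: R] k ->
  measurable_fun [set: R] (fun s => k (a - s)).
Proof. by move=> mk; apply: (measurableT_comp mk); exact: measurable_reflect. Qed.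

Lemma integral_scale (c : R) f : 0 <= c -> measurable_fun [set: R] f ->
  (forall x, 0 <= f x) ->
  (\int[mu]_x (c%:E * (f x)%:E) = c%:E * \int[mu]_x (f x)%:E)%E.
Proof.
move=> c0 mf f0; rewrite ge0_integralZl//.
- exact/measurable_EFinP.
- by move=> x _; rewrite lee_fin.
Qed.

(** Young's inequality with an L1 kernel: apply Cauchy-Schwarz to the product
    of sqrt (k (t - s)) and sqrt (k (t - s)) h s, then exchange the integrals. *)
Lemma schur_test k h (u : R -> R) (B M : R) : 0 <= B ->
  measurable_fun [set: R] k -> (forall s, 0 <= k s) ->
  (\int[mu]_s (k s)%:E <= B%:E)%E ->
  measurable_fun [set: R] h -> (\int[mu]_s (h s ^+ 2)%:E <= M%:E)%E ->
  measurable_fun [set: R] u ->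
  (forall t, (`|u t|%:E <= \int[mu]_s `|k (t - s) * h s|%:E)%E) ->
  (\int[mu]_t (u t ^+ 2)%:E <= (B ^+ 2 * M)%:E)%E.
Proof.
move=> B0 mk k0 kB mh hM mu_ ub.
have mh2 : measurable_fun [set: R] (fun s => h s ^+ 2) by exact: measurable_funX.
have mkh2 : measurable_fun [set: R * R] (fun p => k (p.1 - p.2) * h p.2 ^+ 2).
  exact: (measurable_conv2 mk mh2).
have pt t : ((u t ^+ 2)%:E <= B%:E * \int[mu]_s (k (t - s) * h s ^+ 2)%:E)%E.
  pose p s := Num.sqrt (k (t - s)); pose q s := Num.sqrt (k (t - s)) * h s.
  have mp : measurable_fun [set: R] p.
    have ms := continuous_measurable_fun (@sqrt_continuous R).
    exact: (measurableT_comp ms (measurable_refl t mk)).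
  have mq : measurable_fun [set: R] q by exact: measurable_funM.
  have := cauchy_schwarz mp mq.
  have pqE : (\int[mu]_s `|p s * q s|%:E = \int[mu]_s `|k (t - s) * h s|%:E)%E.
    by apply: eq_integral => s _; rewrite /p /q mulrA -expr2 sqr_sqrtr.
  have p2E : (\int[mu]_s (p s ^+ 2)%:E <= B%:E)%E.
    apply: le_trans kB; rewrite -(ge0_integral_reflect t (F := fun s => (k s)%:E))//.
    - by under eq_integral do rewrite /p sqr_sqrtr//.
    - exact/measurable_EFinP.
  have q2E : (\int[mu]_s (q s ^+ 2)%:E = \int[mu]_s (k (t - s) * h s ^+ 2)%:E)%E.
    by apply: eq_integral => s _; rewrite /q exprMn sqr_sqrtr.
  rewrite pqE q2E => cos_of_sin.
  have -> : ((u t ^+ 2)%:E = `|u t|%:E * `|u t|%:E)%E.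
    by rewrite -EFinM -expr2 real_normK ?num_real.
  apply: le_trans (le_trans _ cos_of_sin) _.
    by apply: lee_pmul => //; rewrite lee_fin.
  apply: lee_wpmul2r => //; apply: integral_ge0 => s _.
  by rewrite lee_fin mulr_ge0// sqr_ge0.
have mE : measurable_fun [set: R * R] (fun p => (k (p.1 - p.2) * h p.2 ^+ 2)%:E).
  exact/measurable_EFinP.
have E0 p : (0 <= (k (p.1 - p.2) * h p.2 ^+ 2)%:E)%E.
  by rewrite lee_fin mulr_ge0// sqr_ge0.
have mI : measurable_fun [set: R] (fun t => \int[mu]_s (k (t - s) * h s ^+ 2)%:E)%E.
  exact: (measurable_fun_fubini_tonelli_F (m2 := mu) _ mE E0).
apply: (@le_trans _ _ (\int[mu]_t (B%:E * \int[mu]_s (k (t - s) * h s ^+ 2)%:E))%E).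
  apply: ge0_le_integral => //.
  - by move=> t _; rewrite lee_fin sqr_ge0.
  - by apply/measurable_EFinP; exact: measurable_funX.
  - exact: emeasurable_funM.
rewrite ge0_integralZl//; last first.
  by move=> t _; apply: integral_ge0 => s _; exact: (E0 (t, s)).
have -> := fubini_tonelli (m1 := mu) (m2 := mu) _ mE E0; rewrite /=.
rewrite expr2 -mulrA EFinM; apply: lee_wpmul2l; first by rewrite lee_fin.
apply: (@le_trans _ _ (\int[mu]_s (B%:E * (h s ^+ 2)%:E))%E).
  apply: ge0_le_integral => //.
  - by move=> t _; apply: integral_ge0 => s _; exact: (E0 (s, t)).
  - exact: (measurable_fun_fubini_tonelli_G (m1 := mu) _ mE E0).
  - by apply: emeasurable_funM => //; exact/measurable_EFinP.
  move=> s _.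
  under eq_integral do rewrite mulrC EFinM.
  rewrite integral_scale ?sqr_ge0//; last exact: measurable_shift.
  rewrite muleC (integral_translate s (F := fun s => (k s)%:E))//; last exact/measurable_EFinP.
  by apply: lee_wpmul2r => //; rewrite lee_fin sqr_ge0.
rewrite integral_scale//; last by move=> s; exact: sqr_ge0.
by rewrite EFinM; apply: lee_wpmul2l.
Qed.

End ProductIntegrals.

(** * Convolutions on weighted square integrable functions *)

Section WeightedL2.
Context {R : realType}.
Local Notation mu := (@lebesgue_measure R).
Implicit Types (f g h k K L : R -> R).

(** The square root of the weight of the norm, so that it multiplies functions. *)
Definition wt (sigma t : R) : R := expR (- (sigma * `|t|)).

(** [f] is a Borel function whose squared weighted norm is at most [M]. Carrying an
    explicit real bound avoids extended reals in all the estimates below. *)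
Definition wL2_le (sigma : R) f (M : R) := measurable_fun [set: R] f /\
  (\int[mu]_t ((f t * wt sigma t) ^+ 2)%:E <= M%:E)%E.

Definition convol K f : R -> R := fun t => Rint (fun s => K (t - s) * f s).

Lemma measurable_wt sigma : measurable_fun [set: R] (wt sigma).
Proof. exact: continuous_measurable_fun (@continuous_expRabs R sigma). Qed.

Lemma wt_gt0 sigma t : 0 < wt sigma t. Proof. exact: expR_gt0. Qed.

Lemma wL2_le_ge0 sigma f M : wL2_le sigma f M -> 0 <= M.
Proof.
move=> [mf fM]; rewrite -lee_fin; apply: le_trans fM.
by apply: integral_ge0 => t _; rewrite lee_fin sqr_ge0.
Qed.

Lemma wL2_le_trans sigma f M N : M <= N -> wL2_le sigma f M -> wL2_le sigma f N.
Proof. by move=> MN [mf fM]; split=> //; apply: le_trans fM _; rewrite lee_fin. Qed.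

Lemma eq_wL2_le sigma f g M : f =1 g -> wL2_le sigma f M -> wL2_le sigma g M.
Proof. by move=> /funext <-. Qed.

Lemma measurable_weighted_sqr sigma f : measurable_fun [set: R] f ->
  measurable_fun [set: R] (fun t => (f t * wt sigma t) ^+ 2).
Proof.
by move=> mf; apply: measurable_funX; apply: measurable_funM => //; exact: measurable_wt.
Qed.

(** The constant 2 replaces the triangle inequality, so that no square root is needed. *)
Lemma wL2_leD sigma f g M N : wL2_le sigma f M -> wL2_le sigma g N ->
  wL2_le sigma (fun t => f t + g t) (2 * (M + N)).
Proof.
move=> [mf fM] [mg gN]; split; first exact: measurable_funD.
have mf2 := measurable_weighted_sqr sigma mf; have mg2 := measurable_weighted_sqr sigma mg.
apply: (@le_trans _ _ (\int[mu]_t (2%:E * (((f t * wt sigma t) ^+ 2)%:E + ((g t * wt sigma t) ^+ 2)%:E)))%E).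
  apply: ge0_le_integral => //.
  - by move=> t _; rewrite lee_fin sqr_ge0.
  - by apply/measurable_EFinP; apply: measurable_weighted_sqr; exact: measurable_funD.
  - apply: emeasurable_funM => //; apply: emeasurable_funD; exact/measurable_EFinP.
  move=> t _; rewrite -EFinD -EFinM lee_fin mulrDl.
  have := sqr_ge0 (f t * wt sigma t - g t * wt sigma t); nra.
rewrite ge0_integralZl//.
- rewrite EFinM lee_pmul2l// ge0_integralD//.
  + by rewrite EFinD; exact: leeD.
  + by move=> t _; rewrite lee_fin sqr_ge0.
  + exact/measurable_EFinP.
  + by move=> t _; rewrite lee_fin sqr_ge0.
  + exact/measurable_EFinP.
- apply: emeasurable_funD; exact/measurable_EFinP.
- by move=> t _; rewrite adde_ge0// lee_fin sqr_ge0.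
Qed.

Lemma wL2_leZ sigma c f M : wL2_le sigma f M -> wL2_le sigma (fun t => c * f t) (c ^+ 2 * M).
Proof.
move=> [mf fM]; split; first exact: measurable_funM.
under eq_integral do rewrite -mulrA exprMn EFinM.
rewrite integral_scale ?sqr_ge0//.
- by rewrite [leRHS]EFinM; apply: lee_wpmul2l => //; rewrite lee_fin sqr_ge0.
- exact: measurable_weighted_sqr.
- by move=> t; rewrite sqr_ge0.
Qed.

Lemma wL2_leN sigma f M : wL2_le sigma f M -> wL2_le sigma (fun t => - f t) M.
Proof.
move=> /(wL2_leZ (-1)); rewrite sqrrN expr1n mul1r; apply: eq_wL2_le => t.
by rewrite mulN1r.
Qed.

Lemma wL2_leB sigma f g M N : wL2_le sigma f M -> wL2_le sigma g N ->
  wL2_le sigma (fun t => f t - g t) (2 * (M + N)).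
Proof. by move=> hf /wL2_leN; exact: wL2_leD. Qed.

Lemma wL2_le_wt sigma f M : wL2_le sigma f M -> wL2_le 0 (fun t => f t * wt sigma t) M.
Proof.
move=> [mf fM]; split; first by apply: measurable_funM => //; exact: measurable_wt.
apply: le_trans fM; rewrite le_eqVlt; apply/orP; left; apply/eqP.
by apply: eq_integral => t _; rewrite /wt mul0r oppr0 expR0 mulr1.
Qed.

Lemma wL2_le_unwt sigma f M : measurable_fun [set: R] f ->
  wL2_le 0 (fun t => f t * wt sigma t) M -> wL2_le sigma f M.
Proof.
move=> mf [_ fM]; split=> //.
apply: le_trans fM; rewrite le_eqVlt; apply/orP; left; apply/eqP.
by apply: eq_integral => t _; rewrite [wt 0 t]/wt mul0r oppr0 expR0 mulr1.
Qed.

Variables (w sigma : R).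
Hypotheses (w0 : 0 < w) (sigma0 : 0 <= sigma) (sw : sigma < w).

Let d0 : 0 < w - sigma. Proof. by rewrite subr_gt0. Qed.

Lemma wt_shift t s : wt sigma t <= expR (sigma * `|t - s|) * wt sigma s.
Proof.
rewrite /wt -expRD ler_expR.
have : `|s| <= `|t - s| + `|t|.
  by rewrite -[in leLHS](subKr t s) distrC (le_trans (ler_normB _ _))// addrC.
by move/(ler_wpM2l sigma0); rewrite mulrDr; lra.
Qed.

Lemma exp_decay_ge0 A K : exp_decay w A K -> 0 <= A.
Proof.
by move=> [_ /(_ 0)]; rewrite normr0 mulr0 oppr0 expR0 mulr1; apply: le_trans.
Qed.

Lemma exp_decay_shift A K t s : exp_decay w A K -> `|K (t - s)| <= A * expR (w * `|t|) * expR (- (w * `|s|)).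
Proof.
move=> dK; have A0 := exp_decay_ge0 dK; have [_ bK] := dK.
apply: le_trans (bK _) _; rewrite -mulrA ler_wpM2l// -expRD ler_expR.
have : `|s| <= `|t - s| + `|t|.
  by rewrite -[in leLHS](subKr t s) distrC (le_trans (ler_normB _ _))// addrC.
by move/(ler_wpM2l (ltW w0)); rewrite mulrDr; lra.
Qed.

Lemma int_wt_le f M : wL2_le sigma f M ->
  (\int[mu]_s `|f s * expR (- (w * `|s|))|%:E <= (Num.sqrt (M / (w - sigma)))%:E)%E.
Proof.
move=> fM; have M0 := wL2_le_ge0 fM; have [mf fM'] := fM.
have mw := measurable_wt sigma.
have me := @measurable_wt (w - sigma).
have := @int_mul_le R (fun s => f s * wt sigma s) (wt (w - sigma)) M (w - sigma)^-1 _ me fM' _.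
move=> H.
have -> : (\int[mu]_s `|f s * expR (- (w * `|s|))|%:E =
    \int[mu]_s `|f s * wt sigma s * wt (w - sigma) s|%:E)%E.
  by apply: eq_integral => s _; rewrite -mulrA /wt -expRD;
    congr (`|_ * expR _|%:E); ring.
apply: H; first exact: measurable_funM.
have -> : (\int[mu]_s (wt (w - sigma) s ^+ 2)%:E =
    \int[mu]_s (expR (- ((2 * (w - sigma)) * `|s|)))%:E)%E.
  by apply: eq_integral => s _; rewrite /wt expr2 -expRD; congr (_ %:E); congr expR; ring.
by rewrite integral_expRabs ?mulr_gt0// lee_fin invfM mulrA mulfV// mul1r.
Qed.

Lemma convol_abs_le A K f M t : exp_decay w A K -> wL2_le sigma f M ->
  (\int[mu]_s `|K (t - s) * f s|%:E <=
   (A * expR (w * `|t|) * Num.sqrt (M / (w - sigma)))%:E)%E.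
Proof.
move=> dK fM; have A0 := exp_decay_ge0 dK; have [mf _] := fM; have [mK _] := dK.
have c0 : 0 <= A * expR (w * `|t|) by rewrite mulr_ge0// expR_ge0.
have mfe : measurable_fun [set: R] (fun s => `|f s * expR (- (w * `|s|))|).
  by apply: measurable_normr; apply: measurable_funM => //; exact: (measurable_wt w).
apply: (@le_trans _ _ (\int[mu]_s ((A * expR (w * `|t|))%:E * `|f s * expR (- (w * `|s|))|%:E))%E).
  apply: ge0_le_integral => //.
  - apply/measurable_EFinP; apply: measurable_normr; apply: measurable_funM => //.
    exact: measurable_refl.
  - by apply: emeasurable_funM => //; exact/measurable_EFinP.
  move=> s _; rewrite -EFinM lee_fin !normrM (gtr0_norm (expR_gt0 _)).
  rewrite [leRHS](_ : _ = A * expR (w * `|t|) * expR (- (w * `|s|)) * `|f s|); last by ring.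
  by rewrite ler_wpM2r//; exact: exp_decay_shift.
rewrite integral_scale// [leRHS]EFinM; apply: lee_wpmul2l; first by rewrite lee_fin.
exact: int_wt_le.
Qed.

Lemma measurable_convol_integrand K f t : measurable_fun [set: R] K -> measurable_fun [set: R] f ->
  measurable_fun [set: R] (fun s => K (t - s) * f s).
Proof. by move=> mK mf; apply: measurable_funM => //; exact: measurable_refl. Qed.

Lemma convol_intbl A K f M t : exp_decay w A K -> wL2_le sigma f M -> intbl (fun s => K (t - s) * f s).
Proof.
move=> dK fM; have [mK _] := dK; have [mf _] := fM.
exact: (Rint_abs_le (measurable_convol_integrand t mK mf) (convol_abs_le t dK fM)).1.
Qed.

(** A pointwise bound, at every t: this is what allows limits in the weighted norm
    to be taken inside a convolution without exceptional null sets. *)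
Lemma convol_le A K f M t : exp_decay w A K -> wL2_le sigma f M ->
  `|convol K f t| <= A * expR (w * `|t|) * Num.sqrt (M / (w - sigma)).
Proof.
move=> dK fM; have [mK _] := dK; have [mf _] := fM.
exact: (Rint_abs_le (measurable_convol_integrand t mK mf) (convol_abs_le t dK fM)).2.
Qed.

Lemma measurable_convol K f : measurable_fun [set: R] K -> measurable_fun [set: R] f ->
  measurable_fun [set: R] (convol K f).
Proof. by move=> mK mf; exact: (measurable_Rint (measurable_conv2 mK mf)). Qed.

Lemma Rint_abs_int f : measurable_fun [set: R] f ->
  (`|Rint f|%:E <= \int[mu]_s `|f s|%:E)%E.
Proof.
move=> mf; have [->|] := eqVneq (\int[mu]_s `|f s|%:E)%E +oo%E.
  by rewrite leey.
rewrite -ltey => fy.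
have f0 : (0 <= \int[mu]_s `|f s|%:E)%E by exact: integral_ge0.
have [r rE] : exists r, (\int[mu]_s `|f s|%:E)%E = r%:E.
  by exists (fine (\int[mu]_s `|f s|%:E)%E); rewrite fineK// ge0_fin_numE.
rewrite rE lee_fin; apply: (Rint_abs_le mf _).2; by rewrite rE.
Qed.

(** The weight is submultiplicative, so convolution by K is dominated in the weighted
    norm by convolution with |K| exp (sigma |s|) in the unweighted one. *)
Lemma convol_young A K f M B : exp_decay w A K -> 0 <= B ->
  (\int[mu]_s (`|K s| * expR (sigma * `|s|))%:E <= B%:E)%E ->
  wL2_le sigma f M -> wL2_le sigma (convol K f) (B ^+ 2 * M).
Proof.
move=> [mK _] B0 kB [mf fM]; have mw := measurable_wt sigma.
split; first exact: measurable_convol.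
have me : measurable_fun [set: R] (fun s => expR (sigma * `|s|)).
  apply: continuous_measurable_fun => x; have := @continuous_expRabs R (- sigma) x.
  by under eq_fun do rewrite mulNr opprK.
have mk : measurable_fun [set: R] (fun s => `|K s| * expR (sigma * `|s|)).
  by apply: measurable_funM => //; exact: measurable_normr.
have k0 s : 0 <= `|K s| * expR (sigma * `|s|) by rewrite mulr_ge0// expR_ge0.
have mfw : measurable_fun [set: R] (fun s => f s * wt sigma s) by exact: measurable_funM.
have mop : measurable_fun [set: R] (fun t => convol K f t * wt sigma t).
  by apply: measurable_funM => //; exact: measurable_convol.
apply: (schur_test B0 mk k0 kB mfw fM mop) => t; rewrite normrM (gtr0_norm (wt_gt0 _ _)) EFinM.
have mKf := measurable_convol_integrand t mK mf.
apply: (@le_trans _ _ ((wt sigma t)%:E * \int[mu]_s `|K (t - s) * f s|%:E)%E).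
  rewrite muleC; apply: lee_wpmul2l; first by rewrite lee_fin ltW// wt_gt0.
  exact: Rint_abs_int.
rewrite -integral_scale ?(ltW (wt_gt0 _ _))//; last exact: measurable_normr.
apply: ge0_le_integral => //.
- by move=> s _; rewrite -EFinM lee_fin mulr_ge0// ltW// wt_gt0.
- by apply: emeasurable_funM => //; apply/measurable_EFinP; exact: measurable_normr.
- apply/measurable_EFinP; apply: measurable_normr; apply: measurable_funM => //.
    apply: measurable_funM; last exact: (measurable_refl t me).
    by apply: measurable_normr; exact: measurable_refl.
move=> s _; rewrite -EFinM lee_fin !normrM normr_id !(gtr0_norm (expR_gt0 _)).
rewrite [leRHS](_ : _ = `|K (t - s)| * `|f s| * (expR (sigma * `|t - s|) * wt sigma s)); last by rewrite /wt; ring.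
rewrite mulrC; apply: ler_wpM2l; first by rewrite mulr_ge0.
exact: wt_shift.
Qed.

Lemma exp_decay_weighted_int A K : exp_decay w A K ->
  (\int[mu]_s (`|K s| * expR (sigma * `|s|))%:E <= (A * (2 / (w - sigma)))%:E)%E.
Proof.
move=> dK; have A0 := exp_decay_ge0 dK; have [mK bK] := dK.
have me : measurable_fun [set: R] (fun s => expR (sigma * `|s|)).
  apply: continuous_measurable_fun => x; have := @continuous_expRabs R (- sigma) x.
  by under eq_fun do rewrite mulNr opprK.
have E : ((2 / (w - sigma))%:E = \int[mu]_s (wt (w - sigma) s)%:E)%E.
  by rewrite -integral_expRabs.
rewrite EFinM E -(integral_scale A0 (@measurable_wt (w - sigma)) (fun s => ltW (wt_gt0 _ s))).
apply: ge0_le_integral => //.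
- by apply/measurable_EFinP; apply: measurable_funM => //; exact: measurable_normr.
- by apply: emeasurable_funM => //; apply/measurable_EFinP; exact: (measurable_wt (w - sigma)).
move=> s _; rewrite -EFinM lee_fin.
apply: (@le_trans _ _ (A * expR (- (w * `|s|)) * expR (sigma * `|s|))).
  by rewrite ler_wpM2r// expR_ge0.
by rewrite -mulrA -expRD ler_wpM2l// ler_expR; lra.
Qed.

Lemma convol_wL2 A K f M : exp_decay w A K -> wL2_le sigma f M ->
  wL2_le sigma (convol K f) ((A * (2 / (w - sigma))) ^+ 2 * M).
Proof.
move=> dK fM; have A0 := exp_decay_ge0 dK; apply: (convol_young dK) => //.
  by rewrite mulr_ge0// divr_ge0// ltW.
exact: exp_decay_weighted_int.
Qed.

Lemma convolD A K f g M N t : exp_decay w A K -> wL2_le sigma f M -> wL2_le sigma g N ->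
  convol K (fun s => f s + g s) t = convol K f t + convol K g t.
Proof.
move=> dK fM gN; rewrite /convol -RintD; [|exact: convol_intbl dK fM|exact: convol_intbl dK gN].
by congr Rint; apply/funext => s; rewrite mulrDr.
Qed.

Lemma convolB A K f g M N t : exp_decay w A K -> wL2_le sigma f M -> wL2_le sigma g N ->
  convol K (fun s => f s - g s) t = convol K f t - convol K g t.
Proof.
move=> dK fM gN; rewrite /convol -RintB; [|exact: convol_intbl dK fM|exact: convol_intbl dK gN].
by congr Rint; apply/funext => s; rewrite mulrBr.
Qed.

Lemma convolBl A B K L f M t : exp_decay w A K -> exp_decay w B L -> wL2_le sigma f M ->
  convol (fun s => K s - L s) f t = convol K f t - convol L f t.
Proof.
move=> dK dL fM; rewrite /convol -RintB; [|exact: convol_intbl dK fM|exact: convol_intbl dL fM].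
by congr Rint; apply/funext => s; rewrite mulrBl.
Qed.

End WeightedL2.

(** * Products and adjoints of convolutions *)

Section Composition.
Context {R : realType}.
Local Notation mu := (@lebesgue_measure R).
Implicit Types (f g h k K L : R -> R).
Variables (w sigma : R).
Hypotheses (w0 : 0 < w) (sigma0 : 0 <= sigma) (sw : sigma < w).

Lemma exp_decay_norm A K : exp_decay w A K -> exp_decay w A (fun s => `|K s|).
Proof.
move=> [mK bK]; split; first exact: measurable_normr.
by move=> s; rewrite normr_id.
Qed.

Lemma wL2_le_norm f M : wL2_le sigma f M -> wL2_le sigma (fun s => `|f s|) M.
Proof.
move=> [mf fM]; split; first exact: measurable_normr.
apply: le_trans fM; rewrite le_eqVlt; apply/orP; left; apply/eqP.
by apply: eq_integral => t _; rewrite !exprMn real_normK ?num_real.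
Qed.

Lemma measurable_weighted_convol (G : R -> R) K f :
  measurable_fun [set: R] G -> measurable_fun [set: R] K -> measurable_fun [set: R] f ->
  measurable_fun [set: R * R] (fun p => G p.1 * (K (p.1 - p.2) * f p.2)).
Proof.
move=> mG mK mf; apply: measurable_funM; first exact: measurableT_comp.
exact: measurable_conv2.
Qed.

Lemma convol_norm_int A K f M s : exp_decay w A K -> wL2_le sigma f M ->
  (\int[mu]_u `|K (s - u) * f u|%:E = (convol (fun s => `|K s|) (fun s => `|f s|) s)%:E)%E.
Proof.
move=> dK fM; have i := convol_intbl w0 sw s (exp_decay_norm dK) (wL2_le_norm fM).
rewrite /convol /Rint /Rintegral fineK; last exact: integrable_fin_num i.
by apply: eq_integral => u _; rewrite normrM.
Qed.

Lemma prod_integrable (G : R -> R) A K f M : exp_decay w A K -> wL2_le sigma f M ->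
  measurable_fun [set: R] G ->
  (\int[mu]_s `|G s * convol (fun s => `|K s|) (fun s => `|f s|) s|%:E < +oo)%E ->
  (mu \x mu)%E.-integrable [set: R * R] (EFin \o (fun p => G p.1 * (K (p.1 - p.2) * f p.2))).
Proof.
move=> dK fM mG fin; have [mK _] := dK; have [mf _] := fM.
apply/integrable12ltyP.
  by apply/measurable_EFinP; exact: (measurable_weighted_convol mG mK mf).
apply: le_lt_trans fin; rewrite le_eqVlt; apply/orP; left; apply/eqP.
apply: eq_integral => s _ /=.
transitivity (\int[mu]_u (`|G s|%:E * `|K (s - u) * f u|%:E))%E.
  by apply: eq_integral => u _; rewrite -EFinM -normrM.
rewrite integral_scale//; last by apply: measurable_normr; exact: measurable_convol_integrand.
rewrite (convol_norm_int s dK fM) -EFinM normrM; congr (_ * _)%:E.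
rewrite ger0_norm// -lee_fin -(convol_norm_int s dK fM).
exact: integral_ge0.
Qed.

Lemma prod_integrable_exp_decay A L B K f M t : exp_decay w A L -> exp_decay w B K -> wL2_le sigma f M ->
  (mu \x mu)%E.-integrable [set: R * R]
    (EFin \o (fun p => L (t - p.1) * (K (p.1 - p.2) * f p.2))).
Proof.
move=> dL dK fM; have [mL _] := dL.
apply: (prod_integrable (G := fun s => L (t - s)) dK fM); first exact: measurable_refl.
apply: (@le_lt_trans _ _ _ _ _ (convol_abs_le w0 sw t dL
  (convol_wL2 sigma0 sw (exp_decay_norm dK) (wL2_le_norm fM)))).
by rewrite ltry.
Qed.

Lemma intbl_shift K (a : R) : intbl K -> intbl (fun s => K (s - a)).
Proof.
move=> iK; have := intbl_reflect 0 (intbl_reflect (- a) iK).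
by under eq_fun do rewrite sub0r opprK addrC.
Qed.

Lemma intbl_exp_decayM A L B K t a : exp_decay w A L -> exp_decay w B K ->
  intbl (fun s => L (t - s) * K (s - a)).
Proof.
move=> dL dK; have iK := intbl_shift a (intbl_exp_decay w0 dK).
have A0 := exp_decay_ge0 dL; have [mL bL] := dL; have [mK bK] := dK.
apply: (le_integrable measurableT _ _ (intblZ A (integrable_norm iK))) => //=.
  apply/measurable_EFinP; apply: measurable_funM; first exact: measurable_refl.
  exact: measurable_shift.
move=> s _; rewrite lee_fin !normrM normr_id (ger0_norm A0) ler_wpM2r//.
apply: le_trans (bL _) _; rewrite ler_piMr// expR_le1 oppr_le0 mulr_ge0//.
exact: ltW.
Qed.

(** The identities of kernels leave out u = 0, and an integral does not see one point. *)
Lemma Rint_eq_off (t : R) f g : measurable_fun [set: R] f -> measurable_fun [set: R] g ->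
  (forall x, x != t -> f x = g x) -> Rint f = Rint g.
Proof.
move=> mf mg fg; rewrite /Rint /Rintegral; congr fine.
apply: ae_eq_integral => //; try exact/measurable_EFinP.
exists [set t]; split; [by []|exact: lebesgue_measure_set1|].
move=> x /= /not_implyP[_ h]; apply: contrapT => xt; apply: h; congr EFin.
by apply: fg; apply/eqP.
Qed.

(** Fubini, applied to the difference of two compositions at once: the identities of
    kernels are known for the difference of two convolutions, not for each. *)
Lemma convol_convol_eq A1 L1 B1 K1 A2 L2 B2 K2 (N : R -> R) f M t :
  exp_decay w A1 L1 -> exp_decay w B1 K1 -> exp_decay w A2 L2 -> exp_decay w B2 K2 ->
  measurable_fun [set: R] N -> wL2_le sigma f M ->
  (forall u, u != 0 -> Rint (fun s => L1 (u - s) * K1 s - L2 (u - s) * K2 s) = N u) ->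
  convol L1 (convol K1 f) t - convol L2 (convol K2 f) t = convol N f t.
Proof.
move=> dL1 dK1 dL2 dK2 mN fM LKN; have [mf _] := fM.
have [mL1 _] := dL1; have [mL2 _] := dL2; have [mK1 _] := dK1; have [mK2 _] := dK2.
pose G1 (p : R * R) := L1 (t - p.1) * (K1 (p.1 - p.2) * f p.2).
pose G2 (p : R * R) := L2 (t - p.1) * (K2 (p.1 - p.2) * f p.2).
have iG1 := prod_integrable_exp_decay t dL1 dK1 fM.
have iG2 := prod_integrable_exp_decay t dL2 dK2 fM.
pose G p := G1 p - G2 p.
have iG : (mu \x mu)%E.-integrable [set: R * R] (EFin \o G).
  exact: (integrableB _ iG1 iG2).
have mG : measurable_fun [set: R * R] G by apply/measurable_EFinP; exact: measurable_int iG.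
have i1 s : intbl (fun u => G1 (s, u)) by exact: (intblZ (L1 (t - s)) (convol_intbl w0 sw s dK1 fM)).
have i2 s : intbl (fun u => G2 (s, u)) by exact: (intblZ (L2 (t - s)) (convol_intbl w0 sw s dK2 fM)).
have j1 u : intbl (fun s => G1 (s, u)).
  have := intblZ (f u) (intbl_exp_decayM t u dL1 dK1).
  by apply: eq_integrable => // s _ /=; congr EFin; rewrite /G1 /=; ring.
have j2 u : intbl (fun s => G2 (s, u)).
  have := intblZ (f u) (intbl_exp_decayM t u dL2 dK2).
  by apply: eq_integrable => // s _ /=; congr EFin; rewrite /G2 /=; ring.
transitivity (Rint (fun s => Rint (fun u => G (s, u)))).
  rewrite /convol -RintB.
  - congr Rint; apply/funext => s; rewrite [RHS]RintB//.
    rewrite -!RintZ//.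
      exact: (convol_intbl w0 sw s dK2 fM).
    exact: (convol_intbl w0 sw s dK1 fM).
  - exact: (convol_intbl w0 sw t dL1 (convol_wL2 sigma0 sw dK1 fM)).
  - exact: (convol_intbl w0 sw t dL2 (convol_wL2 sigma0 sw dK2 fM)).
rewrite Rint_Fubini//; last 2 first.
- by move=> s; exact: intblB.
- by move=> u; exact: intblB.
apply: (Rint_eq_off (t := t)).
- apply: (@measurable_Rint R (fun p => G (p.2, p.1))).
  have ms : measurable_fun [set: R * R] (fun p : R * R => (p.2, p.1)).
    by apply/measurable_fun_pairP; split; [exact: measurable_snd|exact: measurable_fst].
  exact: (measurableT_comp mG ms).
- exact: measurable_convol_integrand.
move=> u ut.
transitivity (Rint (fun s => f u * (L1 (t - s) * K1 (s - u) - L2 (t - s) * K2 (s - u)))).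
  by congr Rint; apply/funext => s; rewrite /G /G1 /G2 /=; ring.
rewrite RintZ; last first.
  by apply: intblB; [exact: (intbl_exp_decayM _ _ dL1 dK1)|exact: (intbl_exp_decayM _ _ dL2 dK2)].
rewrite mulrC; congr (_ * _); rewrite -LKN; last by rewrite subr_eq0 eq_sym.
pose H s := L1 (t - u - s) * K1 s - L2 (t - u - s) * K2 s.
have mH : measurable_fun [set: R] H.
  by apply: measurable_funB; apply: measurable_funM => //; exact: measurable_refl.
rewrite /Rint /Rintegral -[in RHS](integral_translate u (F := fun s => (H s)%:E)); last first.
  exact/measurable_EFinP.
by congr fine; apply: eq_integral => s _; rewrite /H; congr (L1 _ * _ - L2 _ * _)%:E; ring.
Qed.

Lemma convol_comm A L B K f M t : exp_decay w A L -> exp_decay w B K -> wL2_le sigma f M ->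
  convol L (convol K f) t = convol K (convol L f) t.
Proof.
move=> dL dK fM; apply/eqP; rewrite -subr_eq0.
rewrite (convol_convol_eq t dL dK dK dL (N := fun=> 0) _ fM)//.
  rewrite /convol /Rint /Rintegral.
  by under eq_integral do rewrite mul0r; rewrite integral0.
move=> u _; rewrite RintB.
- apply/eqP; rewrite subr_eq0; apply/eqP.
  rewrite -(Rint_reflect u).
    by congr Rint; apply/funext => s; rewrite mulrC; congr (_ * L _); ring.
  have [mL _] := dL; have [mK _] := dK.
  by apply: measurable_funM => //; exact: measurable_refl.
- by have := intbl_exp_decayM u 0 dL dK; under eq_fun do rewrite subr0.
- by have := intbl_exp_decayM u 0 dK dL; under eq_fun do rewrite subr0.
Qed.

End Composition.

Section Adjoint.
Context {R : realType}.
Local Notation mu := (@lebesgue_measure R).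
Implicit Types (f g h k K L : R -> R).
Variable w : R.
Hypothesis w0 : 0 < w.

Lemma L2_le_int f M : wL2_le 0 f M -> (\int[mu]_t (f t ^+ 2)%:E <= M%:E)%E.
Proof.
move=> [mf fM]; apply: le_trans fM; rewrite le_eqVlt; apply/orP; left; apply/eqP.
by apply: eq_integral => t _; rewrite /wt mul0r oppr0 expR0 mulr1.
Qed.

Lemma L2_leP f M : measurable_fun [set: R] f ->
  (\int[mu]_t (f t ^+ 2)%:E <= M%:E)%E -> wL2_le 0 f M.
Proof.
move=> mf fM; split=> //; apply: le_trans fM; rewrite le_eqVlt; apply/orP; left; apply/eqP.
by apply: eq_integral => t _; rewrite /wt mul0r oppr0 expR0 mulr1.
Qed.

Lemma L2_le_mul f g M N : wL2_le 0 f M -> wL2_le 0 g N ->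
  intbl (fun t => f t * g t) /\ `|Rint (fun t => f t * g t)| <= Num.sqrt (M * N).
Proof.
move=> fM gN; have [mf _] := fM; have [mg _] := gN.
apply: Rint_abs_le; first exact: measurable_funM.
by apply: int_mul_le => //; exact: L2_le_int.
Qed.

(** Parity of the kernel makes the convolution self-adjoint (e = 1) or
    skew-adjoint (e = -1). *)
Lemma convol_adjoint A K (e : R) f g M N : exp_decay w A K -> (forall s, K (- s) = e * K s) ->
  wL2_le 0 f M -> wL2_le 0 g N ->
  Rint (fun t => g t * convol K f t) = e * Rint (fun t => f t * convol K g t).
Proof.
move=> dK eK fM gN; have [mK _] := dK; have [mf _] := fM; have [mg _] := gN.
have oo : 0 <= 0 :> R by [].
pose G (p : R * R) := g p.1 * (K (p.1 - p.2) * f p.2).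
have iG : (mu \x mu)%E.-integrable [set: R * R] (EFin \o G).
  apply: (prod_integrable w0 w0 (G := g) dK fM) => //.
  have h := convol_wL2 oo w0 (exp_decay_norm dK) (wL2_le_norm fM).
  have [mh _] := h.
  apply: le_lt_trans (int_mul_le mg mh (L2_le_int gN) (L2_le_int h)) _.
  by rewrite ltry.
have GE s t : G (t, s) = e * f s * (K (s - t) * g t).
  rewrite /G /= -[t - s]opprB eK; ring.
transitivity (Rint (fun t => Rint (fun s => G (t, s)))).
  congr Rint; apply/funext => t; rewrite /convol -RintZ//.
  exact: (convol_intbl w0 w0 t dK fM).
rewrite Rint_Fubini//; last 2 first.
- by move=> t; exact: (intblZ (g t) (convol_intbl w0 w0 t dK fM)).
- by move=> s; under eq_fun do rewrite GE; exact: (intblZ _ (convol_intbl w0 w0 s dK gN)).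
rewrite -RintZ; last first.
  by have := (L2_le_mul fM (convol_wL2 oo w0 dK gN)).1.
congr Rint; apply/funext => s.
under [X in Rint X]eq_fun do rewrite GE.
rewrite RintZ ?mulrA//; exact: (convol_intbl w0 w0 s dK gN).
Qed.

End Adjoint.

(** * Poisson integrals at Lebesgue points *)

Section LebesguePoints.
Context {R : realType}.
Local Notation mu := (@lebesgue_measure R).
Implicit Types (f g h k K L : R -> R).

Lemma wL2_locally_integrable (w sigma : R) f M : 0 < w -> sigma < w -> wL2_le sigma f M ->
  locally_integrable [set: R] f.
Proof.
move=> w0 sw fM; have [mf _] := fM.
split=> //; first exact: openT.
move=> K _ cK; have mK := compact_measurable cK.
have /compact_bounded[N [_ /(_ (N + 1))]] := cK.
rewrite ltrDl ltr01 => /(_ isT) bK.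
apply: (@le_lt_trans _ _ (\int[mu]_(s in K) ((expR (w * (N + 1)))%:E *
    `|f s * expR (- (w * `|s|))|%:E))%E).
  have mfe : measurable_fun [set: R] (fun s => `|f s * expR (- (w * `|s|))|).
    by apply: measurable_normr; apply: measurable_funM => //; exact: (measurable_wt w).
  apply: ge0_le_integral => //.
  - by apply: measurable_funTS; apply/measurable_EFinP; exact: measurable_normr.
  - apply: measurable_funTS; apply: emeasurable_funM => //; exact/measurable_EFinP.
  move=> s Ks; rewrite -EFinM lee_fin normrM (gtr0_norm (expR_gt0 _)).
  rewrite mulrCA ler_peMr// -expRD -[leLHS]expR0 ler_expR -mulrBr mulr_ge0 ?(ltW w0)//.
  by rewrite subr_ge0; exact: bK.
rewrite ge0_integralZl//.
- apply: lte_mul_pinfty => //.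
  apply: le_lt_trans (ltry (Num.sqrt (M / (w - sigma)))).
  apply: le_trans (int_wt_le sw fM).
  apply: ge0_subset_integral => //; apply/measurable_EFinP; apply: measurable_normr.
  by apply: measurable_funM => //; exact: (measurable_wt w).
- apply: measurable_funTS; apply/measurable_EFinP; apply: measurable_normr.
  by apply: measurable_funM => //; exact: (measurable_wt w).
Qed.

Lemma lebesgue_pt_ball f (t m : R) : lebesgue_pt f t -> 0 < m ->
  exists2 r0, 0 < r0 & forall r, 0 < r -> r < r0 ->
  (\int[mu]_(s in ball t r) `|f s - f t|%:E <= (2 * r * m)%:E)%E.
Proof.
move=> ft m0.
have H : \forall r \near (0%R:R)^'+, (davg f t r < m%:E)%E.
  have h := @open_ereal_lt' R 0%E m%:E; rewrite lte_fin in h.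
  exact: (ft _ (h m0)).
move: H => -[d /= d0 dP]; exists d => // r r0 rd.
have := dP r; rewrite /= sub0r normrN gtr0_norm// => /(_ rd r0).
rewrite /davg /iavg lebesgue_measure_ball ?(ltW r0)//.
rewrite inver mulrn_eq0/= (gt_eqF r0) lte_pdivrMl ?mulrn_wgt0 ?pmulrn_lgt0//.
by move=> /ltW; rewrite -EFinM -[r *+ 2]mulr_natl.
Qed.

(** The kernel b / (b^2 + (w x)^2) is at most 1 / b, and at most 4 b / (w r)^2
    between r / 2 and r. Summing over dyadic shells down to radius b / w gives a
    geometric series; the factor 18 - 16 / 2^n is the form in which it goes through
    induction on the number of shells. *)
Lemma poisson_near (w t m r0 b : R) h : 0 < w -> 0 < b -> 0 <= m ->
  measurable_fun [set: R] h -> (forall s, 0 <= h s) ->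
  (forall r, 0 < r -> r < r0 ->
    (\int[mu]_(s in ball t r) (h s)%:E <= (2 * r * m)%:E)%E) ->
  forall r, 0 < r -> r < r0 ->
  (\int[mu]_(s in ball t r) (b / (b ^+ 2 + (w * (t - s)) ^+ 2) * h s)%:E
    <= (18 * m / w)%:E)%E.
Proof.
move=> w0 b0 m0 mh h0 hm.
pose q s := b / (b ^+ 2 + (w * (t - s)) ^+ 2).
have den s : 0 < b ^+ 2 + (w * (t - s)) ^+ 2 by rewrite ltr_wpDr ?sqr_ge0// exprn_gt0.
have q0 s : 0 <= q s by rewrite divr_ge0 ?ltW.
have mq : measurable_fun [set: R] (fun s => q s * h s).
  apply: measurable_funM => //; apply: continuous_measurable_fun => s.
  apply: cvgMl_tmp; apply: cvgV; first by rewrite gt_eqF.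
  apply: cvgD; first exact: cvg_cst.
  have c : (fun s => w * (t - s)) x @[x --> s] --> w * (t - s).
    by apply: cvgMl_tmp; apply: cvgB; [exact: cvg_cst|exact: cvg_id].
  exact: (cvgM c c).
have qbound B c : measurable B -> 0 <= c -> (forall s, B s -> q s <= c) ->
    (\int[mu]_(s in B) (q s * h s)%:E <= c%:E * \int[mu]_(s in B) (h s)%:E)%E.
  move=> mB c0 qc; rewrite -ge0_integralZl//.
  - apply: ge0_le_integral => //.
    + by move=> s _; rewrite lee_fin mulr_ge0.
    + by apply: measurable_funTS; exact/measurable_EFinP.
    + by apply: measurable_funTS; apply: emeasurable_funM => //; exact/measurable_EFinP.
    + by move=> s Bs; rewrite -EFinM lee_fin ler_wpM2r// qc.
  - by apply: measurable_funTS; exact/measurable_EFinP.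
  - by move=> s _; rewrite lee_fin.
have main n : forall r, 0 < r -> r < r0 -> r <= 2 ^+ n * (b / w) ->
    (\int[mu]_(s in ball t r) (q s * h s)%:E <= ((18 - 16 / 2 ^+ n) * m / w)%:E)%E.
  elim: n => [|n IH] r r_gt0 rr0 rn.
    have qb s : ball t r s -> q s <= b^-1.
      move=> _; rewrite /q ler_pdivrMr// ler_pdivlMl// -expr2 lerDl sqr_ge0//.
    apply: le_trans (qbound _ b^-1 (measurable_ball _ _) _ qb) _.
      by rewrite invr_ge0 ltW.
    apply: (@le_trans _ _ ((b^-1)%:E * (2 * r * m)%:E)%E).
      by apply: lee_wpmul2l; [rewrite lee_fin invr_ge0 ltW|exact: hm].
    rewrite -EFinM lee_fin expr0 in rn *; rewrite mul1r in rn.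
    apply: (@le_trans _ _ (b^-1 * (2 * (b / w) * m))).
      by rewrite ler_pM2l ?invr_gt0// ler_wpM2r// ler_pM2l.
    by rewrite le_eqVlt; apply/orP; left; apply/eqP; field; rewrite !gt_eqF.
  have pn : 0 < 2 ^+ n :> R by rewrite exprn_gt0.
  have r20 : 0 < r / 2 by rewrite divr_gt0.
  have [rn'|rn'] := leP r (2 ^+ n * (b / w)).
    apply: le_trans (IH r r_gt0 rr0 rn') _.
    rewrite lee_fin ler_pM2r ?invr_gt0// ler_wpM2r// lerB// ler_pM2l//.
    by rewrite lef_pV2 ?posrE ?exprn_gt0// ler_weXn2l// ?ler1n.
  have sub : ball t (r / 2) `<=` ball t r by apply: le_ball; lra.
  have mB := @measurable_ball R t (r / 2); have mB' := @measurable_ball R t r.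
  rewrite -(setDUK sub) ge0_integral_setU//; last 4 first.
  - exact: measurableD.
  - by apply: measurable_funTS; exact/measurable_EFinP.
  - by move=> s _; rewrite lee_fin mulr_ge0.
  - by rewrite disj_set2E setDIK.
  have h1 := IH (r / 2) r20 ltac:(lra) ltac:(rewrite exprS in rn; lra).
  pose c := 4 * b / (w * r) ^+ 2.
  have wr0 : 0 < w * r by rewrite mulr_gt0.
  have c0 : 0 <= c by rewrite divr_ge0 ?mulr_ge0 ?sqr_ge0// ltW.
  have qc s : (ball t r `\` ball t (r / 2)) s -> q s <= c.
    move=> [_]; rewrite /ball/= => /negP; rewrite -leNgt => hs.
    rewrite /q /c ler_pdivrMr// mulrAC ler_pdivlMr ?exprn_gt0//.
    rewrite -mulrA mulrCA ler_pM2l// !exprMn.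
    have : (r / 2) ^+ 2 <= (t - s) ^+ 2.
      by rewrite -[leRHS]real_normK ?num_real// ler_sqr ?nnegrE// ltW.
    have := sqr_ge0 b; have : 0 < w ^+ 2 by rewrite exprn_gt0.
    move=> w2 b2; rewrite exprMn exprVn => /(ler_wpM2l (ltW w2)); lra.
  have h2 := qbound _ c (measurableD mB' mB) c0 qc.
  have h3 : (\int[mu]_(s in ball t r `\` ball t (r / 2)) (h s)%:E <= (2 * r * m)%:E)%E.
    apply: le_trans (hm r r_gt0 rr0).
    apply: ge0_subset_integral => //; first exact: measurableD.
    by apply: measurable_funTS; exact/measurable_EFinP.
    by move=> s _; rewrite lee_fin.
  apply: le_trans (leeD h1 (le_trans h2 (lee_wpmul2l _ h3))) _; first by rewrite lee_fin.
  rewrite -EFinM -EFinD lee_fin.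
  have -> : c * (2 * r * m) = 8 * (b / w / r) * (m / w).
    by rewrite /c; field; rewrite !gt_eqF.
  have hh : b / w / r <= (2 ^+ n)^-1.
    by rewrite ler_pdivrMr// ler_pdivlMl// ltW.
  have mw0 : 0 <= m / w by rewrite divr_ge0// ltW.
  have := ler_wpM2r mw0 hh.
  rewrite exprS invfM; set y := (2 ^+ n)^-1; set z := m / w; set v := b / w / r => ?.
  rewrite -!(mulrA _ m) -/z; lra.
move=> r r_gt0 rr0.
have [n rn] : exists n, r <= 2 ^+ n * (b / w).
  have bw : 0 < b / w by rewrite divr_gt0.
  exists (Num.bound (r / (b / w))).
  rewrite -ler_pdivrMr//.
  have := archi_boundP (ltW (divr_gt0 r_gt0 bw)) => /ltW h1.
  apply: le_trans h1 _; rewrite -natrX ler_nat.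
  by apply/ltnW/ltn_expl.
apply: le_trans (main n r r_gt0 rr0 rn) _.
rewrite lee_fin ler_pM2r ?invr_gt0// ler_wpM2r// gerBl divr_ge0// exprn_ge0//.
Qed.

End LebesguePoints.

Section RealIntegrals.
Context {R : realType}.
Local Notation mu := (@lebesgue_measure R).
Implicit Types f g : R -> R.

Lemma int_mono f g : measurable_fun [set: R] f -> measurable_fun [set: R] g ->
  (forall x, 0 <= f x) -> (forall x, f x <= g x) ->
  (\int[mu]_x (f x)%:E <= \int[mu]_x (g x)%:E)%E.
Proof.
move=> mf mg f0 fg; apply: ge0_le_integral => //; try exact/measurable_EFinP.
- by move=> x _; rewrite lee_fin.
- by move=> x _; rewrite lee_fin.
Qed.

Lemma int_add f g : measurable_fun [set: R] f -> measurable_fun [set: R] g ->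
  (forall x, 0 <= f x) -> (forall x, 0 <= g x) ->
  (\int[mu]_x (f x + g x)%:E = \int[mu]_x (f x)%:E + \int[mu]_x (g x)%:E)%E.
Proof.
move=> mf mg f0 g0; under eq_integral do rewrite EFinD.
rewrite ge0_integralD//; try exact/measurable_EFinP.
- by move=> x _; rewrite lee_fin.
- by move=> x _; rewrite lee_fin.
Qed.

Lemma int_scale (c : R) f : 0 <= c -> measurable_fun [set: R] f ->
  (forall x, 0 <= f x) ->
  (\int[mu]_x (c * f x)%:E = c%:E * \int[mu]_x (f x)%:E)%E.
Proof.
by move=> c0 mf f0; rewrite -integral_scale//; apply: eq_integral => x _; rewrite EFinM.
Qed.

Lemma ae_imp (P Q : R -> Prop) : {ae mu, forall t, P t} ->
  (forall t, P t -> Q t) -> {ae mu, forall t, Q t}.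
Proof.
move=> [N [mN N0 sub]] PQ; exists N; split=> //.
by apply: subset_trans sub => x /= nQ /PQ.
Qed.

Lemma ae_and (P Q : R -> Prop) : {ae mu, forall t, P t} -> {ae mu, forall t, Q t} ->
  {ae mu, forall t, P t /\ Q t}.
Proof.
move=> [N [mN N0 sub]] [N' [mN' N0' sub']]; exists (N `|` N'); split.
- exact: measurableU.
- by rewrite -N0; apply: measureU0.
- move=> x /= nPQ; have [p|p] := pselect (P x); last by left; apply: sub.
  by right; apply: sub' => /= q; apply: nPQ.
Qed.

End RealIntegrals.

Section PoissonPoints.
Context {R : realType}.
Local Notation mu := (@lebesgue_measure R).
Implicit Types (f g h k K L : R -> R).
Variable w : R.
Hypothesis w0 : 0 < w.

(** The property of Lebesgue points that the proof uses, phrased for the kernels PK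
    themselves. *)
Definition poisson_pt f t := forall e, 0 < e -> exists2 d, 0 < d &
  forall b, 0 < b -> b < d ->
  (\int[mu]_s (PK w b (t - s) * `|f s - f t|)%:E <= e%:E)%E.

Lemma cosh_le_norm (x y : R) : `|x| <= `|y| -> cosh x <= cosh y.
Proof.
move=> xy; have cx := ltW (cosh_gt0 x); have cy := ltW (cosh_gt0 y).
rewrite -(ler_pXn2r (n := 2)) ?nnegrE//.
rewrite !cosh2 lerD2l -real_normK ?num_real// -[leRHS]real_normK ?num_real//.
rewrite ler_pXn2r ?nnegrE// !sinh_abs; exact: sinh_le.
Qed.

(** Monotonicity of tanh. *)
Lemma sinh_ge_tanh (r x : R) : 0 <= r -> r <= `|x| ->
  sinh r / cosh r * cosh x <= `|sinh x|.
Proof.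
move=> r0 rx; have sr : 0 <= sinh r by apply: le_trans (sinh_ge r0).
have cx := ltW (cosh_gt0 x); have cr := ltW (cosh_gt0 r).
rewrite mulrAC ler_pdivrMr ?cosh_gt0// -(ler_pXn2r (n := 2)) ?nnegrE//; last 2 first.
- exact: mulr_ge0.
- exact: mulr_ge0.
rewrite [(sinh r * _) ^+ 2]exprMn [(_ * cosh r) ^+ 2]exprMn !cosh2 real_normK ?num_real//.
have : sinh r ^+ 2 <= sinh x ^+ 2.
  rewrite -[leRHS]real_normK ?num_real// ler_pXn2r ?nnegrE// sinh_abs; exact: sinh_le.
by have := sqr_ge0 (sinh r); nra.
Qed.

Lemma PK_near (b x : R) : 0 < b -> `|x| <= 1 ->
  PK w b x <= w / pi * cosh w * (b / (b ^+ 2 + (w * x) ^+ 2)).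
Proof.
move=> b0 x1; rewrite /PK /pn -[leRHS]mulrA ler_pM2l ?wpi_gt0//.
have dd : 0 < b ^+ 2 + (w * x) ^+ 2 by rewrite ltr_wpDr ?sqr_ge0// exprn_gt0.
have h1 : cosh (w * x) <= cosh w.
  by apply: cosh_le_norm; rewrite normrM ler_piMr.
have h2 : b ^+ 2 + (w * x) ^+ 2 <= sinh (w * x) ^+ 2 + b ^+ 2.
  rewrite addrC lerD2r -real_normK ?num_real// -[leRHS]real_normK ?num_real//.
  by rewrite ler_pXn2r ?nnegrE// norm_sinh_ge.
rewrite [leRHS]mulrCA -mulrA ler_pM2l//.
apply: ler_pM => //; rewrite ?invr_ge0 ?(ltW (cosh_gt0 _)) ?(ltW (den_gt0 _ _))//.
by rewrite lef_pV2 ?posrE ?den_gt0.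
Qed.

Lemma PK_far (b r x : R) : 0 < b -> 0 < r -> r <= `|x| ->
  PK w b x <= b * (w / pi * (2 / (sinh (w * r) / cosh (w * r)) ^+ 2)) * expR (- (w * `|x|)).
Proof.
move=> b0 r0 rx; rewrite /PK /pn.
set c := sinh (w * r) / cosh (w * r).
have wr : 0 < w * r by rewrite mulr_gt0.
have c0 : 0 < c.
  by rewrite divr_gt0 ?cosh_gt0// (lt_le_trans wr)// sinh_ge// ltW.
have h : c * cosh (w * x) <= `|sinh (w * x)|.
  by apply: sinh_ge_tanh; [exact: ltW|rewrite normrM gtr0_norm// ler_pM2l].
have ch := cosh_gt0 (w * x).
have ie := invcosh_le (w * x).
rewrite normrM (gtr0_norm w0) in ie.
rewrite [leRHS](_ : _ = w / pi * (b * (2 * expR (- (w * `|x|)) / c ^+ 2))); last by ring.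
rewrite ler_pM2l ?wpi_gt0// -mulrA ler_pM2l//.
apply: (@le_trans _ _ ((cosh (w * x))^-1 / c ^+ 2)); last by rewrite ler_pM2r ?invr_gt0 ?exprn_gt0.
rewrite ler_pdivrMr ?den_gt0// [leRHS](_ : _ = (sinh (w * x) ^+ 2 + b ^+ 2) / (cosh (w * x) * c ^+ 2)); last first.
  by field; rewrite !gt_eqF.
have p0 : 0 < cosh (w * x) * c ^+ 2 by rewrite mulr_gt0// exprn_gt0.
rewrite ler_pdivlMr//.
rewrite [leLHS](_ : _ = (c * cosh (w * x)) ^+ 2); last by ring.
apply: (@le_trans _ _ (sinh (w * x) ^+ 2)); last by rewrite lerDl sqr_ge0.
rewrite -[leRHS]real_normK ?num_real// ler_pXn2r ?nnegrE//.
by rewrite mulr_ge0// ltW.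
Qed.

Lemma exp_decay_expR : exp_decay w 1 (fun s => expR (- (w * `|s|))).
Proof.
split; first exact: (measurable_wt w).
by move=> s; rewrite mul1r gtr0_norm// expR_gt0.
Qed.

Lemma exp_int_le (sigma : R) f M t : sigma < w -> wL2_le sigma f M ->
  exists2 Z, 0 <= Z &
    (\int[mu]_s (expR (- (w * `|t - s|)) * `|f s - f t|)%:E <= Z%:E)%E.
Proof.
move=> sw fM; have [mf _] := fM.
have e0 s : 0 <= expR (- (w * `|t - s|)) by exact: expR_ge0.
have me : measurable_fun [set: R] (fun s => expR (- (w * `|t - s|))).
  exact: (measurable_refl t (measurable_wt w)).
have m1 : measurable_fun [set: R] (fun s => `|expR (- (w * `|t - s|)) * f s|).
  by apply: measurable_normr; exact: measurable_funM.
have m2 : measurable_fun [set: R] (fun s => expR (- (w * `|t - s|)) * `|f t|).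
  exact: measurable_funM.
exists (1 * expR (w * `|t|) * Num.sqrt (M / (w - sigma)) + `|f t| * (2 / w)).
  apply: addr_ge0; first by rewrite mul1r mulr_ge0 ?expR_ge0 ?sqrtr_ge0.
  by rewrite mulr_ge0// divr_ge0// ltW.
apply: (@le_trans _ _ (\int[mu]_s (`|expR (- (w * `|t - s|)) * f s| +
   `|f t| * expR (- (w * `|t - s|)))%:E)%E).
  apply: int_mono.
  - apply: measurable_funM => //; apply: measurable_normr; exact: measurable_funB.
  - by apply: measurable_funD => //; exact: measurable_funM.
  - by move=> s; rewrite mulr_ge0.
  move=> s; rewrite normrM (ger0_norm (e0 s)).
  rewrite [leRHS](_ : _ = expR (- (w * `|t - s|)) * (`|f s| + `|f t|)); last by ring.
  rewrite ler_wpM2l//.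
  exact: ler_normB.
rewrite int_add//; last exact: measurable_funM.
rewrite EFinD; apply: leeD; first exact: (convol_abs_le w0 sw t exp_decay_expR fM).
rewrite int_scale// [leRHS]EFinM; apply: lee_wpmul2l => //.
have mw : measurable_fun [set: R] (fun s => (expR (- (w * `|s|)))%:E).
  by apply/measurable_EFinP; exact: (measurable_wt w).
by rewrite (integral_reflect t mw) integral_expRabs.
Qed.

Lemma measurable_PKh b t h : 0 < b -> measurable_fun [set: R] h ->
  measurable_fun [set: R] (fun s => PK w b (t - s) * h s).
Proof.
by move=> b0 mh; apply: measurable_funM => //; apply: measurable_refl; exact: measurable_PK.
Qed.

(** Near t the kernel is comparable to b / (b^2 + (w x)^2), which [poisson_near]
    handles; away from t it is at most a multiple of b exp (- w |x|). *)
Lemma lebesgue_pt_poisson (sigma : R) f M t : sigma < w -> wL2_le sigma f M ->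
  lebesgue_pt f t -> poisson_pt f t.
Proof.
move=> sw fM ft e e0; have [mf _] := fM.
pose h s := `|f s - f t|.
have h0 s : 0 <= h s by exact: normr_ge0.
have mh : measurable_fun [set: R] h by apply: measurable_normr; exact: measurable_funB.
have [Z Z0 hZ] := exp_int_le t sw fM.
pose c := w / pi * cosh w; have c0 : 0 < c by rewrite mulr_gt0 ?wpi_gt0 ?cosh_gt0.
(* With this m the bound c (18 m / w) of the near part is e / 2. *)
pose m := e * w / (36 * c).
have m0 : 0 < m. by apply: divr_gt0; [exact: mulr_gt0|exact: mulr_gt0].
have [r0 r00 hr0] := lebesgue_pt_ball ft m0.
pose r := Num.min (r0 / 2) 1.
have r_gt0 : 0 < r by rewrite lt_min ltr01 divr_gt0.
have rr0 : r < r0 by rewrite gt_min; apply/orP; left; lra.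
have r1 : r <= 1 by rewrite ge_min lexx orbT.
pose C := w / pi * (2 / (sinh (w * r) / cosh (w * r)) ^+ 2).
have C0 : 0 <= C.
  by rewrite mulr_ge0 ?(ltW (wpi_gt0 w0))// divr_ge0 ?sqr_ge0.
have CZ : 0 < 2 * (C * Z) + 1 by rewrite ltr_wpDl// mulr_ge0// mulr_ge0.
exists (e / (2 * (C * Z) + 1)); first by rewrite divr_gt0.
move=> b b0 be.
have mP := measurable_PKh t b0 mh.
have mB := @measurable_ball R t r.
have P0 s : 0 <= PK w b (t - s) * h s by rewrite mulr_ge0// PK_ge0.
have hn := poisson_near w0 b0 (ltW m0) mh h0 hr0 r_gt0 rr0.
rewrite -(setUv (ball t r)) ge0_integral_setU//; last 4 first.
- exact: measurableC.
- by apply: measurable_funTS; exact/measurable_EFinP.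
- by move=> s _; rewrite lee_fin.
- exact/disj_setPCl.
have -> : e = e / 2 + e / 2 by lra.
rewrite EFinD; apply: leeD.
  pose q s := b / (b ^+ 2 + (w * (t - s)) ^+ 2).
  have den s : 0 < b ^+ 2 + (w * (t - s)) ^+ 2 by rewrite ltr_wpDr ?sqr_ge0// exprn_gt0.
  have mq : measurable_fun [set: R] (fun s => q s * h s).
    apply: measurable_funM => //; apply: continuous_measurable_fun => s.
    apply: cvgMl_tmp; apply: cvgV; first by rewrite gt_eqF.
    apply: cvgD; first exact: cvg_cst.
    have ct : (fun s => w * (t - s)) x @[x --> s] --> w * (t - s).
      by apply: cvgMl_tmp; apply: cvgB; [exact: cvg_cst|exact: cvg_id].
    exact: (cvgM ct ct).
  apply: (@le_trans _ _ (\int[mu]_(s in ball t r) (c%:E * (q s * h s)%:E))%E).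
    apply: ge0_le_integral => //.
    - by move=> s _; rewrite lee_fin.
    - by apply: measurable_funTS; exact/measurable_EFinP.
    - by apply: measurable_funTS; apply: emeasurable_funM => //; exact/measurable_EFinP.
    move=> s ts; rewrite -EFinM lee_fin mulrA ler_wpM2r//.
    apply: PK_near => //; rewrite ltW// (lt_le_trans _ r1)//.
  rewrite ge0_integralZl//; last 3 first.
  - by apply: measurable_funTS; exact/measurable_EFinP.
  - by move=> s _; rewrite lee_fin mulr_ge0// divr_ge0// ltW.
  - by rewrite lee_fin ltW.
  apply: (@le_trans _ _ (c%:E * (18 * m / w)%:E)%E).
    by apply: lee_wpmul2l => //; rewrite lee_fin ltW.
  rewrite -EFinM lee_fin le_eqVlt; apply/orP; left; apply/eqP.
  by rewrite /m; move: c0; move: (c) => c' c0'; field; rewrite !gt_eqF.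
have mE : measurable_fun [set: R] (fun s => expR (- (w * `|t - s|)) * h s).
  by apply: measurable_funM => //; exact: (measurable_refl t (measurable_wt w)).
have E0 s : 0 <= expR (- (w * `|t - s|)) * h s by rewrite mulr_ge0// expR_ge0.
apply: (@le_trans _ _ (\int[mu]_(s in ~` ball t r) ((b * C)%:E * (expR (- (w * `|t - s|)) * h s)%:E))%E).
  apply: ge0_le_integral => //.
  - exact: measurableC.
  - by move=> s _; rewrite lee_fin.
  - by apply: measurable_funTS; exact/measurable_EFinP.
  - by apply: measurable_funTS; apply: emeasurable_funM => //; exact/measurable_EFinP.
  move=> s; rewrite /ball/= => /negP; rewrite -leNgt => ts.
  rewrite -EFinM lee_fin mulrA ler_wpM2r//; exact: PK_far.
apply: (@le_trans _ _ (\int[mu]_s ((b * C)%:E * (expR (- (w * `|t - s|)) * h s)%:E))%E).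
  apply: ge0_subset_integral => //; first exact: measurableC.
  - by apply: emeasurable_funM => //; exact/measurable_EFinP.
  - by move=> s _; rewrite -EFinM lee_fin mulr_ge0// mulr_ge0// ltW.
have bC : 0 <= b * C by rewrite mulr_ge0// ltW.
rewrite integral_scale//.
apply: (@le_trans _ _ ((b * C)%:E * Z%:E)%E).
  by apply: lee_wpmul2l => //; rewrite lee_fin mulr_ge0// ltW.
rewrite -EFinM lee_fin; rewrite ltr_pdivlMr// in be; nra.
Qed.

Lemma ae_poisson_pt (sigma : R) f M : sigma < w -> wL2_le sigma f M ->
  {ae mu, forall t, poisson_pt f t}.
Proof.
move=> sw fM.
apply: ae_imp (lebesgue_differentiation (wL2_locally_integrable w0 sw fM)) _ => t.
exact: (lebesgue_pt_poisson sw fM).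
Qed.

(** A kernel dominated by a Poisson kernel acts at such a point t as the
    multiplication by its integral, up to a small error. *)
Lemma convol_poisson_le (sigma : R) f M t e b c A K : sigma < w -> wL2_le sigma f M ->
  0 < b -> 0 <= c -> exp_decay w A K -> (forall s, `|K s| <= c * PK w b s) ->
  (\int[mu]_s (PK w b (t - s) * `|f s - f t|)%:E <= e%:E)%E ->
  `|convol K f t - Rint K * f t| <= c * e.
Proof.
move=> sw fM b0 c0 dK KP Pe; have [mf _] := fM; have [mK _] := dK.
have iK := intbl_exp_decay w0 dK.
have -> : convol K f t - Rint K * f t = Rint (fun s => K (t - s) * (f s - f t)).
  rewrite -(Rint_reflect t mK) mulrC -RintZ; last exact: intbl_reflect.
  rewrite /convol -RintB.
  - by congr Rint; apply/funext => s; ring.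
  - exact: (convol_intbl w0 sw t dK fM).
  - by apply: intblZ; exact: intbl_reflect.
have mB : measurable_fun [set: R] (fun s => f s - f t) by exact: measurable_funB.
apply: (Rint_abs_le (measurable_convol_integrand t mK mB) _).2.
have mP : measurable_fun [set: R] (fun s => PK w b (t - s) * `|f s - f t|).
  by apply: measurable_PKh => //; exact: measurable_normr.
apply: (@le_trans _ _ (\int[mu]_s (c%:E * (PK w b (t - s) * `|f s - f t|)%:E))%E).
  apply: ge0_le_integral => //.
  - by apply/measurable_EFinP; apply: measurable_normr; exact: measurable_convol_integrand.
  - by apply: emeasurable_funM => //; exact/measurable_EFinP.
  by move=> s _; rewrite -EFinM lee_fin normrM mulrA ler_wpM2r.
rewrite integral_scale//; last by move=> s; rewrite mulr_ge0// PK_ge0.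
by rewrite EFinM; apply: lee_wpmul2l.
Qed.

End PoissonPoints.

(** * The operator identities *)

Section Unweighted.
Context {R : realType}.
Local Notation mu := (@lebesgue_measure R).
Implicit Types (f g h k K L : R -> R).

(** The lemma of Fatou in the form of an upper bound that passes to the almost
    everywhere limit. *)
Lemma fatou_real (gn : nat -> R -> R) g (B : R) :
  (forall n, measurable_fun [set: R] (gn n)) -> measurable_fun [set: R] g ->
  (forall n t, 0 <= gn n t) -> (forall t, 0 <= g t) ->
  {ae mu, forall t, gn n t @[n --> \oo] --> g t} ->
  (forall n, (\int[mu]_t (gn n t)%:E <= B%:E)%E) ->
  (\int[mu]_t (g t)%:E <= B%:E)%E.
Proof.
move=> mgn mg gn0 g0 gng gnB.
have mE n : measurable_fun [set: R] (fun t => (gn n t)%:E) by exact/measurable_EFinP.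
have lim0 t : (0 <= limn_einf (fun n => (gn n t)%:E))%E.
  rewrite limn_einf_lim; apply: lime_ge; first exact: is_cvg_einfs.
  apply: nearW => n; rewrite /einfs; apply: le_ereal_inf_tmp => _ [m _ <-].
  by rewrite lee_fin.
have mlim : measurable_fun [set: R] (fun t => limn_einf (fun n => (gn n t)%:E)).
  rewrite (_ : (fun _ => _) = (fun t => - limn_esup (fun n => - (gn n t)%:E))%E).
    apply: measurableT_comp => //; apply: measurable_fun_limn_esup => n.
    by apply: measurableT_comp.
  by apply/funext => t; rewrite -limn_einfN; congr limn_einf; apply/funext => n; exact/esym/oppeK.
have h1 : (\int[mu]_t (g t)%:E <= \int[mu]_t (limn_einf (fun n => (gn n t)%:E)))%E.
  apply: ae_ge0_le_integral => //.
  - by move=> t _; rewrite lee_fin.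
  - exact/measurable_EFinP.
  - apply: ae_imp gng _ => t gt _.
    have ct : (gn n t)%:E @[n --> \oo] --> (g t)%:E by apply: cvg_EFin => //; exact: nearW.
    by have [-> _] := cvg_limn_einf_sup ct.
apply: le_trans h1 _; apply: le_trans (fatou mu measurableT mE _) _.
  by move=> n t _; rewrite lee_fin.
rewrite limn_einf_lim; apply: lime_le; first exact: is_cvg_einfs.
apply: nearW => n; apply: le_trans (gnB n); rewrite /einfs.
by apply: ereal_inf_lbound; exists n => /=.
Qed.

Definition cos_of_sin (b : R) := Num.sqrt (1 - b ^+ 2).

(** (a, b) = (cos th, sin th) for some th strictly between 0 and pi / 2. *)
Definition angle (a b : R) := [/\ 0 < a, 0 < b & a ^+ 2 + b ^+ 2 = 1].

Lemma angle_cos_of_sin b : 0 < b -> b < 1 -> angle (cos_of_sin b) b.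
Proof.
move=> b0 b1; have b2 : 0 < 1 - b ^+ 2 by rewrite subr_gt0 expr_lt1// ltW.
by split; rewrite ?sqrtr_gt0// /cos_of_sin sqr_sqrtr ?subrK// ltW.
Qed.

Lemma angle_le1 a b : angle a b -> a <= 1 /\ b <= 1.
Proof.
move=> [a0 b0 ab]; split; first exact: (unit_le1 a0 ab).
by apply: (unit_le1 (b := a) b0); rewrite addrC.
Qed.

Lemma angle_sym a b : angle a b -> angle b a.
Proof. by move=> [? ? ?]; split=> //; rewrite addrC. Qed.

Lemma angle_sub1 a b : angle a b -> 1 - a <= b ^+ 2.
Proof. by move=> ab; have [h _] := angle_le1 ab; case: ab => a0 b0 ab; nra. Qed.

Variables (w sigma : R).
Hypotheses (w0 : 0 < w) (sigma0 : 0 <= sigma) (sw : sigma < w).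

(** A decay constant for both [SK w a b] and [PK w b]; it blows up as b tends to 0. *)
Definition decay_const (b : R) := w / pi * (2 / b ^+ 2).

Lemma exp_decay_SK_angle a b : angle a b -> exp_decay w (decay_const b) (SK w a b).
Proof.
move=> ab; have [a1 b1] := angle_le1 ab; case: ab => a0 b0 _.
by apply: exp_decay_SK => //; rewrite gtr0_norm.
Qed.

Lemma exp_decay_PK_const b : 0 < b -> b <= 1 -> exp_decay w (decay_const b) (PK w b).
Proof. exact: exp_decay_PK. Qed.

Lemma exp_decay_PK_angle a b : angle a b -> exp_decay w (decay_const a) (PK w a).
Proof. by move=> ab; have [a1 _] := angle_le1 ab; case: ab => a0 _ _; exact: exp_decay_PK_const. Qed.

Lemma convolN K f t : intbl (fun s => K (t - s) * f s) -> convol (fun u => - K u) f t = - convol K f t.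
Proof.
move=> i; rewrite /convol -[RHS]mulN1r -RintZ//; congr Rint; apply/funext => s; ring.
Qed.

Definition sin_add (a b a' b' : R) := a * b' + b * a'.

Lemma sin_add_bounds a b a' b' : angle a b -> angle a' b' ->
  0 < sin_add a b a' b' /\ sin_add a b a' b' <= 1.
Proof.
move=> [a0 b0 ab] [a0' b0' ab']; rewrite /sin_add; split.
  by rewrite addr_gt0// mulr_gt0.
have := sqr_ge0 (a - b'); have := sqr_ge0 (b - a'); nra.
Qed.

(** The analogue, at positive angles, of the relation S S = C C - 1. *)
Lemma convol_SS a b a' b' f M t : angle a b -> angle a' b' -> wL2_le sigma f M ->
  convol (SK w a b) (convol (SK w a' b') f) t - convol (PK w a) (convol (PK w a') f) t =
  - convol (PK w (sin_add a b a' b')) f t.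
Proof.
move=> ab ab' fM; have [s0 s1] := sin_add_bounds ab ab'.
have dP := exp_decay_PK_const s0 s1.
rewrite -[RHS]convolN; last exact: (convol_intbl w0 sw t dP fM).
apply: (convol_convol_eq w0 sigma0 sw t (exp_decay_SK_angle ab) (exp_decay_SK_angle ab') (exp_decay_PK_angle ab) (exp_decay_PK_angle ab') _ fM).
  have [mP _] := dP; apply: measurableT_comp => //; exact: oppr_measurable.
case: ab => a0 b0 ab; case: ab' => a0' b0' ab' u u0.
exact: Rint_SK_SK.
Qed.

(** The analogue, at positive angles, of the trivial relation S = S: as th tends to
    0 the kernel PK (sin th) tends to the Dirac mass and SK (sin th) (cos th) to 0. *)
Lemma convol_PS a b a' b' f M t : angle a b -> angle a' b' -> wL2_le sigma f M ->
  convol (PK w b) (convol (SK w a' b') f) t - convol (SK w b a) (convol (PK w a') f) t =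
  convol (SK w (a * a' - b * b') (sin_add a b a' b')) f t.
Proof.
move=> ab ab' fM; have [s0 s1] := sin_add_bounds ab ab'.
apply: (convol_convol_eq w0 sigma0 sw t (exp_decay_PK_angle (angle_sym ab)) (exp_decay_SK_angle ab')
   (exp_decay_SK_angle (angle_sym ab)) (exp_decay_PK_angle ab') _ fM).
  exact: measurable_SK.
case: ab => a0 b0 ab; case: ab' => a0' b0' ab' u u0.
exact: Rint_PK_SK.
Qed.

End Unweighted.

(** * Convergence in the unweighted norm *)

Section Arithmetic.
Context {R : realType}.
Implicit Types x y z p q r e u M : R.

Lemma arith_SS x y u v z : x = -1 * y -> u = 1 * v -> y = v - z -> x + u = z.
Proof. by move=> -> -> ->; ring. Qed.

Lemma arith_square x y z p q r : 0 <= p - 2 * q + r ->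
  x - 2 * y + z <= (x + p) + (z + r) - 2 * (y + q).
Proof. lra. Qed.

Lemma arith_le x y q z M : x + y = q -> 0 <= y -> q <= z -> z <= M -> x <= M.
Proof. lra. Qed.

Lemma arith_second_diff x y u z e :
  x <= z -> y <= z -> z - e / 2 <= u -> x + y - 2 * u <= e.
Proof. lra. Qed.

Lemma arith_fatou x y z e : x <= z -> y < z - e -> x + 2 * y + z <= 4 * z - 2 * e.
Proof. lra. Qed.

Lemma arith_absurd z e : 0 < e -> 4 * z <= 4 * z - 2 * e -> False.
Proof. lra. Qed.

Lemma sin_add_lt (a b a' b' d : R) : angle a b -> angle a' b' -> b < d / 2 -> b' < d / 2 ->
  sin_add a b a' b' < d.
Proof.
move=> ab ab'; have [a1 _] := angle_le1 ab; have [a1' _] := angle_le1 ab'.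
by case: ab => a0 b0 _; case: ab' => a0' b0' _; rewrite /sin_add; nra.
Qed.

End Arithmetic.

Section UnweightedCauchy.
Context {R : realType}.
Local Notation mu := (@lebesgue_measure R).
Implicit Types (f g h k K L u v : R -> R).
Variables (w : R).
Hypotheses (w0 : 0 < w).

Let oo : (0 : R) <= 0. Proof. exact: lexx. Qed.

Definition ip u v := Rint (fun t => u t * v t).

Lemma int_EFin_Rint u : intbl u -> (\int[mu]_t (u t)%:E = (Rint u)%:E)%E.
Proof. by move=> iu; rewrite /Rint /Rintegral fineK//; exact: integrable_fin_num iu. Qed.

Lemma L2_le_ip f M : wL2_le 0 f M -> wL2_le 0 f (ip f f).
Proof.
move=> fM; have [mf _] := fM; apply: L2_leP => //.
have [i _] := L2_le_mul fM fM.
by under eq_integral do rewrite expr2; rewrite (int_EFin_Rint i).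
Qed.

Lemma ip_sym u v : ip u v = ip v u.
Proof. by congr Rint; apply/funext => t; rewrite mulrC. Qed.

Lemma ip_ge0 u : 0 <= ip u u.
Proof. by apply: Rintegral_ge0 => t _; rewrite -expr2 sqr_ge0. Qed.

Lemma ipBr f u v M N N' : wL2_le 0 f M -> wL2_le 0 u N -> wL2_le 0 v N' ->
  ip f (fun t => u t - v t) = ip f u - ip f v.
Proof.
move=> fM uN vL; rewrite /ip -RintB.
- by congr Rint; apply/funext => t; rewrite mulrBr.
- exact: (L2_le_mul fM uN).1.
- exact: (L2_le_mul fM vL).1.
Qed.

Lemma ip_sqrB u v N N' : wL2_le 0 u N -> wL2_le 0 v N' ->
  ip (fun t => u t - v t) (fun t => u t - v t) = ip u u - 2 * ip u v + ip v v.
Proof.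
move=> uN vL; have d := wL2_leB uN vL.
rewrite (ipBr d uN vL) (ip_sym _ u) (ip_sym _ v) (ipBr uN uN vL) (ipBr vL uN vL).
by rewrite (ip_sym v u); ring.
Qed.

(** [convol_SS] tested against f; moving SK to the other side changes the sign because
    the kernel is odd. *)
Lemma ip_SS a b a' b' f M : angle a b -> angle a' b' -> wL2_le 0 f M ->
  ip (convol (SK w a b) f) (convol (SK w a' b') f) + ip (convol (PK w a) f) (convol (PK w a') f) =
  ip f (convol (PK w (sin_add a b a' b')) f).
Proof.
move=> ab ab' fM.
have dS := exp_decay_SK_angle w0 ab; have dS' := exp_decay_SK_angle w0 ab'.
have dP := exp_decay_PK_angle w0 ab; have dP' := exp_decay_PK_angle w0 ab'.
have [s0 s1] := sin_add_bounds ab ab'; have dPs := exp_decay_PK_const w0 s0 s1.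
have qS' := convol_wL2 oo w0 dS' fM; have qP' := convol_wL2 oo w0 dP' fM.
have qSS := convol_wL2 oo w0 dS qS'; have qPP := convol_wL2 oo w0 dP qP'.
have qPs := convol_wL2 oo w0 dPs fM.
have e1 : ip (convol (SK w a' b') f) (convol (SK w a b) f) =
   (-1) * ip f (convol (SK w a b) (convol (SK w a' b') f)).
  by apply: (convol_adjoint w0 dS _ fM qS') => s; rewrite SKN mulN1r.
have e2 : ip (convol (PK w a') f) (convol (PK w a) f) =
   1 * ip f (convol (PK w a) (convol (PK w a') f)).
  by apply: (convol_adjoint w0 dP _ fM qP') => s; rewrite PKN mul1r.
have e3 : ip f (convol (SK w a b) (convol (SK w a' b') f)) =
   ip f (convol (PK w a) (convol (PK w a') f)) - ip f (convol (PK w (sin_add a b a' b')) f).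
  rewrite -(ipBr fM qPP qPs); congr Rint; apply/funext => t; congr (_ * _).
  by rewrite -(convol_SS w0 oo w0 t ab ab' fM) addrC subrK.
exact: (arith_SS (etrans (ip_sym _ _) e1) (etrans (ip_sym _ _) e2) e3).
Qed.

Lemma PK_weight0 b : 0 < b ->
  (\int[mu]_s (`|PK w b s| * expR (0 * `|s|))%:E <= 1%:E)%E.
Proof.
move=> b0; rewrite -(integral_PK w0 b0) le_eqVlt; apply/orP; left; apply/eqP.
by apply: eq_integral => s _; rewrite mul0r expR0 mulr1 ger0_norm// PK_ge0.
Qed.

Lemma PK_contract b f M : 0 < b -> b <= 1 -> wL2_le 0 f M -> wL2_le 0 (convol (PK w b) f) M.
Proof.
move=> b0 b1 fM; rewrite -[M]mul1r -(expr1n _ 2).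
exact: (convol_young oo (exp_decay_PK_const w0 b0 b1) ler01 (PK_weight0 b0) fM).
Qed.

Lemma ip_PK_le b f M : 0 < b -> b <= 1 -> wL2_le 0 f M -> ip f (convol (PK w b) f) <= ip f f.
Proof.
move=> b0 b1 fM; have fI := L2_le_ip fM.
have [_ h] := L2_le_mul fI (PK_contract b0 b1 fI).
apply: le_trans (ler_norm _) (le_trans h _).
by rewrite -expr2 sqrtr_sqr ger0_norm// ip_ge0.
Qed.

Lemma convol_PK_cvg sigma f M t : sigma < w -> wL2_le sigma f M -> poisson_pt w f t ->
  forall e, 0 < e -> exists2 d, 0 < d &
  forall b, 0 < b -> b < d -> b <= 1 -> `|convol (PK w b) f t - f t| <= e.
Proof.
move=> sw fM pt e e0; have [d d0 dP] := pt e e0; exists d => // b b0 bd b1.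
have := convol_poisson_le w0 sw fM b0 ler01 (exp_decay_PK_const w0 b0 b1) _ (dP b b0 bd).
rewrite Rint_PK// !mul1r; apply=> s.
by rewrite ger0_norm ?PK_ge0// mul1r.
Qed.

Lemma cvg_natSinv (u : nat -> R) (l : R) (v : nat -> R) :
  (forall n, v n < n.+1%:R^-1) ->
  (forall e, 0 < e -> exists2 d, 0 < d & forall n, v n < d -> `|u n - l| <= e) ->
  u n @[n --> \oo] --> l.
Proof.
move=> vn H; apply/cvgrPdist_le => e e0; have [d d0 dP] := H e e0.
near=> n; rewrite distrC; apply: dP; apply: lt_trans (vn n) _.
near: n; exact: (near_infty_natSinv_lt (PosNum d0)).
Unshelve. all: by end_near. Qed.

(** Otherwise <f, PK_b f> would stay below |f|^2 - e along some sequence b -> 0, hence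
    |PK_b f + f|^2 <= 4 |f|^2 - 2 e; but PK_b f + f tends to 2 f almost everywhere, and
    Fatou gives a contradiction. *)
Lemma ip_PK_cvg f M : wL2_le 0 f M -> forall e, 0 < e ->
  exists2 d, 0 < d & forall b, 0 < b -> b < d -> b <= 1 ->
  ip f f - e <= ip f (convol (PK w b) f).
Proof.
move=> fM e e0; apply: contrapT => H.
have {H} H n : exists b, [/\ 0 < b, b < n.+1%:R^-1, b <= 1 &
    ip f (convol (PK w b) f) < ip f f - e].
  apply: contrapT => H'; apply: H; exists n.+1%:R^-1; first by rewrite invr_gt0.
  move=> b b0 bn b1; rewrite leNgt; apply/negP => h; apply: H'; exists b; split=> //.
have [bn bnP] := choice H.
have fI := L2_le_ip fM; have [mf _] := fM.
have qP n : wL2_le 0 (convol (PK w (bn n)) f) (ip f f).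
  by have [b0 _ b1 _] := bnP n; exact: PK_contract.
have mP n : measurable_fun [set: R] (convol (PK w (bn n)) f) by have [] := qP n.
pose gn n t := (convol (PK w (bn n)) f t + f t) ^+ 2.
have mgn n : measurable_fun [set: R] (gn n).
  by apply: measurable_funX; exact: measurable_funD.
have gB n : (\int[mu]_t (gn n t)%:E <= (4 * ip f f - 2 * e)%:E)%E.
  have i1 := (L2_le_mul (qP n) (qP n)).1; have i2 := (L2_le_mul fI (qP n)).1.
  have i3 := (L2_le_mul fI fI).1.
  have h1 : ip (convol (PK w (bn n)) f) (convol (PK w (bn n)) f) <= ip f f.
    rewrite -lee_fin -int_EFin_Rint//.
    by apply: le_trans (L2_le_int (qP n)); under eq_integral do rewrite -expr2.
  have gE : gn n = fun t => (convol (PK w (bn n)) f t * convol (PK w (bn n)) f t +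
      2 * (f t * convol (PK w (bn n)) f t)) + f t * f t.
    by apply/funext => t; rewrite /gn; ring.
  have ig : intbl (gn n).
    by rewrite gE; exact: (intblD (intblD i1 (intblZ 2 i2)) i3).
  rewrite (int_EFin_Rint ig) lee_fin gE.
  have e1 := RintD (intblD i1 (intblZ 2 i2)) i3.
  have e2 := RintD i1 (intblZ 2 i2); have e3 := RintZ 2 i2.
  rewrite e1 e2 e3; have [_ _ _ h2] := bnP n.
  exact: (arith_fatou h1 h2).
have : (\int[mu]_t ((f t + f t) ^+ 2)%:E <= (4 * ip f f - 2 * e)%:E)%E.
  apply: (fatou_real mgn _ _ _ _ gB).
  - by apply: measurable_funX; exact: measurable_funD.
  - by move=> n t; rewrite sqr_ge0.
  - by move=> t; rewrite sqr_ge0.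
  - apply: ae_imp (ae_poisson_pt w0 w0 fM) _ => t pt.
    have c : convol (PK w (bn n)) f t @[n --> \oo] --> f t.
      apply: (@cvg_natSinv _ _ bn); first by move=> n; have [] := bnP n.
      move=> e' e0'; have [d d0 dP] := convol_PK_cvg w0 fM pt e0'.
      exists d => // n bd; have [b0 _ b1 _] := bnP n; exact: dP.
    have cD : convol (PK w (bn n)) f t + f t @[n --> \oo] --> f t + f t.
      by apply: cvgD c _; exact: cvg_cst.
    have -> : (fun n => gn n t) = (fun n => (convol (PK w (bn n)) f t + f t) * (convol (PK w (bn n)) f t + f t)).
      by apply/funext => n; rewrite /gn expr2.
    by rewrite expr2; exact: (cvgM cD cD).
have i4 := (L2_le_mul fI fI).1.
have -> : (\int[mu]_t ((f t + f t) ^+ 2)%:E = (4 * ip f f)%:E)%E.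
  rewrite /ip -(RintZ 4 i4) -(int_EFin_Rint (intblZ 4 i4)).
  by apply: eq_integral => t _; congr EFin; ring.
by rewrite lee_fin => /(arith_absurd e0).
Qed.

(** By [ip_SS], the sum of |SK_th f - SK_th' f|^2 and of the similar square for the
    kernels PK (cos th), PK (cos th') is the right side. *)
Lemma convol_SK_sqB a b a' b' f M : angle a b -> angle a' b' -> wL2_le 0 f M ->
  wL2_le 0 (fun t => convol (SK w a b) f t - convol (SK w a' b') f t)
   (ip f (convol (PK w (sin_add a b a b)) f) + ip f (convol (PK w (sin_add a' b' a' b')) f)
     - 2 * ip f (convol (PK w (sin_add a b a' b')) f)).
Proof.
move=> ab ab' fM.
have qS := convol_wL2 oo w0 (exp_decay_SK_angle w0 ab) fM; have qS' := convol_wL2 oo w0 (exp_decay_SK_angle w0 ab') fM.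
have qP := convol_wL2 oo w0 (exp_decay_PK_angle w0 ab) fM; have qP' := convol_wL2 oo w0 (exp_decay_PK_angle w0 ab') fM.
apply: wL2_le_trans (L2_le_ip (wL2_leB qS qS')).
rewrite -(ip_SS ab ab fM) -(ip_SS ab' ab' fM) -(ip_SS ab ab' fM).
rewrite (ip_sqrB qS qS').
have h := ip_ge0 (fun t => convol (PK w a) f t - convol (PK w a') f t).
rewrite (ip_sqrB qP qP') in h.
exact: arith_square h.
Qed.

Lemma convol_SK_contract a b f M : angle a b -> wL2_le 0 f M -> wL2_le 0 (convol (SK w a b) f) M.
Proof.
move=> ab fM.
have qS := convol_wL2 oo w0 (exp_decay_SK_angle w0 ab) fM; have qP := convol_wL2 oo w0 (exp_decay_PK_angle w0 ab) fM.
have [s0 s1] := sin_add_bounds ab ab.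
have fI := L2_le_ip fM.
apply: wL2_le_trans (L2_le_ip qS).
have h := ip_SS ab ab fM; have h1 := ip_ge0 (convol (PK w a) f).
have h2 := ip_PK_le s0 s1 fM.
have h3 : ip f f <= M.
  have i := (L2_le_mul fM fM).1; rewrite -lee_fin -int_EFin_Rint//.
  by apply: le_trans (L2_le_int fM); under eq_integral do rewrite -expr2.
exact: (arith_le h h1 h2 h3).
Qed.

(** All three terms of [convol_SK_sqB] are close to |f|^2, with total coefficient 0. *)
Lemma convol_SK_Cauchy0 f M : wL2_le 0 f M -> forall e, 0 < e ->
  exists2 d, 0 < d & forall a b a' b', angle a b -> angle a' b' -> b < d -> b' < d ->
  wL2_le 0 (fun t => convol (SK w a b) f t - convol (SK w a' b') f t) e.
Proof.
move=> fM e e0; have e20 : 0 < e / 2 by rewrite divr_gt0.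
have [d d0 dP] := ip_PK_cvg fM e20.
exists (d / 2); first by rewrite divr_gt0.
move=> a b a' b' ab ab' bd bd'.
apply: wL2_le_trans (convol_SK_sqB ab ab' fM).
have [s0 s1] := sin_add_bounds ab ab; have [s0' s1'] := sin_add_bounds ab' ab'.
have [s0'' s1''] := sin_add_bounds ab ab'.
have h1 := ip_PK_le s0 s1 fM; have h2 := ip_PK_le s0' s1' fM.
have sd := sin_add_lt ab ab' bd bd'.
have h3 := dP _ s0'' sd s1''.
exact: (arith_second_diff h1 h2 h3).
Qed.

End UnweightedCauchy.

(** * Convergence in the weighted norm *)

Section WeightedCauchy.
Context {R : realType}.
Local Notation mu := (@lebesgue_measure R).
Implicit Types (f g h k K L u v : R -> R).
Variables (w sigma : R).
Hypotheses (w0 : 0 < w) (sigma0 : 0 <= sigma) (sw : sigma < w).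

Let d0 : 0 < w - sigma. Proof. by rewrite subr_gt0. Qed.

(** The relative variation of the weight over a distance s is at most this. *)
Definition growth (s : R) := expR (sigma * `|s|) - 1.

Lemma growth_ge0 s : 0 <= growth s.
Proof. by rewrite subr_ge0 -[leLHS]expR0 ler_expR mulr_ge0. Qed.

Lemma measurable_growth : measurable_fun [set: R] growth.
Proof.
apply: measurable_funB => //; apply: continuous_measurable_fun => x.
have := @continuous_expRabs R (- sigma) x.
by under eq_fun do rewrite mulNr opprK.
Qed.

Lemma wt_sub_le t s : `|wt sigma t - wt sigma s| <= growth (t - s) * wt sigma s.
Proof.
have h1 := wt_shift sigma0 t s; have h2 := wt_shift sigma0 s t.
have ws := wt_gt0 sigma s; have wt_ := wt_gt0 sigma t.
rewrite distrC in h2; rewrite /growth; set x := expR _ in h1 h2 *.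
have x0 : 0 < x by exact: expR_gt0.
rewrite ler_norml; apply/andP; split; last by lra.
have h3 : wt sigma s <= x * wt sigma t := h2.
have : (2 - x) * wt sigma s <= wt sigma t.
  have [x2|x2] := leP 2 x; first by nra.
  have : (2 - x) * x <= 1 by have := sqr_ge0 (x - 1); lra.
  nra.
lra.
Qed.

(** The commutator of convolution with the multiplication by the weight. *)
Lemma weighted_defect A K f M B : exp_decay w A K -> 0 <= B ->
  (\int[mu]_s (`|K s| * growth s)%:E <= B%:E)%E -> wL2_le sigma f M ->
  wL2_le 0 (fun t => convol K f t * wt sigma t - convol K (fun s => f s * wt sigma s) t) (B ^+ 2 * M).
Proof.
move=> dK B0 KB fM; have [mK _] := dK; have [mf fM'] := fM.
have mw := measurable_wt sigma; have hM := wL2_le_wt fM; have [mh _] := hM.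
have mu_ : measurable_fun [set: R]
    (fun t => convol K f t * wt sigma t - convol K (fun s => f s * wt sigma s) t).
  apply: measurable_funB; last exact: measurable_convol.
  by apply: measurable_funM => //; exact: measurable_convol.
apply: L2_leP => //.
have mk : measurable_fun [set: R] (fun s => `|K s| * growth s).
  by apply: measurable_funM; [exact: measurable_normr|exact: measurable_growth].
have k0 s : 0 <= `|K s| * growth s by rewrite mulr_ge0// growth_ge0.
apply: (schur_test B0 mk k0 KB mh (L2_le_int hM) mu_) => t.
have i1 := convol_intbl w0 sw t dK fM; have i2 := convol_intbl w0 w0 t dK hM.
have -> : convol K f t * wt sigma t - convol K (fun s => f s * wt sigma s) t =
    Rint (fun s => K (t - s) * f s * (wt sigma t - wt sigma s)).
  rewrite mulrC /convol -RintZ// -RintB//; last exact: intblZ.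
  by congr Rint; apply/funext => s; ring.
have mm : measurable_fun [set: R] (fun s => K (t - s) * f s * (wt sigma t - wt sigma s)).
  by apply: measurable_funM; [exact: measurable_convol_integrand|exact: measurable_funB].
apply: le_trans (Rint_abs_int mm) _.
apply: int_mono => //.
- exact: measurable_normr.
- apply: measurable_normr; apply: measurable_funM => //; exact: (measurable_refl t mk).
move=> s; rewrite [leRHS]normrM (ger0_norm (k0 _)) !normrM (gtr0_norm (wt_gt0 _ _)).
rewrite [leRHS](_ : _ = `|K (t - s)| * `|f s| * (growth (t - s) * wt sigma s)); last by ring.
by rewrite ler_wpM2l ?mulr_ge0// wt_sub_le.
Qed.

Lemma growth_le_sinh s : growth s <= 2 * expR (- ((w - sigma) * `|s|)) * `|sinh (w * s)|.
Proof. exact: expRB1_le_sinh sigma0 (ltW sw). Qed.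

(** The bound does not depend on the angle, although SK itself does not stay
    bounded as the angle tends to 0. *)
Lemma SK_growth_le a b s : angle a b ->
  `|SK w a b s| * growth s <= 2 * (w / pi) * expR (- ((w - sigma) * `|s|)).
Proof.
move=> ab; have [a1 _] := angle_le1 ab; case: ab => a0 b0 _.
have hg := growth_le_sinh s; have g0 := growth_ge0 s.
rewrite /SK /sn; move: (sinh (w * s)) hg => X hg.
rewrite normrM (gtr0_norm (wpi_gt0 w0)); set e := expR _ in hg *.
have e0 : 0 < e by exact: expR_gt0.
have D0 : 0 < X ^+ 2 + b ^+ 2 by rewrite ltr_wpDl ?sqr_ge0// exprn_gt0.
rewrite -[leLHS]mulrA [leRHS](_ : _ = w / pi * (2 * e)); last by ring.
rewrite ler_pM2l ?wpi_gt0//.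
rewrite normrM normfV (gtr0_norm D0) normrM (gtr0_norm a0) mulrAC ler_pdivrMr//.
apply: (@le_trans _ _ (a * `|X| * (2 * e * `|X|))).
  by rewrite ler_wpM2l// mulr_ge0// ltW.
rewrite (_ : a * `|X| * (2 * e * `|X|) = 2 * e * (a * `|X| ^+ 2)); last by ring.
rewrite ler_pM2l ?mulr_gt0// real_normK ?num_real//.
apply: (@le_trans _ _ (X ^+ 2)); first by rewrite ler_piMl// sqr_ge0.
by rewrite lerDl sqr_ge0.
Qed.

(** The difference is 1 / sinh times ((1 - a) sinh^2 + b^2) / (sinh^2 + b^2), up to
    sign. Its first part is of order b^2 because 1 - a <= b^2, and the second one is
    b times a Poisson kernel. *)
Lemma SK_sub_growth_le a b s : angle a b ->
  `|SK w a b s - S_kernel w s| * growth s <=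
  2 * (w / pi) * b * expR (- ((w - sigma) * `|s|)) + 2 * b * PK w b s.
Proof.
move=> ab; have [a1 b1] := angle_le1 ab; have a2 := angle_sub1 ab.
case: ab => a0 b0 _.
have hg := growth_le_sinh s; have g0 := growth_ge0 s.
have ch := cosh_ge1 (w * s).
rewrite /SK /sn /S_kernel /PK /pn -mulrBr.
move: (sinh (w * s)) hg => X hg; move: (cosh (w * s)) ch => Y ch.
have Y0 : 0 <= Y by apply: le_trans ch.
rewrite normrM (gtr0_norm (wpi_gt0 w0)); set e := expR _ in hg *.
have e0 : 0 < e by exact: expR_gt0.
have e1 : e <= 1 by rewrite expR_le1 oppr_le0 mulr_ge0// ltW.
have D0 : 0 < X ^+ 2 + b ^+ 2 by rewrite ltr_wpDl ?sqr_ge0// exprn_gt0.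
rewrite -[leLHS]mulrA [leRHS](_ : _ = w / pi * (2 * b * e + 2 * b * (b * Y / (X ^+ 2 + b ^+ 2)))); last by ring.
rewrite ler_pM2l ?wpi_gt0//.
have [X0|X0] := eqVneq X 0.
  have -> : growth s = 0.
    apply/eqP; rewrite eq_le g0 andbT; apply: le_trans hg _.
    by rewrite X0 normr0 mulr0.
  by rewrite mulr0 addr_ge0// !mulr_ge0 ?invr_ge0 ?(ltW b0) ?(ltW e0) ?(ltW D0).
have aX : 0 < `|X| by rewrite normr_gt0.
have -> : a * X / (X ^+ 2 + b ^+ 2) - X^-1 =
    - (((1 - a) * X ^+ 2 + b ^+ 2) / (X ^+ 2 + b ^+ 2)) / X.
  by field; rewrite X0 gt_eqF.
rewrite normrM normrN normfV.
set r := _ / (X ^+ 2 + b ^+ 2).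
have r0 : 0 <= r.
  by rewrite divr_ge0 ?(ltW D0)// addr_ge0 ?sqr_ge0// mulr_ge0 ?sqr_ge0// subr_ge0.
rewrite (ger0_norm r0).
apply: (@le_trans _ _ (r / `|X| * (2 * e * `|X|))).
  by rewrite ler_wpM2l// divr_ge0.
rewrite (_ : r / `|X| * (2 * e * `|X|) = 2 * (e * r)); last by field; rewrite gt_eqF.
rewrite -!(mulrA 2) -mulrDr ler_pM2l//.
have b2 : b ^+ 2 <= b by rewrite expr2 ler_piMl// ltW.
have rE : r <= b + b ^+ 2 * (Y / (X ^+ 2 + b ^+ 2)).
  rewrite /r mulrDl; apply: lerD.
    rewrite ler_pdivrMr//; apply: (@le_trans _ _ (b * X ^+ 2)).
      by rewrite ler_wpM2r ?sqr_ge0// (le_trans a2).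
    by rewrite ler_pM2l// lerDl sqr_ge0.
  by rewrite ler_pM2l ?exprn_gt0// ler_peMl// invr_ge0 ltW.
set q := b ^+ 2 * _ in rE.
have q0 : 0 <= q by rewrite mulr_ge0 ?sqr_ge0// divr_ge0// ltW.
apply: (@le_trans _ _ (e * (b + q))); first by rewrite ler_pM2l.
rewrite [leRHS](_ : _ = e * b + q); last by rewrite /q; ring.
by rewrite mulrDr lerD2l ler_piMl.
Qed.

Let c1 := 2 * (w / pi) * (2 / (w - sigma)) + 2.

Let c1_gt0 : 0 < c1.
Proof. by rewrite ltr_wpDl// !mulr_ge0 ?invr_ge0 ?(ltW w0) ?(ltW d0) ?pi_ge0. Qed.

Let me : measurable_fun [set: R] (fun s => expR (- ((w - sigma) * `|s|))).
Proof. exact: (measurable_wt (w - sigma)). Qed.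

Let ie c : 0 <= c -> (\int[mu]_s (c * expR (- ((w - sigma) * `|s|)))%:E = (c * (2 / (w - sigma)))%:E)%E.
Proof.
move=> c0; rewrite (int_scale c0 me (fun s => expR_ge0 _)).
by rewrite integral_expRabs.
Qed.

Lemma SK_growth_int a b : angle a b ->
  (\int[mu]_s (`|SK w a b s| * growth s)%:E <= c1%:E)%E.
Proof.
move=> ab; have [_ b0 _] := ab.
have wp : 0 <= 2 * (w / pi) by rewrite mulr_ge0// ltW// wpi_gt0.
apply: (@le_trans _ _ (\int[mu]_s (2 * (w / pi) * expR (- ((w - sigma) * `|s|)))%:E)%E).
  apply: int_mono.
  - apply: measurable_funM; last exact: measurable_growth.
    by apply: measurable_normr; exact: measurable_SK.
  - exact: measurable_funM.
  - by move=> s; rewrite mulr_ge0// growth_ge0.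
  - by move=> s; exact: SK_growth_le.
by rewrite ie// lee_fin lerDl.
Qed.

Lemma SK_sub_growth_int a b a' b' : angle a b -> angle a' b' ->
  (\int[mu]_s (`|SK w a b s - SK w a' b' s| * growth s)%:E <= (c1 * (b + b'))%:E)%E.
Proof.
move=> ab ab'; have [_ b0 _] := ab; have [_ b0' _] := ab'.
have wp : 0 <= 2 * (w / pi) by rewrite mulr_ge0// ltW// wpi_gt0.
pose g1 (c s : R) := 2 * (w / pi) * c * expR (- ((w - sigma) * `|s|)).
pose g2 c s := 2 * c * PK w c s.
have m1 c : measurable_fun [set: R] (g1 c) by exact: measurable_funM.
have m2 c : 0 < c -> measurable_fun [set: R] (g2 c).
  by move=> c0; apply: measurable_funM => //; exact: measurable_PK.
have p1 c s : 0 < c -> 0 <= g1 c s.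
  by move=> c0; rewrite /g1 !mulr_ge0 ?(ltW c0) ?(ltW w0) ?invr_ge0 ?pi_ge0 ?expR_ge0.
have p2 c s : 0 < c -> 0 <= g2 c s by move=> c0; rewrite /g2 mulr_ge0 ?PK_ge0// mulr_ge0// ltW.
have I c : 0 < c -> (\int[mu]_s (g1 c s + g2 c s)%:E = (c1 * c)%:E)%E.
  move=> c0; rewrite int_add//; last 3 first.
  - exact: m2.
  - by move=> s; exact: p1.
  - by move=> s; exact: p2.
  rewrite /g1 ie; last by rewrite mulr_ge0// ltW.
  rewrite /g2 int_scale; last 3 first.
  - by rewrite mulr_ge0// ltW.
  - exact: measurable_PK.
  - by move=> s; exact: PK_ge0.
  by rewrite integral_PK// -EFinM -EFinD; congr EFin; rewrite /c1; ring.
apply: (@le_trans _ _ (\int[mu]_s ((g1 b s + g2 b s) + (g1 b' s + g2 b' s))%:E)%E).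
  apply: int_mono.
  - apply: measurable_funM; last exact: measurable_growth.
    by apply: measurable_normr; apply: measurable_funB; exact: measurable_SK.
  - by apply: measurable_funD; apply: measurable_funD => //; exact: m2.
  - by move=> s; rewrite mulr_ge0// growth_ge0.
  move=> s; have h1 := SK_sub_growth_le s ab; have h2 := SK_sub_growth_le s ab'.
  apply: le_trans (lerD h1 h2); rewrite -mulrDl ler_wpM2r ?growth_ge0//.
  rewrite -[SK w a b s - SK w a' b' s](_ : (SK w a b s - S_kernel w s) - (SK w a' b' s - S_kernel w s) = _); last by ring.
  exact: ler_normB.
rewrite int_add.
- by rewrite !I// -EFinD mulrDr.
- by apply: measurable_funD => //; exact: m2.
- by apply: measurable_funD => //; exact: m2.
- by move=> s; rewrite addr_ge0 ?p1 ?p2.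
- by move=> s; rewrite addr_ge0 ?p1 ?p2.
Qed.

Lemma exp_decayB A B K L : exp_decay w A K -> exp_decay w B L -> exp_decay w (A + B) (fun s => K s - L s).
Proof.
move=> [mK bK] [mL bL]; split; first exact: measurable_funB.
by move=> s; apply: le_trans (ler_normB _ _) _; rewrite mulrDl lerD.
Qed.

Lemma wL2_le_from_defect K f M N : measurable_fun [set: R] K -> wL2_le sigma f M ->
  wL2_le 0 (convol K (fun s => f s * wt sigma s)) M ->
  wL2_le 0 (fun t => convol K f t * wt sigma t - convol K (fun s => f s * wt sigma s) t) N ->
  wL2_le sigma (convol K f) (2 * (M + N)).
Proof.
move=> mK [mf _] h1 h2; apply: wL2_le_unwt; first exact: measurable_convol.
by apply: eq_wL2_le (wL2_leD h1 h2) => t; rewrite addrC subrK.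
Qed.

Lemma convol_SK_bounded a b f M : angle a b -> wL2_le sigma f M ->
  wL2_le sigma (convol (SK w a b) f) (2 * (M + c1 ^+ 2 * M)).
Proof.
move=> ab fM; have [_ b0 _] := ab; apply: (wL2_le_from_defect _ fM).
- exact: measurable_SK.
- exact: (convol_SK_contract w0 ab (wL2_le_wt fM)).
- apply: (weighted_defect (exp_decay_SK_angle w0 ab) _ _ fM); first exact: ltW.
  exact: SK_growth_int.
Qed.

Lemma convol_SK_Cauchy f M : wL2_le sigma f M -> forall e, 0 < e ->
  exists2 d, 0 < d & forall a b a' b', angle a b -> angle a' b' -> b < d -> b' < d ->
  wL2_le sigma (fun t => convol (SK w a b) f t - convol (SK w a' b') f t) e.
Proof.
move=> fM e e0; have M0 := wL2_le_ge0 fM.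
have e4 : 0 < e / 4 by rewrite divr_gt0.
have [d1 d10 d1P] := convol_SK_Cauchy0 w0 (wL2_le_wt fM) e4.
(* With b, b' < e / q the commutator contributes at most e / 2 to the final bound. *)
pose q := 16 * (c1 ^+ 2 * M + 1).
have q0 : 0 < q by rewrite mulr_gt0// ltr_wpDl// mulr_ge0// sqr_ge0.
exists (Num.min d1 (Num.min 1 (e / q))).
  by rewrite !lt_min d10 ltr01 divr_gt0.
move=> a b a' b' ab ab'; rewrite !lt_min => /and3P[bd b1 be] /and3P[bd' b1' be'].
have [_ b0 _] := ab; have [_ b0' _] := ab'.
have dd := exp_decayB (exp_decay_SK_angle w0 ab) (exp_decay_SK_angle w0 ab'); have [md _] := dd.
have cb0 : 0 <= c1 * (b + b') by rewrite mulr_ge0 ?(ltW c1_gt0)// addr_ge0// ltW.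
have h1 := weighted_defect dd cb0 (SK_sub_growth_int ab ab') fM.
have h2 : wL2_le 0 (convol (fun s => SK w a b s - SK w a' b' s) (fun s => f s * wt sigma s)) (e / 4).
  apply: eq_wL2_le (d1P a b a' b' ab ab' bd bd') => t.
  by rewrite (convolBl w0 w0 t (exp_decay_SK_angle w0 ab) (exp_decay_SK_angle w0 ab') (wL2_le_wt fM)).
have [mf _] := fM.
have := wL2_leD h2 h1 => h3.
have h4 : wL2_le sigma (convol (fun s => SK w a b s - SK w a' b' s) f)
    (2 * (e / 4 + (c1 * (b + b')) ^+ 2 * M)).
  apply: wL2_le_unwt; first exact: measurable_convol.
  by apply: eq_wL2_le h3 => t; rewrite addrC subrK.
have h5 : 2 * (e / 4 + (c1 * (b + b')) ^+ 2 * M) <= e.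
  rewrite exprMn.
  have hb : (b + b') ^+ 2 <= 4 * (e / q) by nra.
  have hc : 0 <= c1 ^+ 2 * M by rewrite mulr_ge0// sqr_ge0.
  have := ler_wpM2l hc hb.
  have : c1 ^+ 2 * M * (e / q) <= e / 16.
    rewrite mulrA ler_pdivrMr// /q; nra.
  lra.
apply: (eq_wL2_le _ (wL2_le_trans h5 h4)) => t.
exact: (convolBl w0 sw t (exp_decay_SK_angle w0 ab) (exp_decay_SK_angle w0 ab') fM).
Qed.

End WeightedCauchy.

(** * Completeness of the weighted space *)

Section Completeness.
Context {R : realType}.
Local Notation mu := (@lebesgue_measure R).
Implicit Types (f g h : R -> R).
Variable sigma : R.

(** Chosen so that 4^n times the n-th squared norm is summable. *)
Definition tol (n : nat) : R := 4 ^- n * (1 / (2 ^ n.+1)%:R).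

Lemma tol_gt0 n : 0 < tol n.
Proof. by rewrite mulr_gt0 ?invr_gt0 ?exprn_gt0// divr_gt0// ltr0n expn_gt0. Qed.

Lemma pow2_ge n : n%:R <= 2 ^+ n :> R.
Proof. by rewrite -natrX ler_nat; apply/ltnW/ltn_expl. Qed.

Lemma tol_le_eventually e : 0 < e -> exists n, tol n <= e.
Proof.
move=> e0; exists (Num.bound e^-1).
set n := Num.bound _.
have h1 : e^-1 <= 2 ^+ n.
  apply: le_trans (pow2_ge n); apply: ltW.
  by apply: archi_boundP; rewrite invr_ge0 ltW.
have h2 : tol n <= 2 ^- n.
  rewrite /tol -[leRHS]mul1r div1r natrX ler_pM ?invr_ge0 ?exprn_ge0//.
    by rewrite invf_le1 ?exprn_gt0// exprn_ege1// ler1n.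
  by rewrite lef_pV2 ?posrE ?exprn_gt0// ler_weXn2l// ler1n.
apply: le_trans h2 _; rewrite -[leRHS]invrK lef_pV2 ?posrE ?exprn_gt0 ?invr_gt0//.
Qed.

Lemma cvg_geometric_bound (u : nat -> R) (C : R) :
  (forall n, `|u n.+1 - u n| <= C / 2 ^+ n) -> cvgn u.
Proof.
move=> uC.
have C0 : 0 <= C.
  by have := uC 0%N; rewrite expr0 divr1; apply: le_trans.
have cS : cvgn (series (fun n => u n.+1 - u n)).
  apply: normed_cvg.
  have h0 n : 0 <= geometric C 2^-1 n by rewrite /= mulr_ge0// exprn_ge0// invr_ge0.
  have h1 n : [sequence `|u n.+1 - u n|]_n n <= geometric C 2^-1 n by rewrite /= exprVn.
  have h2 : cvgn (series (geometric C (2^-1 : R))).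
    by apply: is_cvg_geometric_series; rewrite ger0_norm ?invr_ge0// invf_lt1 ?ltr1n.
  apply: (series_le_cvg _ h0 h1 h2) => n /=; exact: normr_ge0.
have -> : u = (fun n => u 0%N + series (fun n => u n.+1 - u n) n).
  by apply/funext => n; rewrite /series /= telescope_sumr// addrC subrK.
by apply: is_cvgD => //; exact: is_cvg_cst.
Qed.

(** The sum over n of 4^n |u (n + 1) - u n|^2, weighted, has a finite integral, hence is
    finite almost everywhere; so the increments are O (2^-n) there. *)
Lemma fast_cvg (u : nat -> R -> R) :
  (forall n, wL2_le sigma (fun t => u n.+1 t - u n t) (tol n)) ->
  {ae mu, forall t, cvgn (fun n => u n t)}.
Proof.
move=> uT.
pose D n t := ((u n.+1 t - u n t) * wt sigma t) ^+ 2.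
have mD n : measurable_fun [set: R] (D n).
  by apply: measurable_weighted_sqr; have [] := uT n.
have D0 n t : 0 <= D n t by rewrite /D sqr_ge0.
pose G n t : \bar R := (4 ^+ n * D n t)%:E.
have G0 n t : (0 <= G n t)%E by rewrite lee_fin mulr_ge0// exprn_ge0.
have mG n : measurable_fun [set: R] (G n).
  by apply/measurable_EFinP; exact: measurable_funM.
have IG n : (\int[mu]_t G n t <= (1 / (2 ^ n.+1)%:R)%:E)%E.
  rewrite /G int_scale ?exprn_ge0//.
  have [_ h] := uT n.
  apply: (@le_trans _ _ ((4 ^+ n)%:E * (tol n)%:E)%E).
    by apply: lee_wpmul2l => //; rewrite lee_fin exprn_ge0.
  have n0 : 4 ^+ n != 0 :> R by rewrite gt_eqF// exprn_gt0.
  by rewrite -EFinM lee_fin /tol (mulVKf n0).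
pose S t := (\sum_(n <oo) G n t)%E.
have IS : (\int[mu]_t S t <= 1%:E)%E.
  rewrite integral_nneseries//.
  apply: le_trans (epsilon_trick0 xpredT (ler01 (R := R))).
  by apply: lee_nneseries => [n _ _|n _]; [exact: integral_ge0|exact: IG].
have S0 t : (0 <= S t)%E by apply: nneseries_ge0.
have mS : measurable_fun [set: R] S.
  by apply: ge0_emeasurable_sum.
have iS : mu.-integrable [set: R] S.
  apply/integrableP; split=> //.
  under eq_integral do rewrite gee0_abs//.
  by apply: le_lt_trans IS _; rewrite ltry.
have := integrable_ae measurableT iS.
move=> aeS; apply: ae_imp aeS _ => t /(_ I) St.
pose C := fine (S t).
have SE : S t = C%:E by rewrite /C fineK.
have C0 : 0 <= C by rewrite -lee_fin -SE.
have GC n : 4 ^+ n * D n t <= C.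
  rewrite -lee_fin -SE /S (nneseriesD1 (n := n))// leeDl//.
  by apply: nneseries_ge0.
have w0 := wt_gt0 sigma t.
apply: (@cvg_geometric_bound _ (Num.sqrt C / wt sigma t)) => n.
rewrite mulrAC ler_pdivlMr//.
rewrite -(gtr0_norm w0) -normrM -sqrtr_sqr ler_pdivlMr ?exprn_gt0//.
have p0 : 0 <= 2 ^+ n :> R by rewrite exprn_ge0.
rewrite -(ger0_norm p0) -(sqrtr_sqr (2 ^+ n)) -sqrtrM ?sqr_ge0// ler_wsqrtr//.
apply: le_trans (GC n); rewrite mulrC /D -exprM mulnC exprM.
by rewrite (_ : 2 ^+ 2 = 4)//; ring.
Qed.

(** Riesz-Fischer for a family indexed by b -> 0: a rapidly Cauchy sequence of
    parameters has an almost everywhere limit g, and Fatou transfers the Cauchy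
    estimate to g for the whole family. *)
Lemma weighted_complete (F : R -> R -> R) :
  (forall b, 0 < b -> b < 1 -> exists N, wL2_le sigma (F b) N) ->
  (forall e, 0 < e -> exists2 d, 0 < d & forall b b', 0 < b -> b < d -> 0 < b' -> b' < d ->
    wL2_le sigma (fun t => F b t - F b' t) e) ->
  exists g, (exists N, wL2_le sigma g N) /\
    forall e, 0 < e -> exists2 d, 0 < d & forall b, 0 < b -> b < d ->
      wL2_le sigma (fun t => F b t - g t) e.
Proof.
move=> Fq FC.
have : forall n, exists d, 0 < d /\ forall b b', 0 < b -> b < d -> 0 < b' -> b' < d ->
    wL2_le sigma (fun t => F b t - F b' t) (tol n).
  by move=> n; have [d d0 dP] := FC _ (tol_gt0 n); exists d.
move=> /choice[d dP].
(* The running minimum m makes the n-th threshold valid for all later parameters;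
   it is halved to turn <= into <. *)
pose m := fix m n := if n is k.+1 then Num.min (m k) (d k.+1) else Num.min 1 (d 0%N).
have m0 n : 0 < m n.
  elim: n => [|n IH] /=; first by rewrite lt_min ltr01; have [] := dP 0%N.
  by rewrite lt_min IH; have [] := dP n.+1.
have md n : m n <= d n by case: n => [|n] /=; rewrite ge_min lexx orbT.
have m1 n : m n <= 1.
  by elim: n => [|n IH] /=; rewrite ge_min ?lexx// IH.
have mS n k : m (n + k)%N <= m n.
  elim: k => [|k IH]; first by rewrite addn0.
  by rewrite addnS /= ge_min IH.
pose bn n := m n / 2.
have b0 n : 0 < bn n by rewrite divr_gt0.
have bm n k : bn (n + k)%N < d n.
  apply: lt_le_trans (md n); apply: lt_le_trans (mS n k).
  by rewrite /bn ltr_pdivrMr// mulr_natr mulr2n ltrDl.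
pose u n := F (bn n).
have uS n : wL2_le sigma (fun t => u n.+1 t - u n t) (tol n).
  have [_ h] := dP n; apply: h => //.
  - by have := bm n 1%N; rewrite addn1.
  - by have := bm n 0%N; rewrite addn0.
have b1 n : bn n < 1.
  by rewrite /bn ltr_pdivrMr// mul1r; apply: le_lt_trans (m1 n) _; rewrite ltr1n.
have mu_ n : measurable_fun [set: R] (u n).
  by have [N []] := Fq _ (b0 n) (b1 n).
(* The upper limit exists everywhere and is Borel; it is the limit where there is one. *)
pose g t := fine (limn_esup (fun n => (u n t)%:E)).
have mg : measurable_fun [set: R] g.
  apply: (measurableT_comp (@fine_measurable R setT measurableT)).
  by apply: measurable_fun_limn_esup => n; exact/measurable_EFinP.
have ug : {ae mu, forall t, u n t @[n --> \oo] --> g t}.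
  apply: ae_imp (fast_cvg uS) _ => t /cvg_ex[l ul].
  have ct : (u n t)%:E @[n --> \oo] --> l%:E by apply: cvg_EFin => //; exact: nearW.
  by have [_ e] := cvg_limn_einf_sup ct; rewrite /g e.
have key n b : 0 < b -> b < d n -> measurable_fun [set: R] (F b) ->
    wL2_le sigma (fun t => F b t - g t) (tol n).
  move=> bp bd mF; split; first exact: measurable_funB.
  apply: (fatou_real (gn := fun k t => ((F b t - u (n + k)%N t) * wt sigma t) ^+ 2)).
  - by move=> k; apply: measurable_weighted_sqr; exact: measurable_funB.
  - by apply: measurable_weighted_sqr; exact: measurable_funB.
  - by move=> k t; rewrite sqr_ge0.
  - by move=> t; rewrite sqr_ge0.
  - apply: ae_imp ug _ => t ut.
    have us : u (n + k)%N t @[k --> \oo] --> g t.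
      exact: (cvg_comp (addn n) (fun n => u n t) (cvg_addnl n) ut).
    have c : (F b t - u (n + k)%N t) * wt sigma t @[k --> \oo] --> (F b t - g t) * wt sigma t.
      by apply: cvgMr_tmp; apply: cvgB => //; exact: cvg_cst.
    have -> : (fun k => ((F b t - u (n + k)%N t) * wt sigma t) ^+ 2) =
       (fun k => ((F b t - u (n + k)%N t) * wt sigma t) * ((F b t - u (n + k)%N t) * wt sigma t)).
      by apply/funext => k; rewrite expr2.
    by rewrite expr2; exact: (cvgM c c).
  - by move=> k; have [_ h] := dP n; have [] := h b _ bp bd (b0 _) (bm n k).
exists g; split.
  have bd : bn 0%N < d 0%N by have := bm 0%N 0%N; rewrite addn0.
  have k0 := key 0%N (bn 0%N) (b0 _) bd (mu_ 0%N).
  have [N hN] := Fq _ (b0 0%N) (b1 0%N).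
  exists (2 * (N + tol 0)); apply: eq_wL2_le (wL2_leB hN k0) => t.
  by rewrite opprB addrC subrK.
move=> e e0; have [n ne] := tol_le_eventually e0.
exists (Num.min 1 (d n)); first by rewrite lt_min ltr01; have [] := dP n.
move=> b bp; rewrite lt_min => /andP[bb1 bd].
apply: wL2_le_trans ne _; apply: key => //.
by have [N []] := Fq b bp bb1.
Qed.

End Completeness.

(** * Letting one angle tend to 0 *)

Section KernelPerturbation.
Context {R : realType}.
Implicit Types (f g h K L : R -> R).
Variable w : R.
Hypothesis w0 : 0 < w.

Lemma exp_decay_cosh_den (c b : R) K : 0 < b -> b <= 1 -> 0 <= c -> measurable_fun [set: R] K ->
  (forall s, `|K s| <= w / pi * (c * (cosh (w * s) / (sinh (w * s) ^+ 2 + b ^+ 2)))) ->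
  exp_decay w (c * decay_const w b) K.
Proof.
move=> b0 b1 c0 mK hK; split => // s; apply: le_trans (hK s) _.
rewrite /decay_const [leRHS](_ : _ = w / pi * (c * (2 / b ^+ 2 * expR (- (w * `|s|))))); last by ring.
rewrite ler_pM2l ?wpi_gt0// ler_wpM2l//.
by rewrite -{3}(gtr0_norm w0) -normrM; exact: cosh_den_le.
Qed.

(** As b tends to 0 the angle of this kernel tends to pi / 2, where its amplitude
    vanishes. *)
Lemma exp_decay_SK_small (a b : R) : angle a b -> exp_decay w (b * decay_const w a) (SK w b a).
Proof.
move=> ab; have [a1 b1] := angle_le1 ab; case: ab => a0 b0 _.
apply: exp_decay_cosh_den => //; [exact: ltW|exact: measurable_SK|move=> s].
rewrite /SK /sn; have := norm_sinh_le_cosh (w * s).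
move: (sinh _) (cosh _) => X Y XY.
have D0 : 0 < X ^+ 2 + a ^+ 2 by rewrite ltr_wpDl ?sqr_ge0// exprn_gt0.
rewrite normrM (gtr0_norm (wpi_gt0 w0)) ler_pM2l ?wpi_gt0//.
by rewrite normrM normfV (gtr0_norm D0) normrM (gtr0_norm b0) -mulrA ler_pM2l// ler_pM2r ?invr_gt0.
Qed.

Lemma exp_decay_PK_sub1 (a : R) : 0 < a -> a <= 1 ->
  exp_decay w ((1 - a) * decay_const w a) (fun s => PK w a s - PK w 1 s).
Proof.
move=> a0 a1; apply: exp_decay_cosh_den => //; first by rewrite subr_ge0.
  by apply: measurable_funB; exact: measurable_PK.
move=> s; rewrite /PK /pn -mulrBr; have c2 := cosh2 (w * s); have c1 := cosh_ge1 (w * s).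
move: (sinh _) (cosh _) c2 c1 => X Y c2 c1.
have D0 : 0 < X ^+ 2 + a ^+ 2 by rewrite ltr_wpDl ?sqr_ge0// exprn_gt0.
have Y0 : 0 < Y by apply: lt_le_trans c1.
rewrite expr1n.
have XY : X ^+ 2 + 1 = Y ^+ 2 by rewrite c2 addrC.
rewrite XY normrM (gtr0_norm (wpi_gt0 w0)) ler_pM2l ?wpi_gt0//.
have -> : a * Y / (X ^+ 2 + a ^+ 2) - 1 * Y / Y ^+ 2 =
  (1 - a) * (Y / (X ^+ 2 + a ^+ 2) * ((a - X ^+ 2) / Y ^+ 2)).
  have nz : X ^+ 2 + 1 != 0 by rewrite XY gt_eqF// exprn_gt0.
  by rewrite -XY; field; rewrite nz gt_eqF.
rewrite normrM ger0_norm ?subr_ge0// ler_wpM2l ?subr_ge0//.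
rewrite normrM ger0_norm ?divr_ge0 ?(ltW Y0) ?(ltW D0)//.
rewrite ler_piMr ?divr_ge0 ?(ltW Y0) ?(ltW D0)//.
rewrite normrM normfV (gtr0_norm (exprn_gt0 2 Y0)) ler_pdivrMr ?exprn_gt0// mul1r.
by rewrite -XY ler_norml; apply/andP; split; have := sqr_ge0 X; lra.
Qed.

Lemma exp_decay_SK_sub (a b a' b' : R) : `|a| <= 1 -> 0 < b -> 0 < b' -> b' <= 1 ->
  exp_decay w ((`|a' - a| + `|b ^+ 2 - b' ^+ 2| / b ^+ 2) * decay_const w b')
    (fun s => SK w a' b' s - SK w a b s).
Proof.
move=> a1 b0 b0' b1'; have bb : 0 < b ^+ 2 by rewrite exprn_gt0.
apply: exp_decay_cosh_den => //.
- by rewrite addr_ge0// divr_ge0// ltW.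
- by apply: measurable_funB; exact: measurable_SK.
move=> s; rewrite /SK /sn -mulrBr; have := norm_sinh_le_cosh (w * s).
move: (sinh _) (cosh _) => X Y XY.
have D0 : 0 < X ^+ 2 + b ^+ 2 by rewrite ltr_wpDl ?sqr_ge0.
have D0' : 0 < X ^+ 2 + b' ^+ 2 by rewrite ltr_wpDl ?sqr_ge0// exprn_gt0.
rewrite normrM (gtr0_norm (wpi_gt0 w0)) ler_pM2l ?wpi_gt0//.
have -> : a' * X / (X ^+ 2 + b' ^+ 2) - a * X / (X ^+ 2 + b ^+ 2) =
  (a' - a + a * ((b ^+ 2 - b' ^+ 2) / (X ^+ 2 + b ^+ 2))) * (X / (X ^+ 2 + b' ^+ 2)).
  by field; rewrite !gt_eqF.
rewrite normrM; apply: ler_pM => //.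
  apply: le_trans (ler_normD _ _) _; rewrite lerD2l normrM.
  rewrite -[leRHS]mul1r; apply: ler_pM => //.
  rewrite normrM normfV (gtr0_norm D0) ler_wpM2l// lef_pV2 ?posrE//.
  by rewrite lerDr sqr_ge0.
by rewrite normrM normfV (gtr0_norm D0') ler_pM2r ?invr_gt0.
Qed.

Lemma exp_decay_PK_sub (b b' : R) : 0 < b -> b <= 1 -> 0 < b' -> b' <= 1 ->
  exp_decay w ((`|b' - b| + `|b ^+ 2 - b' ^+ 2| / b ^+ 2) * decay_const w b')
    (fun s => PK w b' s - PK w b s).
Proof.
move=> b0 b1 b0' b1'; have bb : 0 < b ^+ 2 by rewrite exprn_gt0.
apply: exp_decay_cosh_den => //.
- by rewrite addr_ge0// divr_ge0// ltW.
- by apply: measurable_funB; exact: measurable_PK.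
move=> s; rewrite /PK /pn -mulrBr; have := cosh_gt0 (w * s).
move: (sinh _) (cosh _) => X Y Y0.
have D0 : 0 < X ^+ 2 + b ^+ 2 by rewrite ltr_wpDl ?sqr_ge0.
have D0' : 0 < X ^+ 2 + b' ^+ 2 by rewrite ltr_wpDl ?sqr_ge0// exprn_gt0.
rewrite normrM (gtr0_norm (wpi_gt0 w0)) ler_pM2l ?wpi_gt0//.
have -> : b' * Y / (X ^+ 2 + b' ^+ 2) - b * Y / (X ^+ 2 + b ^+ 2) =
  (b' - b + b * ((b ^+ 2 - b' ^+ 2) / (X ^+ 2 + b ^+ 2))) * (Y / (X ^+ 2 + b' ^+ 2)).
  by field; rewrite !gt_eqF.
rewrite normrM; apply: ler_pM => //.
  apply: le_trans (ler_normD _ _) _; rewrite lerD2l normrM.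
  rewrite -[leRHS]mul1r; apply: ler_pM => //; first by rewrite gtr0_norm.
  rewrite normrM normfV (gtr0_norm D0) ler_wpM2l// lef_pV2 ?posrE//.
  by rewrite lerDr sqr_ge0.
by rewrite normrM normfV (gtr0_norm D0') (gtr0_norm Y0).
Qed.

End KernelPerturbation.

Section LimitIdentity.
Context {R : realType}.
Implicit Types (f g h K L : R -> R).
Variables (w sigma : R).
Hypotheses (w0 : 0 < w) (sigma0 : 0 <= sigma) (sw : sigma < w).

Lemma norm_sub_le1 (x y : R) : 0 <= x -> x <= 1 -> 0 <= y -> y <= 1 -> `|x - y| <= 1.
Proof. by move=> *; rewrite ler_norml; apply/andP; split; lra. Qed.

Lemma eq_by_eps (x y C : R) : (forall e, 0 < e -> `|x - y| <= e * C) -> x = y.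
Proof.
move=> h; apply/eqP; rewrite -subr_eq0 -normr_le0; apply/ler_addgt0Pl => e e0.
rewrite addr0; have C0 : 0 < `|C| + 1 by rewrite ltr_wpDl.
apply: le_trans (h (e / (`|C| + 1)) _) _; first by rewrite divr_gt0.
rewrite mulrAC ler_pdivrMr// ler_pM2l//.
by apply: le_trans (ler_norm C) _; rewrite lerDl.
Qed.

Lemma exp_decay_le A A' K : A <= A' -> exp_decay w A K -> exp_decay w A' K.
Proof.
move=> AA [mK hK]; split => // s; apply: le_trans (hK s) _.
by rewrite ler_pM2r ?expR_gt0.
Qed.

Lemma decay_const_ge0 b : 0 <= decay_const w b.
Proof. by rewrite /decay_const mulr_ge0 ?(ltW (wpi_gt0 w0))// divr_ge0 ?sqr_ge0. Qed.

Lemma decay_const_half b b' : 0 < b -> b / 2 <= b' -> decay_const w b' <= 4 * decay_const w b.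
Proof.
move=> b0 bb; have b0' : 0 < b' by apply: lt_le_trans bb; rewrite divr_gt0.
rewrite /decay_const (mulrCA 4) (ler_pM2l (wpi_gt0 w0)) (mulrCA 4) ler_pM2l//.
rewrite ler_pdivlMr ?exprn_gt0// mulrC ler_pdivrMr ?exprn_gt0//.
by nra.
Qed.

(** Adding the angle of (a', b') moves sine and cosine by O (b'). *)
Lemma angle_perturb (a b a' b' : R) : angle a b -> angle a' b' -> b' <= b / 4 ->
  [/\ `|(a * a' - b * b') - a| <= 2 * b', `|sin_add a b a' b' - b| <= 2 * b',
      `|b ^+ 2 - sin_add a b a' b' ^+ 2| <= 4 * b' & b / 2 <= sin_add a b a' b'].
Proof.
move=> ab ab' b'b; have h := angle_sub1 ab'; have [a1 b1] := angle_le1 ab.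
have [a1' b1'] := angle_le1 ab'; have [s0 s1] := sin_add_bounds ab ab'.
case: ab ab' => a0 b0 _ [a0' b0' _].
have h2 : 1 - a' <= b' by apply: le_trans h _; rewrite expr2 ler_piMl// ltW.
have m1 : 0 <= a * (1 - a') by rewrite mulr_ge0 ?subr_ge0// ltW.
have m2 : a * (1 - a') <= b' by apply: le_trans h2; rewrite ler_piMl// subr_ge0.
have m3 : 0 <= b * (1 - a') by rewrite mulr_ge0 ?subr_ge0// ltW.
have m4 : b * (1 - a') <= b' by apply: le_trans h2; rewrite ler_piMl// subr_ge0.
have m5 : 0 < a * b' by exact: mulr_gt0.
have m6 : a * b' <= b' by rewrite ler_piMl// ltW.
have m7 : 0 < b * b' by exact: mulr_gt0.
have m8 : b * b' <= b' by rewrite ler_piMl// ltW.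
have h3 : `|b - sin_add a b a' b'| <= 2 * b'.
  rewrite (_ : b - _ = b * (1 - a') - a * b'); last by rewrite /sin_add; ring.
  apply: le_trans (ler_normB _ _) _.
  by rewrite (ger0_norm m3) (gtr0_norm m5) mulr_natl mulr2n lerD.
split.
- rewrite (_ : _ - a = - (a * (1 - a')) - b * b'); last by ring.
  apply: le_trans (ler_normB _ _) _.
  by rewrite normrN (ger0_norm m1) (gtr0_norm m7) mulr_natl mulr2n lerD.
- by rewrite distrC.
- rewrite subr_sqr normrM (_ : 4 * b' = 2 * b' * 2); last by ring.
  by apply: ler_pM => //; rewrite ger0_norm; lra.
- have -> : sin_add a b a' b' = b - b * (1 - a') + a * b' by rewrite /sin_add; ring.
  by lra.
Qed.

(** [g] is the limit of the regularised transforms of [f] in the weighted norm. It turns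
    out to be the principal value transform of [f]. *)
Definition Strans f g := (exists N, wL2_le sigma g N) /\
  forall e, 0 < e -> exists2 d, 0 < d &
    forall a b, angle a b -> b < d -> wL2_le sigma (fun t => convol (SK w a b) f t - g t) e.

Lemma cos_of_sin_angle (a b : R) : angle a b -> a = cos_of_sin b.
Proof.
by case=> a0 b0 e; rewrite /cos_of_sin -e addrK sqrtr_sqr ger0_norm// ltW.
Qed.

Lemma Strans_exists f M : wL2_le sigma f M -> exists g, Strans f g.
Proof.
move=> fM; have := @weighted_complete _ sigma (fun b => convol (SK w (cos_of_sin b) b) f).
case.
- move=> b b0 b1; eexists; exact: (convol_SK_bounded w0 sigma0 sw (angle_cos_of_sin b0 b1) fM).
- move=> e e0; have [d d0 dP] := convol_SK_Cauchy w0 sigma0 sw fM e0.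
  exists (Num.min d 1); first by rewrite lt_min d0 ltr01.
  move=> b b' b0; rewrite lt_min => /andP[bd b1] b0'; rewrite lt_min => /andP[bd' b1'].
  by apply: dP => //; exact: angle_cos_of_sin.
move=> g [gN gP]; exists g; split => // e e0; have [d d0 dP] := gP e e0.
exists d => // a b ab bd; rewrite (cos_of_sin_angle ab); apply: dP => //; by case: ab.
Qed.

Lemma convol_le_sqr (A : R) K u (M c e t : R) : 0 <= c -> 0 <= e -> exp_decay w A K ->
  wL2_le sigma u ((e * c) ^+ 2 * M) ->
  `|convol K u t| <= e * (A * expR (w * `|t|) * (c * Num.sqrt (M / (w - sigma)))).
Proof.
move=> c0 e0 dK uM; apply: le_trans (convol_le w0 sw t dK uM) _.
rewrite -(mulrA _ M) sqrtrM ?sqr_ge0// sqrtr_sqr (ger0_norm (mulr_ge0 e0 c0)).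
by move: (expR _) (Num.sqrt _) => X Y; rewrite le_eqVlt; apply/orP; left; apply/eqP; ring.
Qed.

(** The squares of the errors are scaled as (e c)^2 M so that the pointwise errors
    become linear in e. *)
Lemma small_angle f g M b e : wL2_le sigma f M -> Strans f g -> 0 < b -> 0 < e ->
  exists a' b', [/\ angle a' b', b' <= e, b' <= b / 4,
    wL2_le sigma (fun t => convol (SK w a' b') f t - g t) ((e * 1) ^+ 2 * 1) &
    wL2_le sigma (fun t => convol (PK w a') f t - convol (PK w 1) f t)
      ((e * (4 * decay_const w 1 * (2 / (w - sigma)))) ^+ 2 * M)].
Proof.
move=> fM [_ gP] b0 e0.
have [d d0 dP] := gP (e ^+ 2) (exprn_gt0 2 e0).
have [b' [b0' bd' bb' be' b1']] : exists b' : R, [/\ 0 < b', b' < d, b' <= b / 4, b' <= e & b' <= 2^-1].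
  exists (Num.min (d / 2) (Num.min (b / 4) (Num.min e 2^-1))).
  rewrite !lt_min !gt_min !ge_min !divr_gt0 ?invr_gt0 ?e0 ?lexx//= ?orbT.
  by rewrite ltr_pdivrMr// ltr_pMr// ltr1n.
have b1_ : b' < 1 by apply: le_lt_trans b1' _; rewrite invf_lt1 ?ltr1n.
have ab' := angle_cos_of_sin b0' b1_; set a' := cos_of_sin b' in ab'.
exists a', b'; have [a1' _] := angle_le1 ab'; have [a0' _ _] := ab'.
have q1 : 1 - a' <= b'.
  by apply: le_trans (angle_sub1 ab') _; rewrite expr2 ler_piMl// ltW.
have dP1 : exp_decay w (e * (4 * decay_const w 1)) (fun s => PK w a' s - PK w 1 s).
  apply: exp_decay_le; last exact: exp_decay_PK_sub1.
  apply: ler_pM; rewrite ?decay_const_ge0 ?subr_ge0//; first exact: le_trans be'.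
  by apply: decay_const_half => //; rewrite div1r; lra.
have d1 := exp_decay_PK_const w0 ltr01 (lexx 1); have da' := exp_decay_PK_angle w0 ab'.
split => //; first by rewrite !mulr1; exact: dP.
rewrite mulrA; apply: eq_wL2_le (convol_wL2 sigma0 sw dP1 fM) => s.
exact: (convolBl w0 sw s da' d1 fM).
Qed.

Lemma sub3_le (x y z e A B C : R) : `|x| <= e * A -> `|y| <= e * B -> `|z| <= e * C ->
  `|x - y - z| <= e * (A + B + C).
Proof.
move=> hx hy hz; rewrite !mulrDr.
by apply: le_trans (ler_normB _ _) (lerD (le_trans (ler_normB _ _) (lerD hx hy)) hz).
Qed.

Lemma perturb_const_ge0 : 0 <= 4 * decay_const w 1 * (2 / (w - sigma)).
Proof.
apply: mulr_ge0; first by apply: mulr_ge0 => //; exact: decay_const_ge0.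
by rewrite divr_ge0// subr_ge0 ltW.
Qed.

Lemma perturb_le (b y B e z : R) : 0 < b -> B <= e -> `|z| <= 2 * B ->
  `|b ^+ 2 - y ^+ 2| <= 4 * B -> b / 2 <= y ->
  (`|z| + `|b ^+ 2 - y ^+ 2| / b ^+ 2) * decay_const w y <= e * ((2 + 4 / b ^+ 2) * (4 * decay_const w b)).
Proof.
move=> b0 Be hz h2 h3; rewrite [leRHS](mulrA e); apply: ler_pM.
- by rewrite addr_ge0// divr_ge0// sqr_ge0.
- exact: decay_const_ge0.
- rewrite mulrDr; apply: lerD.
    by apply: le_trans hz _; rewrite mulrC ler_pM2r.
  rewrite mulrA ler_pM2r ?invr_gt0 ?exprn_gt0//.
  by apply: le_trans h2 _; rewrite mulrC ler_pM2r.
- exact: decay_const_half.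
Qed.

(** The limit th' -> 0 in [convol_PS]. It holds at every t, since each term depends on
    the functions through the pointwise bound of convolutions. *)
Lemma convol_SK_limit f g M a b t : wL2_le sigma f M -> Strans f g -> angle a b ->
  convol (SK w a b) f t = convol (PK w b) g t - convol (SK w b a) (convol (PK w 1) f) t.
Proof.
move=> fM fg ab; have [[N gN] _] := fg; have ba := angle_sym ab.
have [a1 b1] := angle_le1 ab; have [a0 b0 _] := ab.
apply/esym/eq_by_eps => e e0.
have [a' [b' [ab' be bb qS qP]]] := small_angle fM fg b0 e0.
have [p1 _ p2 p3] := angle_perturb ab ab' bb.
have [s0 s1] := sin_add_bounds ab ab'.
have na : `|a| <= 1 by rewrite gtr0_norm.
have dS := exp_decay_le (perturb_le b0 be p1 p2 p3) (exp_decay_SK_sub w0 _ na b0 s0 s1).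
have d1 := exp_decay_PK_const w0 ltr01 (lexx 1); have da' := exp_decay_PK_angle w0 ab'.
have c1 : `|a * a' - b * b'| <= 1.
  have [a1' b1'] := angle_le1 ab'; have [a0' b0' _] := ab'.
  by apply: norm_sub_le1; rewrite ?mulr_ge0 ?mulr_ile1 ?(ltW a0) ?(ltW a0') ?(ltW b0) ?(ltW b0').
have e3 := convolBl w0 sw t (exp_decay_SK w0 c1 s0 s1) (exp_decay_SK_angle w0 ab) fM.
rewrite -(convol_PS w0 sigma0 sw t ab ab' fM) in e3.
have h1 := convol_le_sqr t ler01 (ltW e0) (exp_decay_PK_angle w0 ba) qS.
rewrite (convolB w0 sw t (exp_decay_PK_angle w0 ba) (convol_SK_bounded w0 sigma0 sw ab' fM) gN) in h1.
have h2 := convol_le_sqr t perturb_const_ge0 (ltW e0) (exp_decay_SK_angle w0 ba) qP.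
rewrite (convolB w0 sw t (exp_decay_SK_angle w0 ba) (convol_wL2 sigma0 sw da' fM) (convol_wL2 sigma0 sw d1 fM)) distrC in h2.
have h3 := convol_le w0 sw t dS fM; rewrite e3 -!(mulrA e) in h3.
move: (sub3_le h3 h1 h2).
move: (convol (PK w b) (convol _ _) t) (convol (SK w b a) (convol (PK w a') f) t) => x y.
move: (convol (PK w b) g t) (convol (SK w b a) (convol _ _) t) (convol (SK w a b) f t) => u v z.
rewrite [leLHS](_ : _ = `|u - v - z|); last by congr (`|_|); ring.
exact.
Qed.

(** The limit th' -> 0 in [convol_SS]. *)
Lemma convol_SS_limit f g M a b t : wL2_le sigma f M -> Strans f g -> angle a b ->
  convol (SK w a b) g t = convol (PK w a) (convol (PK w 1) f) t - convol (PK w b) f t.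
Proof.
move=> fM fg ab; have [[N gN] _] := fg.
have [a1 b1] := angle_le1 ab; have [a0 b0 _] := ab.
apply/esym/eq_by_eps => e e0.
have [a' [b' [ab' be bb qS qP]]] := small_angle fM fg b0 e0.
have [_ p1 p2 p3] := angle_perturb ab ab' bb.
have [s0 s1] := sin_add_bounds ab ab'.
have dS := exp_decay_le (perturb_le b0 be p1 p2 p3) (exp_decay_PK_sub w0 b0 b1 s0 s1).
have d1 := exp_decay_PK_const w0 ltr01 (lexx 1); have da' := exp_decay_PK_angle w0 ab'.
have e3 := convolBl w0 sw t (exp_decay_PK_const w0 s0 s1) (exp_decay_PK_const w0 b0 b1) fM.
have e4 := convol_SS w0 sigma0 sw t ab ab' fM.
have h1 := convol_le_sqr t ler01 (ltW e0) (exp_decay_SK_angle w0 ab) qS.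
rewrite (convolB w0 sw t (exp_decay_SK_angle w0 ab) (convol_SK_bounded w0 sigma0 sw ab' fM) gN) in h1.
have h2 := convol_le_sqr t perturb_const_ge0 (ltW e0) (exp_decay_PK_angle w0 ab) qP.
rewrite (convolB w0 sw t (exp_decay_PK_angle w0 ab) (convol_wL2 sigma0 sw da' fM) (convol_wL2 sigma0 sw d1 fM)) in h2.
have h3 := convol_le w0 sw t dS fM; rewrite e3 distrC -!(mulrA e) in h3.
move: (sub3_le h1 h2 h3) e4.
move: (convol (SK w a b) (convol _ _) t) (convol (PK w a) (convol (PK w a') f) t) => x y.
move: (convol (PK w a) (convol _ _) t) (convol (SK w a b) g t) (convol (PK w b) f t) => u v z.
move: (convol _ f t) => r.
rewrite [leLHS](_ : _ = `|(u - z - v) + ((x - y) + r)|); last by congr (`|_|); ring.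
move=> h e4; move: h; rewrite e4 addNr addr0; exact.
Qed.

End LimitIdentity.

(** * Principal values *)

Section Truncation.
Context {R : realType}.
Local Notation mu := (@lebesgue_measure R).
Implicit Types (f g h K L : R -> R).
Variables (w sigma : R).
Hypotheses (w0 : 0 < w) (sigma0 : 0 <= sigma) (sw : sigma < w).

(** By [convol_SK_limit], SK_th f t is a Poisson integral of g at t, up to a term whose
    kernel is O (b). *)
Lemma convol_SK_cvg f g M t : wL2_le sigma f M -> Strans w sigma f g -> poisson_pt w g t ->
  forall e, 0 < e -> exists2 d, 0 < d &
    forall a b, angle a b -> b < d -> `|convol (SK w a b) f t - g t| <= e.
Proof.
move=> fM fg pt e e0; have [[N gN] _] := fg.
have e2 : 0 < e / 2 by rewrite divr_gt0.
have [d d0 dP] := convol_PK_cvg w0 sw gN pt e2.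
have d1 := exp_decay_PK_const w0 ltr01 (lexx 1); have qC := convol_wL2 sigma0 sw d1 fM.
set M' := _ ^+ 2 * M in qC.
pose D := 4 * decay_const w 1 * expR (w * `|t|) * Num.sqrt (M' / (w - sigma)).
have D0 : 0 <= D.
  by apply: mulr_ge0 (sqrtr_ge0 _); apply: mulr_ge0 (expR_ge0 _); apply: mulr_ge0 => //; exact: decay_const_ge0.
exists (Num.min (Num.min d 2^-1) (e / 2 / (D + 1))).
  by rewrite !lt_min d0 invr_gt0 ltr0n/= divr_gt0// ltr_wpDl.
move=> a b ab; rewrite !lt_min => /andP[/andP[bd bh] be].
have [a1 b1] := angle_le1 ab; have ah := angle_sub1 ab; have ba := angle_sym ab.
have [a0 b0 _] := ab.
rewrite (convol_SK_limit w0 sigma0 sw t fM fg ab) addrAC.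
apply: le_trans (ler_normB _ _) _; rewrite (splitr e); apply: lerD.
  exact: dP.
have dS : exp_decay w (b * (4 * decay_const w 1)) (SK w b a).
  apply: exp_decay_le (exp_decay_SK_small w0 ab); rewrite ler_pM2l//; apply: decay_const_half => //.
  rewrite div1r; have : b ^+ 2 <= b by rewrite expr2 ler_piMl// ltW.
  by lra.
apply: le_trans (convol_le w0 sw t dS qC) _.
rewrite [leLHS](_ : _ = b * D); last by rewrite /D; ring.
apply: (@le_trans _ _ (b * (D + 1))); first by rewrite ler_pM2l// lerDl.
by rewrite -ler_pdivlMr ?ltW// ltr_wpDl.
Qed.

Definition trunc (e s : R) := if `|s| < e then 0 else S_kernel w s.

(** Written as sinh times a real power of sinh^2, because the inverse itself is
    discontinuous at 0. *)
Lemma measurable_S_kernel : measurable_fun [set: R] (S_kernel w).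
Proof.
have -> : S_kernel w = fun s : R => w / pi * (sinh (w * s) * (sinh (w * s) ^+ 2) `^ (- 1)).
  apply/funext => s; rewrite /S_kernel; congr (_ * _); move: (sinh _) => X.
  rewrite powR_inv1 ?sqr_ge0// expr2 invfM mulrA.
  by have [->|X0] := eqVneq X 0; [rewrite invr0 !mulr0|rewrite divff// mul1r].
have ms : measurable_fun [set: R] (fun s : R => sinh (w * s)).
  by apply: continuous_measurable_fun; apply: continuous_wM; exact: continuous_sinh.
apply: measurable_funM => //; apply: measurable_funM => //.
apply: (measurableT_comp (measurable_powR _)); exact: measurable_funX.
Qed.

Lemma S_kernelN s : S_kernel w (- s) = - S_kernel w s.
Proof. by rewrite /S_kernel mulrN sinhN invrN mulrN. Qed.

Lemma truncN e s : trunc e (- s) = - trunc e s.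
Proof. by rewrite /trunc normrN S_kernelN; case: ifP; rewrite ?oppr0. Qed.

Lemma measurable_trunc e : measurable_fun [set: R] (trunc e).
Proof.
apply: measurable_fun_ifT => //; last exact: measurable_S_kernel.
by apply: measurable_fun_ltr => //; exact: measurable_normr.
Qed.

Lemma exp_decay_trunc e : 0 < e -> exists A, exp_decay w A (trunc e).
Proof.
move=> e0; have we : 0 < w * e by rewrite mulr_gt0.
have s0 : 0 < sinh (w * e) by apply: lt_le_trans (sinh_ge (ltW we)).
pose c := sinh (w * e) / cosh (w * e).
have c0 : 0 < c by rewrite divr_gt0// cosh_gt0.
exists (w / pi * (2 / c)); split; first exact: measurable_trunc.
move=> s; rewrite /trunc; case: ltP => se.
  by rewrite normr0 mulr_ge0 ?expR_ge0// mulr_ge0 ?(ltW (wpi_gt0 w0))// divr_ge0// ltW.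
have h : w * e <= `|w * s| by rewrite normrM (gtr0_norm w0) ler_pM2l.
have h1 := sinh_ge_tanh (ltW we) h; have h2 := invcosh_le (w * s).
rewrite /S_kernel normrM (gtr0_norm (wpi_gt0 w0)) -mulrA ler_pM2l ?wpi_gt0//.
have ch := cosh_gt0 (w * s).
have cc : 0 < c * cosh (w * s) by rewrite mulr_gt0.
rewrite normfV; apply: (@le_trans _ _ (c * cosh (w * s))^-1).
  by rewrite lef_pV2 ?posrE// (lt_le_trans cc).
rewrite invfM mulrC mulrAC ler_pM2r ?invr_gt0//.
by rewrite normrM (gtr0_norm w0) in h2.
Qed.

(** For |s| < e the kernel SK alone remains, and |sinh (w s)| <= 2 b. For |s| >= e the
    difference is at most ((1 - a) sinh^2 + b^2) / (|sinh| (sinh^2 + b^2)), where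
    b <= |sinh| and 1 - a <= b^2. *)
Lemma trunc_sub_SK a e s : angle a (w * e) -> w * e <= 2^-1 -> 0 < e ->
  `|trunc e s - SK w a (w * e) s| <= 2 * PK w (w * e) s.
Proof.
move=> ab b2 e0; have [a1 b1] := angle_le1 ab; have ah := angle_sub1 ab.
case: ab => a0 b0 _.
have Y1 := cosh_ge1 (w * s); have XY := norm_sinh_le_cosh (w * s).
have Xs : `|s| < e -> `|sinh (w * s)| <= 2 * (w * e).
  move=> se; apply: (@le_trans _ _ (sinh (w * e))); last exact: sinh_le2 (ltW b0) b2.
  by rewrite sinh_abs sinh_le// normrM (gtr0_norm w0) ler_pM2l// ltW.
have Xb : e <= `|s| -> w * e <= `|sinh (w * s)|.
  move=> se; apply: le_trans (norm_sinh_ge _).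
  by rewrite normrM (gtr0_norm w0) ler_pM2l.
rewrite /trunc /SK /sn /PK /pn /S_kernel.
move: (w * e) a1 b1 ah b0 b2 Xs Xb => b a1 b1 ah b0 b2 Xs Xb.
move: (sinh _) (cosh _) XY Y1 Xs Xb => X Y XY Y1 Xs Xb.
have D0 : 0 < X ^+ 2 + b ^+ 2 by rewrite ltr_wpDl ?sqr_ge0// exprn_gt0.
have Y0 : 0 <= Y by apply: le_trans Y1.
have aX : 0 <= `|X| by [].
rewrite (mulrCA 2); case: ltP => [/Xs {}Xs|/Xb {}Xb].
  rewrite sub0r normrN normrM (gtr0_norm (wpi_gt0 w0)) ler_pM2l ?wpi_gt0//.
  rewrite normrM normfV (gtr0_norm D0) [leRHS]mulrA ler_pM2r ?invr_gt0//.
  rewrite normrM (gtr0_norm a0); apply: (@le_trans _ _ (1 * `|X|)).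
    by rewrite ler_wpM2r.
  rewrite mul1r; apply: le_trans Xs _; rewrite ler_pM2l//.
  by rewrite ler_peMr// ltW.
have X0 : X != 0 by rewrite -normr_gt0 (lt_le_trans b0).
rewrite -mulrBr normrM (gtr0_norm (wpi_gt0 w0)) ler_pM2l ?wpi_gt0//.
have -> : X^-1 - a * X / (X ^+ 2 + b ^+ 2) =
    ((1 - a) * X ^+ 2 + b ^+ 2) / X / (X ^+ 2 + b ^+ 2).
  by field; rewrite X0 gt_eqF.
rewrite normrM normfV (gtr0_norm D0) [leRHS]mulrA ler_pM2r ?invr_gt0//.
rewrite normrM normfV ler_pdivrMr ?normr_gt0//.
rewrite ger0_norm; last by rewrite addr_ge0 ?sqr_ge0// mulr_ge0 ?sqr_ge0// subr_ge0.
rewrite -(real_normK (num_real X)).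
move: (`|X|) aX XY Xb => Z Z0 ZY bZ.
have h1 : b ^+ 2 <= b * Y * Z.
  rewrite expr2 -mulrA ler_pM2l//; apply: le_trans bZ _; by rewrite ler_peMl.
have h2 : (1 - a) * Z ^+ 2 <= b * Y * Z.
  rewrite expr2 mulrA ler_wpM2r//; apply: ler_pM => //; first by rewrite subr_ge0.
  by apply: le_trans ah _; rewrite expr2 ler_piMl// ltW.
by rewrite -!mulrA mulr_natl mulr2n mulrA addrC lerD.
Qed.

(** The difference of the two kernels is odd, hence of integral 0, and dominated by
    Poisson kernels, so it contributes nothing at a Lebesgue point of f. *)
Lemma trunc_cvg f g M : wL2_le sigma f M -> Strans w sigma f g ->
  {ae mu, forall t, forall e, 0 < e -> exists2 d, 0 < d &
    forall r, 0 < r -> r < d -> `|convol (trunc r) f t - g t| <= e}.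
Proof.
move=> fM fg; have [[N gN] _] := fg.
apply: ae_imp (ae_and (ae_poisson_pt w0 sw fM) (ae_poisson_pt w0 sw gN)) _.
move=> t [ptf ptg] e e0.
have e2 : 0 < e / 2 by rewrite divr_gt0.
have [d1 d10 dP1] := convol_SK_cvg fM fg ptg e2.
have e4 : 0 < e / 4 by rewrite divr_gt0.
have [d2 d20 dP2] := ptf _ e4.
exists (Num.min (Num.min d1 d2) 2^-1 / w).
  by apply: divr_gt0 => //; rewrite !lt_min d10 d20 invr_gt0 ltr0n.
move=> r r0; rewrite ltr_pdivlMr// mulrC !lt_min => /andP[/andP[rd1 rd2] rh].
have b0 : 0 < w * r by rewrite mulr_gt0.
have b1 : w * r < 1 by apply: lt_trans rh _; rewrite invf_lt1 ?ltr1n.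
have ab := angle_cos_of_sin b0 b1; set a := cos_of_sin _ in ab.
have [A dT] := exp_decay_trunc r0; have dS := exp_decay_SK_angle w0 ab.
have dD := exp_decayB dT dS.
have h := convol_poisson_le w0 sw fM b0 (ler0n _ 2) dD
  (fun s => trunc_sub_SK s ab (ltW rh) r0) (dP2 _ b0 rd2).
have R0 : Rint (fun s => trunc r s - SK w a (w * r) s) = 0.
  apply: Rint_odd; [by have [] := dD| |exact: (intbl_exp_decay w0 dD)].
  by move=> s; rewrite truncN SKN opprD.
rewrite R0 mul0r subr0 (convolBl w0 sw t dT dS fM) in h.
have h2 := dP1 _ _ ab rd1.
rewrite -(subrKA (convol (SK w a (w * r)) f t)).
apply: le_trans (ler_normD _ _) _; apply: le_trans (lerD h h2) _.
by rewrite le_eqVlt; apply/orP; left; apply/eqP; field.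
Qed.

End Truncation.

(** * The relations between C and S *)

Section TransformAlgebra.
Context {R : realType}.
Local Notation mu := (@lebesgue_measure R).
Implicit Types (f g h K L : R -> R).
Variables (w sigma : R).
Hypotheses (w0 : 0 < w) (sigma0 : 0 <= sigma) (sw : sigma < w).
Local Notation C := (convol (PK w 1)).
Local Notation Str := (Strans w sigma).
Let d1 : exp_decay w (decay_const w 1) (PK w 1) := exp_decay_PK_const w0 ltr01 (lexx 1).

(** Convolution with PK 1 commutes with each SK and is bounded. *)
Lemma Strans_convol f g M : wL2_le sigma f M -> Str f g -> Str (C f) (C g).
Proof.
move=> fM [[N gN] gP]; split; first by eexists; exact: (convol_wL2 sigma0 sw d1 gN).
pose c : R := (decay_const w 1 * (2 / (w - sigma))) ^+ 2.
have c0 : 0 < c + 1 by rewrite ltr_wpDl// sqr_ge0.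
move=> e e0; have [d d0 dP] := gP (e / (c + 1)) (divr_gt0 e0 c0).
exists d => // a b ab bd; have dS := exp_decay_SK_angle w0 ab.
have q := convol_wL2 sigma0 sw d1 (dP a b ab bd).
apply: (@eq_wL2_le _ _ (C (fun t => convol (SK w a b) f t - g t))).
  move=> t; rewrite (convolB w0 sw t d1 (convol_SK_bounded w0 sigma0 sw ab fM) gN).
  by rewrite (convol_comm w0 sigma0 sw t d1 dS fM).
apply: wL2_le_trans q; rewrite mulrA ler_pdivrMr// mulrC ler_pM2l// -/c.
by rewrite lerDl.
Qed.

Lemma Strans_lin (k : R) f g f' g' M M' : wL2_le sigma f M -> wL2_le sigma f' M' ->
  Str f g -> Str f' g' -> Str (fun t => f t + k * f' t) (fun t => g t + k * g' t).
Proof.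
move=> fM fM' [[N gN] gP] [[N' gN'] gP'].
split; first by eexists; exact: (wL2_leD gN (wL2_leZ k gN')).
move=> e e0; have k0 : 0 < k ^+ 2 + 1 by rewrite ltr_wpDl// sqr_ge0.
have e1 : 0 < e / 4 by rewrite divr_gt0.
have [d d0 dP] := gP _ e1.
have [d' d0' dP'] := gP' (e / 4 / (k ^+ 2 + 1)) (divr_gt0 e1 k0).
exists (Num.min d d'); first by rewrite lt_min d0.
move=> a b ab; rewrite lt_min => /andP[bd bd']; have dS := exp_decay_SK_angle w0 ab.
apply: (@eq_wL2_le _ _ (fun t => (convol (SK w a b) f t - g t) + k * (convol (SK w a b) f' t - g' t))).
  move=> t; rewrite (convolD w0 sw t dS fM (wL2_leZ k fM')).
  have -> : convol (SK w a b) (fun s => k * f' s) t = k * convol (SK w a b) f' t.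
    rewrite /convol -RintZ; first by congr Rint; apply/funext => s; rewrite mulrCA.
    exact: (convol_intbl w0 sw t dS fM').
  by ring.
apply: wL2_le_trans (wL2_leD (dP a b ab bd) (wL2_leZ k (dP' a b ab bd'))).
have h : k ^+ 2 * (e / 4 / (k ^+ 2 + 1)) <= e / 4.
  by rewrite mulrA ler_pdivrMr// mulrC ler_pM2l// lerDl.
by lra.
Qed.

(** [convol_SS_limit] expresses SK_th g by Poisson integrals of C f and f. Let th tend to 0
    at a point where those of f and of h converge. *)
Lemma Strans_Strans f g h M : wL2_le sigma f M -> Str f g -> Str g h ->
  {ae mu, forall t, h t = C (C f) t - f t}.
Proof.
move=> fM fg gh; have [[N gN] _] := fg; have [[N' hN] _] := gh.
apply: ae_imp (ae_and (ae_poisson_pt w0 sw fM) (ae_poisson_pt w0 sw hN)) _.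
move=> t [ptf pth].
have qC := convol_wL2 sigma0 sw d1 fM; set M' := _ ^+ 2 * M in qC.
pose D := 4 * decay_const w 1 * expR (w * `|t|) * Num.sqrt (M' / (w - sigma)).
apply: (@eq_by_eps _ _ _ (1 + 1 + D)) => e e0.
have [d d0 dP] := convol_SK_cvg w0 sigma0 sw gN gh pth e0.
have [d' d0' dP'] := convol_PK_cvg w0 sw fM ptf e0.
pose m := Num.min (Num.min d d') (Num.min e 2^-1).
have m0 : 0 < m by rewrite !lt_min d0 d0' e0 invr_gt0 ltr0n.
have [b [b0 bd bd' be bh]] : exists b, [/\ 0 < b, b < d, b < d', b <= e & b <= 2^-1].
  exists (m / 2); rewrite divr_gt0//.
  have : m / 2 < m by rewrite ltr_pdivrMr// ltr_pMr// ltr1n.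
  by rewrite {2 3 4 5 6}/m !lt_min => /andP[/andP[-> ->] /andP[/ltW -> /ltW ->]].
have b1 : b < 1 by apply: le_lt_trans bh _; rewrite invf_lt1 ?ltr1n.
have ab := angle_cos_of_sin b0 b1; set a := cos_of_sin b in ab.
have [a1 _] := angle_le1 ab; have ah := angle_sub1 ab; have [a0 _ _] := ab.
have bb : b ^+ 2 <= b by rewrite expr2 ler_piMl// ltW.
have h1 : `|convol (SK w a b) g t - h t| <= e * 1 by rewrite mulr1; exact: dP.
have h2 : `|convol (PK w b) f t - f t| <= e * 1 by rewrite mulr1; exact: dP' (ltW b1).
have dD : exp_decay w (e * (4 * decay_const w 1)) (fun s => PK w a s - PK w 1 s).
  apply: exp_decay_le (exp_decay_PK_sub1 w0 a0 a1); apply: ler_pM; rewrite ?decay_const_ge0 ?subr_ge0//.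
    exact: le_trans ah (le_trans bb be).
  by apply: decay_const_half => //; rewrite div1r; lra.
have h3 := convol_le w0 sw t dD qC.
rewrite (convolBl w0 sw t (exp_decay_PK_angle w0 ab) d1 qC) distrC -!(mulrA e) -/D in h3.
rewrite (convol_SS_limit w0 sigma0 sw t fM fg ab) distrC in h1.
move: (sub3_le h1 h2 h3).
rewrite [X in `|X| <= _ -> _](_ : _ = h t - (C (C f) t - f t)) //.
by move: (convol _ _ t) (convol _ _ t) (convol _ _ t) => x y z; ring.
Qed.

End TransformAlgebra.

(** * Integrals of functions that agree almost everywhere *)

Section AeIntegral.
Context d (T : measurableType d) {R : realType} (m : {measure set T -> \bar R}).
Local Open Scope ereal_scope.
Import HBNNSimple HBSimple.

(** The integral of a nonnegative function, Borel or not, is a supremum over the simple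
    functions below it, and a simple function can be set to 0 on a null set without
    changing its integral. *)
Lemma ge0_integral_le_ae (f g : T -> \bar R) : (forall x, 0 <= f x) -> (forall x, 0 <= g x) ->
  {ae m, forall x, f x = g x} -> \int[m]_x f x <= \int[m]_x g x.
Proof.
move=> f0 g0 [N [mN N0 fgN]]; rewrite !ge0_integralTE//.
apply: ge_ereal_sup => _ [h hf <-].
(* h, set to 0 on the null set N *)
pose h' := proj_nnsfun h (measurableC mN).
have -> : sintegral m h = sintegral m h'.
  rewrite -!integralT_nnsfun; apply: ge0_ae_eq_integral => //.
  - by apply/measurable_EFinP.
  - by apply/measurable_EFinP.
  - by move=> x _; rewrite lee_fin.
  - by move=> x _; rewrite lee_fin.
  exists N; split => // x /= /not_implyP[_ H]; apply: contrapT => Nx; apply: H.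
  by rewrite /h' /proj_nnsfun/= mindicE mem_set ?mulr1.
apply: ereal_sup_ubound; exists h' => // x.
rewrite /h' /proj_nnsfun/= mindicE; have [xN|xN] := boolP (x \in ~` N).
  rewrite mulr1; rewrite -[g x](_ : f x = g x)//.
  by apply: contrapT => H; move/set_mem : xN; apply; exact: fgN.
by rewrite mulr0.
Qed.

Lemma integral_ae (f g : T -> \bar R) :
  {ae m, forall x, f x = g x} -> \int[m]_x f x = \int[m]_x g x.
Proof.
move=> fg; have gf : {ae m, forall x, g x = f x} by apply: filterS fg => x ->.
by rewrite integralE [in RHS]integralE; congr (_ - _); apply/eqP; rewrite eq_le;
  apply/andP; split; apply: ge0_integral_le_ae => //;
  (apply: filterS fg || apply: filterS gf) => x e; rewrite !(funeposE, funenegE) e.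
Qed.

End AeIntegral.

(** * Complex valued functions *)

Section Complexification.
Context {R : realType}.
Local Open Scope complex_scope.
Local Notation mu := (@lebesgue_measure R).
Implicit Types (f g h : R -> R) (x y : R -> R[i]).
Variables (w sigma : R).
Hypotheses (w0 : 0 < w) (sigma0 : 0 <= sigma) (sw : sigma < w).

Definition re_im_ae x f f' := {ae mu, forall t, x t = f t +i* f' t}.

Lemma Rintegral_ae D f g : {ae mu, forall t, f t = g t} ->
  Rintegral mu D f = Rintegral mu D g.
Proof.
move=> fg; rewrite /Rintegral !(integral_mkcond D); congr fine; apply: integral_ae.
by apply: ae_imp fg _ => t e; rewrite /patch e.
Qed.

Lemma CintegralR_kernel D K x f f' : re_im_ae x f f' ->
  CintegralR D (fun s => (K s)%:C * x s) =
  Rintegral mu D (fun s => K s * f s) +i* Rintegral mu D (fun s => K s * f' s).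
Proof.
move=> xf; rewrite /CintegralR; congr (_ +i* _); apply: Rintegral_ae;
  apply: ae_imp xf _ => s -> /=; by rewrite ?mul0r ?subr0 ?addr0.
Qed.

Lemma PK_C_kernel s : PK w 1 s = C_kernel w s.
Proof.
rewrite /PK /pn /C_kernel expr1n addrC -cosh2 mul1r; congr (_ * _).
rewrite expr2 invfM mulrA.
by rewrite divff ?mul1r// gt_eqF// cosh_gt0.
Qed.

Lemma C_transformE x f f' t : re_im_ae x f f' ->
  C_transform w x t = convol (PK w 1) f t +i* convol (PK w 1) f' t.
Proof.
move=> xf; rewrite /C_transform (CintegralR_kernel _ _ xf).
by congr (_ +i* _); apply: eq_Rintegral => s _; rewrite PK_C_kernel.
Qed.

Lemma Rintegral_trunc f t e :
  Rintegral mu (~` `]t - e, t + e[) (fun s => S_kernel w (t - s) * f s) = convol (trunc w e) f t.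
Proof.
rewrite Rintegral_mkcond; apply: eq_Rintegral => s _; rewrite /patch /trunc.
have -> : (s \in ~` `]t - e, t + e[%classic) = ~~ (`|t - s| < e).
  apply/idP/idP => [/set_mem /= H|H].
    apply/negP => h; apply: H; rewrite in_itv /=; move: h.
    by rewrite ltr_norml => /andP[h1 h2]; apply/andP; split; lra.
  apply/mem_set => /=; rewrite in_itv /= => /andP[h1 h2]; move/negP : H; apply.
  by rewrite ltr_norml; apply/andP; split; lra.
by case: (_ < e); rewrite ?mul0r.
Qed.

Lemma S_truncatedE x f f' t e : re_im_ae x f f' ->
  S_truncated w x t e = convol (trunc w e) f t +i* convol (trunc w e) f' t.
Proof. by move=> xf; rewrite /S_truncated (CintegralR_kernel _ _ xf) !Rintegral_trunc. Qed.

Lemma lim_complex (u v : R -> R) (a b : R) :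
  (forall e, 0 < e -> exists2 d, 0 < d & forall r, 0 < r -> r < d -> `|u r - a| <= e) ->
  (forall e, 0 < e -> exists2 d, 0 < d & forall r, 0 < r -> r < d -> `|v r - b| <= e) ->
  lim ((u r +i* v r : R[i]^o) @[r --> 0^'+]) = a +i* b.
Proof.
move=> ua vb; apply/cvg_lim; first exact: norm_hausdorff.
apply/cvgrPdist_le => -[e e'] /=; rewrite ltcE/= => /andP[/eqP -> e0].
have e2 : 0 < e / 2 by rewrite divr_gt0.
have [d d0 dP] := ua _ e2; have [d' d0' dP'] := vb _ e2.
near=> r.
have r0 : 0 < r by near: r; exact: nbhs_right_gt.
have rd : r < d by near: r; exact: nbhs_right_lt.
have rd' : r < d' by near: r; exact: nbhs_right_lt.
rewrite distrC; have -> : (u r +i* v r : R[i]) - (a +i* b) = (u r - a) +i* (v r - b) by [].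
rewrite normc_def /= lecE/= eqxx/=.
apply: le_trans (_ : `|u r - a| + `|v r - b| <= _); last first.
  by rewrite (splitr e); apply: lerD; [exact: dP|exact: dP'].
rewrite -[leRHS]ger0_norm ?addr_ge0// -sqrtr_sqr ler_wsqrtr//.
rewrite -(real_normK (num_real (u r - a))) -(real_normK (num_real (v r - b))).
by rewrite sqrrD -addrA lerD2l lerDr// mulrn_wge0// mulr_ge0.
Unshelve. all: by end_near. Qed.

Lemma C_transform_re_im x f f' : re_im_ae x f f' ->
  re_im_ae (C_transform w x) (convol (PK w 1) f) (convol (PK w 1) f').
Proof. by move=> xf; apply: aeW => t; exact: C_transformE. Qed.

Lemma S_transform_re_im x f f' g g' M M' : wL2_le sigma f M -> wL2_le sigma f' M' ->
  Strans w sigma f g -> Strans w sigma f' g' -> re_im_ae x f f' -> re_im_ae (S_transform w x) g g'.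
Proof.
move=> fM fM' fg fg' xf.
apply: ae_imp (ae_and (trunc_cvg w0 sigma0 sw fM fg) (trunc_cvg w0 sigma0 sw fM' fg')) _.
move=> t [h h']; rewrite /S_transform -(lim_complex h h').
have -> // : (fun e => S_truncated w x t e) =
    fun e => convol (trunc w e) f t +i* convol (trunc w e) f' t.
by apply/funext => e; exact: S_truncatedE.
Qed.

Lemma re_im_ae_lin (k : R) x y f f' g g' : re_im_ae x f f' -> re_im_ae y g g' ->
  re_im_ae (fun t => x t + k%:C * y t) (fun t => f t + k * g t) (fun t => f' t + k * g' t).
Proof.
move=> xf yg; apply: ae_imp (ae_and xf yg) _ => t [-> ->].
by apply/eqP; rewrite eq_complex/= mul0r subr0 mul0r addr0 !eqxx.
Qed.

Lemma L2_re_im x : L2 sigma x ->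
  exists f f' M, [/\ wL2_le sigma f M, wL2_le sigma f' M & re_im_ae x f f'].
Proof.
move=> [[y [mf mf'] xy] xI].
pose f t := complex.Re (y t); pose f' t := complex.Im (y t).
have wtE t : expR (- (2 * sigma * `|t|)) = wt sigma t ^+ 2.
  by rewrite /wt -expRM_natl; congr expR; ring.
have I : (\int[mu]_t (((f t * wt sigma t) ^+ 2) + (f' t * wt sigma t) ^+ 2)%:E < +oo)%E.
  rewrite [ltLHS](_ : _ = (\int[mu]_tau
       (Normc.normc (x tau) ^+ 2 * expR (- (2 * sigma * `|tau|)))%:E)%E)//.
  apply: integral_ae; apply: ae_imp xy _ => t ->//.
  congr (_%:E); rewrite wtE /f /f'; case: (y t) => a b /=.
  by rewrite sqr_sqrtr ?addr_ge0 ?sqr_ge0//; ring.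
have mw := measurable_wt sigma.
pose M := fine (\int[mu]_t (((f t * wt sigma t) ^+ 2) + (f' t * wt sigma t) ^+ 2)%:E)%E.
have ME : (\int[mu]_t (((f t * wt sigma t) ^+ 2) + (f' t * wt sigma t) ^+ 2)%:E)%E = M%:E.
  rewrite fineK// ge0_fin_numE//; apply: integral_ge0 => t _.
  by rewrite lee_fin addr_ge0// sqr_ge0.
have m1 := measurable_weighted_sqr sigma mf; have m2 := measurable_weighted_sqr sigma mf'.
exists f, f', M; split.
- split => //; rewrite -ME; apply: (int_mono m1 (measurable_funD m1 m2)) => t.
    by rewrite sqr_ge0.
  by rewrite lerDl sqr_ge0.
- split => //; rewrite -ME; apply: (int_mono m2 (measurable_funD m1 m2)) => t.
    by rewrite sqr_ge0.
  by rewrite lerDr sqr_ge0.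
apply: ae_imp xy _ => t ->//; by rewrite /f /f'; case: (y t).
Qed.

Lemma convol_lin (k A : R) K f g M N t : exp_decay w A K -> wL2_le sigma f M -> wL2_le sigma g N ->
  convol K (fun s => f s + k * g s) t = convol K f t + k * convol K g t.
Proof.
move=> dK fM gN; rewrite (convolD w0 sw t dK fM (wL2_leZ k gN)); congr (_ + _).
rewrite /convol -RintZ; last exact: (convol_intbl w0 sw t dK gN).
by congr Rint; apply/funext => s; rewrite mulrCA.
Qed.

(** The computation C (C f1 + s g2) - s (C g2 + s h1) = C C f1 - s^2 h1, where g2 = S f2
    and h1 = S S f1. *)
Lemma real_inverse (s : R) f1 f2 g1 g2 h1 M M' : s * s = 1 ->
  wL2_le sigma f1 M -> wL2_le sigma f2 M' -> Strans w sigma f1 g1 -> Strans w sigma f2 g2 ->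
  Strans w sigma g1 h1 ->
  {ae mu, forall t, convol (PK w 1) (fun r => convol (PK w 1) f1 r + s * g2 r) t +
     (- s) * (convol (PK w 1) g2 t + s * h1 t) = f1 t}.
Proof.
move=> ss fM fM' fg fg' gh; have d1 := exp_decay_PK_const w0 ltr01 (lexx 1).
apply: ae_imp (Strans_Strans w0 sigma0 sw fM fg gh) _ => t ->.
have [[N gN] _] := fg'.
rewrite (convol_lin s t d1 (convol_wL2 sigma0 sw d1 fM) gN).
move: (convol _ (convol _ _) t) (convol _ g2 t) (f1 t) => u v z.
rewrite [LHS](_ : _ = u - s * s * (u - z)); last by ring.
by rewrite ss; ring.
Qed.

(** One entry suffices: the other is the same with x1 and x2 exchanged. *)
Lemma akhiezer_component (s : R) x1 x2 : s * s = 1 -> L2 sigma x1 -> L2 sigma x2 ->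
  {ae mu, forall t,
    C_transform w (fun r => C_transform w x1 r + s%:C * S_transform w x2 r) t +
    (- s)%:C * S_transform w (fun r => C_transform w x2 r + s%:C * S_transform w x1 r) t = x1 t}.
Proof.
move=> ss /L2_re_im[f1 [f1' [M [fM fM' r1]]]] /L2_re_im[f2 [f2' [N [fN fN' r2]]]].
have [g1 S1] := Strans_exists w0 sigma0 sw fM.
have [g1' S1'] := Strans_exists w0 sigma0 sw fM'.
have [g2 S2] := Strans_exists w0 sigma0 sw fN.
have [g2' S2'] := Strans_exists w0 sigma0 sw fN'.
have [[Q q1] _] := S1; have [[Q' q1'] _] := S1'.
have [h1 T1] := Strans_exists w0 sigma0 sw q1.
have [h1' T1'] := Strans_exists w0 sigma0 sw q1'.
have d1 := exp_decay_PK_const w0 ltr01 (lexx 1).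
have y1 := re_im_ae_lin s (C_transform_re_im r1) (S_transform_re_im fN fN' S2 S2' r2).
have y2 := re_im_ae_lin s (C_transform_re_im r2) (S_transform_re_im fM fM' S1 S1' r1).
have U := Strans_lin w0 sw s (convol_wL2 sigma0 sw d1 fN) q1 (Strans_convol w0 sigma0 sw fN S2) T1.
have U' := Strans_lin w0 sw s (convol_wL2 sigma0 sw d1 fN') q1' (Strans_convol w0 sigma0 sw fN' S2') T1'.
have Y2 := S_transform_re_im (wL2_leD (convol_wL2 sigma0 sw d1 fN) (wL2_leZ s q1))
  (wL2_leD (convol_wL2 sigma0 sw d1 fN') (wL2_leZ s q1')) U U' y2.
have Z := re_im_ae_lin (- s) (C_transform_re_im y1) Y2.
apply: ae_imp (ae_and Z (ae_and r1 (ae_and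
  (real_inverse ss fM fN S1 S2 T1) (real_inverse ss fM' fN' S1' S2' T1')))) _.
by move=> t [-> [-> [-> ->]]].
Qed.

End Complexification.

(** * Inversion of the Akhiezer transforms *)

Section SignTrick.
Context {R : realType}.
Local Open Scope complex_scope.

(** Phi for s = 1 and Psi for s = -1. *)
Definition akhiezer (w s : R) (X : column R) : column R :=
  (fun t => C_transform w X.1 t + s%:C * S_transform w X.2 t,
   fun t => C_transform w X.2 t + s%:C * S_transform w X.1 t).

Lemma PhiE w : Phi w = akhiezer w 1.
Proof.
apply/funext => X; rewrite /Phi /akhiezer.
by congr pair; apply/funext => t; rewrite mul1r// addrC.
Qed.

Lemma PsiE w : Psi w = akhiezer w (- 1).
Proof.
apply/funext => X; rewrite /Psi /akhiezer.
by congr pair; apply/funext => t; rewrite rmorphN1 mulN1r// addrC.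
Qed.

Lemma akhiezerK (w sigma s : R) X : 0 < w -> 0 <= sigma -> sigma < w -> s * s = 1 ->
  L2_column sigma X -> column_ae_eq (akhiezer w (- s) (akhiezer w s X)) X.
Proof.
move=> w0 sigma0 sw ss [X1 X2]; split.
- by apply: ae_imp (akhiezer_component w0 sigma0 sw ss X1 X2) _ => t h _.
- by apply: ae_imp (akhiezer_component w0 sigma0 sw ss X2 X1) _ => t h _.
Qed.

End SignTrick.

Theorem theorem6p3 (R : realType) (omega sigma : R)
  (homega : 0 < omega) (hsigma0 : 0 <= sigma) (hsigma : sigma < omega)
  (X : column R) (hX : L2_column sigma X) :
  column_ae_eq (Psi omega (Phi omega X)) X /\
  column_ae_eq (Phi omega (Psi omega X)) X.
Proof.
rewrite PhiE PsiE; split; first exact: akhiezerK homega hsigma0 hsigma (mulr1 1) hX.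
rewrite -{1}[1]opprK; apply: akhiezerK homega hsigma0 hsigma _ hX.
by rewrite mulrNN mulr1.
Qed.
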